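(* Let $q\in\mathbb C$ with $q\neq0$ and $|q|\neq1$, let $x=\frac12(z+z^{-1})\in\mathbb C$, and let $\alpha,\beta,t\in\mathbb C\setminus\{0\}$ be such that $|q^{\alpha+\frac12}t|<1$. Then $$\sum_{n=0}^\infty\frac{(q^{\alpha+\beta+1},q^{\frac12(\alpha+\beta+3)},-q^{\frac12(\alpha+\beta+3)};q)_n}{(q^{\alpha+1},q^{\frac12(\alpha+\beta+1)},-q^{\frac12(\alpha+\beta+1)};q)_n}\,t^n\,P_n^{(\alpha,\beta)}(x|q)$$ $$=\frac{(q^{\alpha+\beta+3}t,\;q^{\alpha+\beta+2}t^2;q)_\infty}{(t,\;q^{\alpha+\beta+3}t^2;q)_\infty}\;{}_5\phi_4\left(\begin{matrix}q^{\frac12(\alpha+\beta+2)},\;q^{\frac12(\alpha+\beta+3)},\;-q^{\frac12(\alpha+\beta+3)},\;q^{\frac\alpha2+\frac14}z,\;q^{\frac\alpha2+\frac14}z^{-1}\\ q^{\alpha+1},\;-q^{\frac12(\alpha+\beta+1)},\;q^{\alpha+\beta+3}t,\;q/t\end{matrix};q,q\right)$$ $$+\frac{(q^{\alpha+\beta+2},\;-q^{\frac12(\alpha+\beta+1)}t,\;-q^{\frac12(\alpha+\beta+2)}t,\;q^{\alpha+1}t,\;q^{\frac\alpha2+\frac14}z,\;q^{\frac\alpha2+\frac14}z^{-1};q)_\infty}{(q^{\alpha+1},\;-q^{\frac12(\alpha+\beta+1)},\;-q^{\frac12(\alpha+\beta+2)},\;1/t,\;q^{\frac\alpha2+\frac14}tz,\;q^{\frac\alpha2+\frac14}tz^{-1};q)_\infty}$$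 $$\quad\times{}_5\phi_4\left(\begin{matrix}q^{\frac12(\alpha+\beta+2)}t,\;q^{\frac12(\alpha+\beta+3)}t,\;-q^{\frac12(\alpha+\beta+3)}t,\;q^{\frac\alpha2+\frac14}tz,\;q^{\frac\alpha2+\frac14}tz^{-1}\\ -q^{\frac12(\alpha+\beta+1)}t,\;qt,\;q^{\alpha+1}t,\;q^{\alpha+\beta+3}t^2\end{matrix};q,q\right).$$
   Context: Complex powers of $q$: fix a logarithm $\log q$ and set $q^s:=\exp(s\log q)$. Notation: $(a;q)_n:=\prod_{k=0}^{n-1}(1-aq^k)$, $(a;q)_\infty:=\prod_{k\ge0}(1-aq^k)$, and $(a_1,\dots,a_r;q)_n:=\prod_i (a_i;q)_n$ (also for $n=\infty$). Basic hypergeometric series: ${}_{r+1}\phi_r\left(\begin{matrix}a_1,\dots,a_{r+1}\\ b_1,\dots,b_r\end{matrix};q,u\right):=\sum_{k\ge0}\frac{(a_1,\dots,a_{r+1};q)_k}{(q,b_1,\dots,b_r;q)_k}u^k$. Askey--Wilson polynomials: for $x=\frac12(z+z^{-1})$, $$p_n(x;a,b,c,d|q):=a^{-n}(ab,ac,ad;q)_n\sum_{k=0}^n\frac{(q^{-n},q^{n-1}abcd,az,az^{-1};q)_k}{(q,ab,ac,ad;q)_k}q^k.$$ Continuous $q$-Jacobi polynomials: $$P_n^{(\alpha,\beta)}(x|q):=\frac{q^{(\frac{\alpha}{2}+\frac14)n}}{(q,-q^{\frac{\alpha+\beta+1}{2}},-q^{\frac{\alpha+\beta+2}{2}};q)_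n}\,p_n\left(x;q^{\frac{\alpha}{2}+\frac14},q^{\frac{\alpha}{2}+\frac34},-q^{\frac{\beta}{2}+\frac14},-q^{\frac{\beta}{2}+\frac34}\big|q\right).$$
   Formalization: Convergence of the left-hand series is assumed, since |q^(α+1/2)t|<1 does not imply it (it can diverge for large |z|); all denominators are assumed nonzero and the infinite products in denominators convergent, which leaves only |q|<1, as (t;q)_∞ has no nonzero limit for |q|>1. *)

(* Defs.v *)
From Stdlib Require Export Reals List.
From Stdlib Require Import ClassicalEpsilon Lra.
From Coquelicot Require Export Coquelicot.
Export ListNotations.
Open Scope R_scope.
Open Scope C_scope.

Definition Cexp (w : C) : C :=
  (exp (Re w) * cos (Im w), exp (Re w) * sin (Im w))%R.

(** [q^s] for the branch determined by a chosen logarithm [logq] of [q]. *)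
Definition cpower (logq s : C) : C := Cexp (s * logq).

Definition Cis_lim (u : nat -> C) (l : C) : Prop :=
  filterlim u eventually (@locally C_UniformSpace l).

(** Total operators, computed componentwise: they return the limit (the sum)
    whenever it exists, see [Clim_unique] and [Cseries_unique]. *)
Definition Clim (u : nat -> C) : C :=
  (real (Lim_seq (fun n => Re (u n))), real (Lim_seq (fun n => Im (u n)))).

Definition Cseries (u : nat -> C) : C :=
  Clim (@sum_n C_AbelianMonoid u).

Definition Cex_series (u : nat -> C) : Prop :=
  @ex_series C_AbsRing C_NormedModule u.

Lemma Clim_unique (u : nat -> C) (l : C) : Cis_lim u l -> Clim u = l.
Proof.
intros H; unfold Clim.
assert (H1 : is_lim_seq (fun n => Re (u n)) (Finite (Re l))).
{ apply filterlim_locally; intros eps.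
  destruct (proj1 (filterlim_locally u l) H eps) as [N HN].
  exists N; intros n Hn; exact (proj1 (HN n Hn)). }
assert (H2 : is_lim_seq (fun n => Im (u n)) (Finite (Im l))).
{ apply filterlim_locally; intros eps.
  destruct (proj1 (filterlim_locally u l) H eps) as [N HN].
  exists N; intros n Hn; exact (proj2 (HN n Hn)). }
rewrite (is_lim_seq_unique _ _ H1), (is_lim_seq_unique _ _ H2).
destruct l; reflexivity.
Qed.

Lemma Cseries_unique (u : nat -> C) (l : C) :
  @is_series C_AbsRing C_NormedModule u l -> Cseries u = l.
Proof. intros H; apply Clim_unique; exact H. Qed.

(** [(a;q)_n] *)
Fixpoint qpoch (a q : C) (n : nat) : C :=
  match n with
  | O => 1
  | S m => qpoch a q m * (1 - a * q ^ m)
  end.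

(** [(a_1,...,a_r;q)_n] *)
Definition qpochs (l : list C) (q : C) (n : nat) : C :=
  fold_right Cmult 1 (map (fun a => qpoch a q n) l).

(** [(a;q)_oo] *)
Definition qpoch_inf (a q : C) : C := Clim (qpoch a q).

(** [(a_1,...,a_r;q)_oo] *)
Definition qpochs_inf (l : list C) (q : C) : C :=
  fold_right Cmult 1 (map (fun a => qpoch_inf a q) l).

Definition qpochs_admissible (l : list C) (q : C) : Prop :=
  forall b, In b l -> forall n, qpoch b q n <> 0.

(** Convergence is automatic for [|q| < 1]; for [|q| > 1] it fails unless
    the product is [0] or [b = 0]. *)
Definition qpochs_inf_admissible (l : list C) (q : C) : Prop :=
  forall b, In b l -> exists p : C, Cis_lim (qpoch b q) p /\ p <> 0.

(** Basic hypergeometric series; [length num = S (length den)] in the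
    [r+1 phi r] case. *)
Definition phi (num den : list C) (q u : C) : C :=
  Cseries (fun k => qpochs num q k / qpochs (q :: den) q k * u ^ k).

Definition askey_wilson_z (n : nat) (z a b c d q : C) : C :=
  / a ^ n * qpochs [a * b; a * c; a * d] q n *
  @sum_n C_AbelianMonoid
    (fun k => qpochs [/ q ^ n; q ^ n / q * (a * b * c * d); a * z; a * / z] q k
              / qpochs [q; a * b; a * c; a * d] q k * q ^ k) n.

(** [p_n(x;a,b,c,d|q)]: the defining formula is evaluated at any [z] with
    [x = (z + 1/z)/2]; the choice is irrelevant by [askey_wilsonE]. *)
Definition askey_wilson (n : nat) (x a b c d q : C) : C :=
  askey_wilson_z n
    (epsilon (inhabits (1 : C)) (fun z => z <> 0 /\ x = (z + / z) / 2))
    a b c d q.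

Lemma joukowski_inj (z w : C) : z <> 0 -> w <> 0 ->
  (z + / z) / 2 = (w + / w) / 2 -> w = z \/ w = / z.
Proof.
intros hz hw h.
assert (h2 : RtoC 2 <> 0) by (intros e; injection e; lra).
assert (e : (w - z) * (w - / z) = 0).
{ replace ((w - z) * (w - / z)) with
    (w * 2 * ((w + / w) / 2 - (z + / z) / 2)) by (field; repeat split; auto).
  rewrite h; ring. }
destruct (Ceq_dec (w - z) 0) as [e1 | n1].
- left; replace w with (w - z + z) by ring; rewrite e1; ring.
- right; destruct (Ceq_dec (w - / z) 0) as [e2 | n2].
  + replace w with (w - / z + / z) by ring; rewrite e2; ring.
  + destruct (Cmult_neq_0 _ _ n1 n2 e).
Qed.

Lemma askey_wilsonE (n : nat) (z a b c d q : C) : z <> 0 ->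
  askey_wilson n ((z + / z) / 2) a b c d q = askey_wilson_z n z a b c d q.
Proof.
intros hz; unfold askey_wilson.
assert (h := epsilon_spec (inhabits (1 : C))
  (fun w => w <> 0 /\ (z + / z) / 2 = (w + / w) / 2)
  (ex_intro _ z (conj hz eq_refl))).
cbv beta in h; revert h; generalize (epsilon (inhabits (1 : C))
  (fun w => w <> 0 /\ (z + / z) / 2 = (w + / w) / 2)).
intros w [hw e].
destruct (joukowski_inj z w hz hw e) as [-> | ->]; [reflexivity |].
unfold askey_wilson_z; f_equal; apply sum_n_ext; intros k.
do 2 f_equal; unfold qpochs; simpl.
replace (/ / z) with z by (field; auto).
ring.
Qed.

Definition q_jacobi (n : nat) (alpha beta x q logq : C) : C :=
  let Q := cpower logq in
  Q ((alpha / 2 + 1 / 4) * INR n)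
  / qpochs [q; - Q ((alpha + beta + 1) / 2); - Q ((alpha + beta + 2) / 2)] q n
  * askey_wilson n x
      (Q (alpha / 2 + 1 / 4)) (Q (alpha / 2 + 3 / 4))
      (- Q (beta / 2 + 1 / 4)) (- Q (beta / 2 + 3 / 4)) q.

(* Main.v *)
(** For [|q| > 1] the product [(t;q)_oo] diverges, so the hypotheses are
    contradictory; let [|q| < 1]. Put [A = q^(alpha+beta+1)], [a = A q] and
    [f_k = (x_1,x_2;q)_k / (b_1,b_2,b_3;q)_k], where [x_1], [x_2] are
    [q^(alpha/2+1/4) z] and [q^(alpha/2+1/4) / z], and [b_1], [b_2], [b_3] are
    [q^(alpha+1)], [-q^((alpha+beta+1)/2)], [-q^((alpha+beta+2)/2)].
    The left-hand side is [sum_r c_r t^r], where up to normalization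
    [(c_r, f_k)] is a Bailey pair. Exchanging the sums over [r] and [k] in it
    diverges. Instead, with
    [E_r(u) = prod_(i < r) (u - q^i) * (a q^r u;q)_oo], Bailey inversion says
    [(a;q)_oo f(u) = sum_r c_r E_r(u)] at the points [u = q^k]. Both sides are
    analytic in [|u| < |t|], up to the explicit denominator of [f], hence equal
    there, and Abel's theorem extends the equality to [u = t].
    The right-hand side is a linear functional of the values [f(q^k)] and
    [f(t q^k)], so it remains to see that it takes [E_r] to [t^r]. For small [a]
    the values [V_r] on [E_r] satisfy
    [V_r / t^r - V_(r+1) / t^(r+1) = a t^2 (V_(r+1) / t^(r+1) - V_(r+2) / t^(r+2))]
    by telescoping, and [V_r / t^r] tends to [1]; this forces [V_r = t^r]. The
    functional is entire in [a], so the identity persists for every [a]. *)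

Require Import Defs.
From Stdlib Require Import Lra Lia ClassicalEpsilon FunctionalExtensionality.

(** * Complex limits and series *)

Definition cv (u : nat -> C) (l : C) : Prop :=
  is_lim_seq (fun n => Cmod (u n - l)) 0.

Lemma cv_Cis_lim (u : nat -> C) (l : C) : Cis_lim u l <-> cv u l.
Proof.
split; intros H.
- apply is_lim_seq_spec; intros eps; simpl.
  assert (h2 : (0 < sqrt 2)%R) by (apply sqrt_lt_R0; lra).
  assert (he : (0 < eps / sqrt 2)%R)
    by (apply Rdiv_lt_0_compat; [apply cond_pos | lra]).
  destruct (proj1 (filterlim_locally u l) H (mkposreal _ he)) as [N HN].
  exists N; intros n Hn.
  rewrite Rminus_0_r, Rabs_pos_eq by apply Cmod_ge_0.
  assert (h := C_NormedModule_mixin_compat2 l (u n) _ (HN n Hn)).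
  simpl in h; unfold minus, plus, opp in h; simpl in h.
  replace (sqrt 2 * (eps / sqrt 2))%R with (pos eps) in h by (field; lra).
  exact h.
- apply filterlim_locally; intros eps.
  apply is_lim_seq_spec in H; destruct (H eps) as [N HN]; exists N; intros n Hn.
  apply C_NormedModule_mixin_compat1.
  assert (h := HN n Hn).
  rewrite Rminus_0_r, Rabs_pos_eq in h by apply Cmod_ge_0; exact h.
Qed.

Lemma cv_le (u : nat -> C) (l : C) (b : nat -> R) :
  (forall n, Cmod (u n - l) <= b n)%R -> is_lim_seq b 0 -> cv u l.
Proof.
intros h hb; apply (is_lim_seq_le_le (fun _ => 0%R) _ b).
- intros n; split; [apply Cmod_ge_0 | apply h].
- apply is_lim_seq_const.
- exact hb.
Qed.

Lemma cv_ext (u v : nat -> C) (l : C) : (forall n, u n = v n) -> cv u l -> cv v l.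
Proof. intros h; apply is_lim_seq_ext; intros n; now rewrite h. Qed.

Lemma cv_const (c : C) : cv (fun _ => c) c.
Proof.
apply cv_le with (fun _ => 0%R); [|apply is_lim_seq_const].
intros _; replace (c - c) with (RtoC 0) by ring; rewrite Cmod_0; lra.
Qed.

Lemma cv_Cmod (u : nat -> C) (l : C) : cv u l -> is_lim_seq (fun n => Cmod (u n)) (Cmod l).
Proof.
intros h.
apply (is_lim_seq_le_le (fun n => Cmod l - Cmod (u n - l))%R _
  (fun n => Cmod l + Cmod (u n - l))%R).
- intros n; split.
  + assert (h1 := Cmod_triangle (u n) (l - u n)).
    replace (u n + (l - u n)) with l in h1 by ring.
    replace (l - u n) with (- (u n - l)) in h1 by ring; rewrite Cmod_opp in h1; lra.
  + assert (h1 := Cmod_triangle l (u n - l)).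
    replace (l + (u n - l)) with (u n) in h1 by ring; lra.
- replace (Finite (Cmod l)) with (Finite (Cmod l - 0)) by (f_equal; ring).
  apply is_lim_seq_minus'; [apply is_lim_seq_const | exact h].
- replace (Finite (Cmod l)) with (Finite (Cmod l + 0)) by (f_equal; ring).
  apply is_lim_seq_plus'; [apply is_lim_seq_const | exact h].
Qed.

Lemma cv_plus (u v : nat -> C) (l m : C) :
  cv u l -> cv v m -> cv (fun n => u n + v n) (l + m).
Proof.
intros hu hv; apply cv_le with (fun n => Cmod (u n - l) + Cmod (v n - m))%R.
- intros n; replace (u n + v n - (l + m)) with ((u n - l) + (v n - m)) by ring.
  apply Cmod_triangle.
- replace (Finite 0) with (Finite (0 + 0)) by (f_equal; ring).
  now apply is_lim_seq_plus'.
Qed.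

Lemma cv_mult (u v : nat -> C) (l m : C) :
  cv u l -> cv v m -> cv (fun n => u n * v n) (l * m).
Proof.
intros hu hv.
apply cv_le with (fun n => Cmod (u n - l) * Cmod (v n) + Cmod l * Cmod (v n - m))%R.
- intros n; replace (u n * v n - l * m) with ((u n - l) * v n + l * (v n - m)) by ring.
  rewrite <- !Cmod_mult; apply Cmod_triangle.
- replace (Finite 0) with (Finite (0 * Cmod m + Cmod l * 0)) by (f_equal; ring).
  apply is_lim_seq_plus'; apply is_lim_seq_mult'; auto using is_lim_seq_const, cv_Cmod.
Qed.

Lemma cv_scal (c : C) (u : nat -> C) (l : C) : cv u l -> cv (fun n => c * u n) (c * l).
Proof. intros h; apply cv_mult; [apply cv_const | exact h]. Qed.

Lemma cv_minus (u v : nat -> C) (l m : C) :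
  cv u l -> cv v m -> cv (fun n => u n - v n) (l - m).
Proof.
intros hu hv; apply cv_ext with (fun n => u n + (- (1)) * v n); [intros; ring|].
replace (l - m) with (l + (- (1)) * m) by ring.
now apply cv_plus; [|apply cv_scal].
Qed.

Lemma cv_unique (u : nat -> C) (l m : C) : cv u l -> cv u m -> l = m.
Proof.
intros hl hm.
assert (h := cv_minus _ _ _ _ hl hm).
apply cv_Cmod in h.
assert (h0 : is_lim_seq (fun n => Cmod (u n - u n)) 0).
{ apply is_lim_seq_ext with (fun _ => 0%R); [|apply is_lim_seq_const].
  intros n; replace (u n - u n) with (RtoC 0) by ring; now rewrite Cmod_0. }
assert (e := is_lim_seq_unique _ _ h); rewrite (is_lim_seq_unique _ _ h0) in e.
injection e; intros e1.
assert (e2 := Cmod_eq_0 (l - m) (eq_sym e1)).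
replace l with (l - m + m) by ring; rewrite e2; ring.
Qed.

Lemma cv_S (u : nat -> C) (l : C) : cv (fun n => u (S n)) l <-> cv u l.
Proof. symmetry; apply (is_lim_seq_incr_1 (fun n => Cmod (u n - l))). Qed.

Lemma cv_shift (u : nat -> C) (l : C) (N : nat) : cv u l -> cv (fun n => u (n + N)%nat) l.
Proof. apply (is_lim_seq_incr_n (fun n => Cmod (u n - l)) N). Qed.

Lemma cv_bound (u : nat -> C) (l : C) (M : R) :
  cv u l -> (forall n, Cmod (u n) <= M)%R -> (Cmod l <= M)%R.
Proof.
intros h hM; apply cv_Cmod in h.
apply (is_lim_seq_le (fun n => Cmod (u n)) (fun _ => M) (Cmod l) M); auto using is_lim_seq_const.
Qed.

Fixpoint psum (a : nat -> C) (n : nat) : C :=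
  match n with O => 0 | S m => psum a m + a m end.

Fixpoint rsum (a : nat -> R) (n : nat) : R :=
  match n with O => 0%R | S m => (rsum a m + a m)%R end.

Definition cs (a : nat -> C) (l : C) : Prop := cv (psum a) l.

Lemma psum_sum_n (a : nat -> C) (n : nat) : @sum_n C_AbelianMonoid a n = psum a (S n).
Proof.
induction n as [|n IH].
- rewrite sum_O; simpl; ring.
- rewrite sum_Sn, IH; reflexivity.
Qed.

Lemma rsum_sum_n (a : nat -> R) (n : nat) : sum_n a n = rsum a (S n).
Proof.
induction n as [|n IH].
- rewrite sum_O; simpl; ring.
- rewrite sum_Sn, IH; reflexivity.
Qed.

Lemma cs_is_series (a : nat -> C) (l : C) :
  @is_series C_AbsRing C_NormedModule a l <-> cs a l.
Proof.
unfold cs; rewrite <- cv_S, <- cv_Cis_lim; split; intros h.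
- apply filterlim_ext with (@sum_n C_AbelianMonoid a); [apply psum_sum_n | exact h].
- apply filterlim_ext with (fun n => psum a (S n)); [|exact h].
  intros n; symmetry; apply psum_sum_n.
Qed.

Lemma cs_Cseries (a : nat -> C) (l : C) : cs a l -> Cseries a = l.
Proof. intros h; apply Cseries_unique, cs_is_series, h. Qed.

Lemma cs_ex (a : nat -> C) (l : C) : cs a l -> cs a (Cseries a).
Proof. intros h; now rewrite (cs_Cseries _ _ h). Qed.

Lemma psum_ext (a b : nat -> C) (n : nat) :
  (forall k, (k < n)%nat -> a k = b k) -> psum a n = psum b n.
Proof.
induction n as [|n IH]; intros h; simpl; [reflexivity|].
rewrite IH, h; auto.
Qed.

Lemma psum_plus (a b : nat -> C) (n : nat) :
  psum (fun k => a k + b k) n = psum a n + psum b n.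
Proof. induction n as [|n IH]; simpl; [ring | rewrite IH; ring]. Qed.

Lemma psum_scal (c : C) (a : nat -> C) (n : nat) :
  psum (fun k => c * a k) n = c * psum a n.
Proof. induction n as [|n IH]; simpl; [ring | rewrite IH; ring]. Qed.

Lemma psum_zero (a : nat -> C) (n : nat) :
  (forall k, (k < n)%nat -> a k = 0) -> psum a n = 0.
Proof.
induction n as [|n IH]; intros h; simpl; [reflexivity|].
rewrite IH, h; auto; ring.
Qed.

Lemma psum_exchange (a : nat -> nat -> C) (m n : nat) :
  psum (fun i => psum (a i) n) m = psum (fun j => psum (fun i => a i j) m) n.
Proof.
induction m as [|m IH]; simpl.
- induction n as [|n IH]; simpl; [reflexivity | rewrite <- IH; ring].
- rewrite IH, <- psum_plus; reflexivity.
Qed.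

Lemma psum_split (a : nat -> C) (m n : nat) :
  psum a (m + n) = psum a m + psum (fun k => a (m + k)%nat) n.
Proof.
induction n as [|n IH]; [rewrite Nat.add_0_r; simpl; ring|].
rewrite Nat.add_succ_r; simpl; rewrite IH; ring.
Qed.

Lemma psum_S_l (a : nat -> C) (n : nat) :
  psum a (S n) = a O + psum (fun k => a (S k)) n.
Proof. replace (S n) with (1 + n)%nat by lia; rewrite psum_split; simpl; ring. Qed.

Lemma rsum_le (a b : nat -> R) (n : nat) :
  (forall k, a k <= b k)%R -> (rsum a n <= rsum b n)%R.
Proof.
intros h; induction n as [|n IH]; simpl; [lra | specialize (h n); lra].
Qed.

Lemma rsum_scal (c : R) (a : nat -> R) (n : nat) :
  rsum (fun k => c * a k)%R n = (c * rsum a n)%R.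
Proof. induction n as [|n IH]; simpl; [ring | rewrite IH; ring]. Qed.

Lemma rsum_plus (a b : nat -> R) (n : nat) :
  rsum (fun k => a k + b k)%R n = (rsum a n + rsum b n)%R.
Proof. induction n as [|n IH]; simpl; [ring | rewrite IH; ring]. Qed.

Lemma rsum_nonneg (a : nat -> R) (n : nat) :
  (forall k, 0 <= a k)%R -> (0 <= rsum a n)%R.
Proof. intros h; induction n as [|n IH]; simpl; [lra | specialize (h n); lra]. Qed.

Lemma rsum_mono (a : nat -> R) (m n : nat) :
  (forall k, 0 <= a k)%R -> (m <= n)%nat -> (rsum a m <= rsum a n)%R.
Proof.
intros h; induction 1 as [|n _ IH]; simpl; [lra | specialize (h n); lra].
Qed.

Lemma psum_le_rsum (a : nat -> C) (b : nat -> R) (n : nat) :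
  (forall k, Cmod (a k) <= b k)%R -> (Cmod (psum a n) <= rsum b n)%R.
Proof.
intros h; induction n as [|n IH]; simpl; [rewrite Cmod_0; lra|].
eapply Rle_trans; [apply Cmod_triangle | specialize (h n); lra].
Qed.

Lemma rsum_geom (x : R) (n : nat) : (0 <= x < 1)%R -> (rsum (pow x) n <= / (1 - x))%R.
Proof.
intros hx.
assert (e : (rsum (pow x) n * (1 - x) = 1 - x ^ n)%R)
  by (induction n as [|n IH]; simpl; [ring | rewrite Rmult_plus_distr_r, IH; ring]).
assert (h := pow_le x n (proj1 hx)).
apply Rmult_le_reg_r with (1 - x)%R; [lra|].
rewrite e, Rinv_l; lra.
Qed.

Lemma lim_rsum (b : nat -> R) (m : R) : is_series b m <-> is_lim_seq (rsum b) m.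
Proof.
unfold is_series; split; intros h.
- apply is_lim_seq_incr_1; apply is_lim_seq_ext with (sum_n b); [apply rsum_sum_n | exact h].
- apply is_lim_seq_incr_1 in h.
  change (is_lim_seq (sum_n b) m).
  apply (is_lim_seq_ext (fun n => rsum b (S n)) (sum_n b));
    [intros; symmetry; apply rsum_sum_n | exact h].
Qed.

Lemma ex_series_bounded (b : nat -> R) (M : R) :
  (forall n, 0 <= b n)%R -> (forall n, rsum b n <= M)%R -> ex_series b.
Proof.
intros h0 hM.
destruct (ex_finite_lim_seq_incr (rsum b) M) as [l hl].
- intros n; apply rsum_mono; auto.
- exact hM.
- exists l; now apply lim_rsum.
Qed.

Lemma cs_dominated (a : nat -> C) (b : nat -> R) :
  (forall k, Cmod (a k) <= b k)%R -> ex_series b -> cs a (Cseries a).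
Proof.
intros h hb.
destruct (ex_series_le (K := C_AbsRing) (V := C_CompleteNormedModule) a b) as [l hl].
- exact h.
- exact hb.
- apply cs_ex with l; now apply cs_is_series.
Qed.

Lemma cs_tail (a : nat -> C) (b : nat -> R) (s : C) (m : R) (K : nat) :
  (forall k, Cmod (a k) <= b k)%R -> cs a s -> is_series b m ->
  (Cmod (s - psum a K) <= m - rsum b K)%R.
Proof.
intros h hs hm; apply lim_rsum in hm.
assert (h1 : cv (fun n => psum a (n + K) - psum a K) (s - psum a K))
  by (apply cv_minus; [now apply (cv_shift (psum a)) | apply cv_const]).
apply cv_Cmod in h1.
assert (h2 : is_lim_seq (fun n => rsum b (n + K) - rsum b K)%R (m - rsum b K)%R)
  by (apply is_lim_seq_minus'; [now apply (is_lim_seq_incr_n (rsum b) K) | apply is_lim_seq_const]).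
refine (is_lim_seq_le _ _ (Finite _) (Finite _) _ h1 h2); intros n.
rewrite Nat.add_comm; induction n as [|n IH].
- rewrite Nat.add_0_r; replace (psum a K - psum a K) with (RtoC 0) by ring.
  rewrite Cmod_0; lra.
- rewrite Nat.add_succ_r; simpl.
  replace (psum a (K + n) + a (K + n)%nat - psum a K)
    with ((psum a (K + n) - psum a K) + a (K + n)%nat) by ring.
  eapply Rle_trans; [apply Cmod_triangle|]; specialize (h (K + n)%nat); lra.
Qed.

Lemma cs_bound (a : nat -> C) (s : C) (M : R) :
  cs a s -> (forall n, rsum (fun k => Cmod (a k)) n <= M)%R -> (Cmod s <= M)%R.
Proof.
intros h hM; apply (cv_bound _ _ _ h); intros n.
eapply Rle_trans; [|apply (hM n)]; apply psum_le_rsum; intros; lra.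
Qed.

Lemma cs_ext (a b : nat -> C) (l : C) : (forall n, a n = b n) -> cs a l -> cs b l.
Proof. intros h; apply cv_ext; intros n; apply psum_ext; auto. Qed.

Lemma cs_plus (a b : nat -> C) (l m : C) :
  cs a l -> cs b m -> cs (fun n => a n + b n) (l + m).
Proof.
intros ha hb; apply cv_ext with (fun n => psum a n + psum b n);
  [intros; symmetry; apply psum_plus | now apply cv_plus].
Qed.

Lemma cs_scal (c : C) (a : nat -> C) (l : C) : cs a l -> cs (fun n => c * a n) (c * l).
Proof.
intros ha; apply cv_ext with (fun n => c * psum a n);
  [intros; symmetry; apply psum_scal | now apply cv_scal].
Qed.

Lemma cs_S (a : nat -> C) (l : C) : cs (fun n => a (S n)) l <-> cs a (a O + l).
Proof.
unfold cs; rewrite <- (cv_S (psum a)); split; intros h.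
- apply cv_ext with (fun n => a O + psum (fun k => a (S k)) n);
    [intros; symmetry; apply psum_S_l | apply cv_plus; [apply cv_const | exact h]].
- replace l with ((a O + l) - a O) by ring.
  apply cv_ext with (fun n => psum a (S n) - a O);
    [intros n; rewrite psum_S_l; ring | apply cv_minus; [exact h | apply cv_const]].
Qed.

Lemma cs_unique (a : nat -> C) (l m : C) : cs a l -> cs a m -> l = m.
Proof. apply cv_unique. Qed.

Lemma cs_finite (a : nat -> C) (N : nat) :
  (forall k, (N <= k)%nat -> a k = 0) -> cs a (psum a N).
Proof.
intros h; apply (is_lim_seq_incr_n (fun n => Cmod (psum a n - psum a N)) N).
apply cv_ext with (fun _ => psum a N); [|apply cv_const].
intros n; rewrite Nat.add_comm, psum_split.
rewrite (psum_zero (fun k => a (N + k)%nat)); [ring|].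
intros k _; apply h; lia.
Qed.

Lemma tannery (a : nat -> nat -> C) (c : nat -> C) (b : nat -> R) :
  (forall n k, Cmod (a n k) <= b k)%R -> ex_series b ->
  (forall k, cv (fun n => a n k) (c k)) ->
  cs c (Cseries c) /\ cv (fun n => Cseries (a n)) (Cseries c).
Proof.
intros h hb hc.
assert (hcb : forall k, (Cmod (c k) <= b k)%R).
{ intros k; apply (cv_bound _ _ _ (hc k)); intros n; apply h. }
assert (hsc := cs_dominated c b hcb hb).
split; [exact hsc|].
assert (hm := Series_correct _ hb); set (m := Series b) in hm.
apply is_lim_seq_spec; intros eps.
assert (he : (0 < eps / 3)%R) by (assert (h0 := cond_pos eps); lra).
assert (hm' := proj1 (lim_rsum _ _) hm); apply is_lim_seq_spec in hm'.
destruct (hm' (mkposreal _ he)) as [K HK].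
assert (hK := HK K (Nat.le_refl _)); simpl in hK.
assert (hps : cv (fun n => psum (a n) K) (psum c K)).
{ clear HK hK; induction K as [|K IH]; simpl; [apply cv_const | now apply cv_plus]. }
apply is_lim_seq_spec in hps.
destruct (hps (mkposreal _ he)) as [N HN].
exists N; intros n Hn; specialize (HN n Hn); simpl in HN.
rewrite Rminus_0_r, Rabs_pos_eq in HN by apply Cmod_ge_0.
rewrite Rminus_0_r, Rabs_pos_eq by apply Cmod_ge_0.
assert (t1 := cs_tail c b _ m K hcb hsc hm).
assert (t2 := cs_tail (a n) b _ m K (h n) (cs_dominated _ _ (h n) hb) hm).
replace (Cseries (a n) - Cseries c) with
  ((Cseries (a n) - psum (a n) K) + ((psum (a n) K - psum c K) + - (Cseries c - psum c K)))
  by ring.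
eapply Rle_lt_trans; [apply Cmod_triangle|].
assert (t3 := Cmod_triangle (psum (a n) K - psum c K) (- (Cseries c - psum c K))).
rewrite Cmod_opp in t3.
apply Rabs_lt_between in hK; lra.
Qed.

Lemma fubini (a : nat -> nat -> C) (M : nat -> R) :
  (forall n J, rsum (fun j => Cmod (a n j)) J <= M n)%R -> ex_series M ->
  exists s, cs (fun n => Cseries (a n)) s /\ cs (fun j => Cseries (fun n => a n j)) s.
Proof.
intros h hM.
assert (hr : forall n, cs (a n) (Cseries (a n))).
{ intros n; apply cs_dominated with (fun j => Cmod (a n j)); [intros; lra|].
  apply ex_series_bounded with (M n); auto using Cmod_ge_0. }
assert (hc : forall j n, (Cmod (a n j) <= M n)%R).
{ intros j n; eapply Rle_trans; [|apply (h n (S j))]; simpl.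
  assert (h0 := rsum_nonneg (fun j => Cmod (a n j)) j (fun k => Cmod_ge_0 _)); lra. }
exists (Cseries (fun n => Cseries (a n))).
destruct (tannery (fun J n => psum (a n) J) (fun n => Cseries (a n)) M) as [h1 h2].
- intros J n; eapply Rle_trans; [|apply (h n J)]; apply psum_le_rsum; intros; lra.
- exact hM.
- intros n; exact (hr n).
- split; [exact h1|].
  apply cv_ext with (2 := h2); intros J; apply cs_Cseries.
  induction J as [|J IH]; simpl.
  + exact (cs_finite (fun _ => 0) 0 (fun _ _ => eq_refl)).
  + apply cs_plus; [exact IH | exact (cs_dominated _ _ (hc J) hM)].
Qed.

Lemma ex_series_Rscal (c : R) (b : nat -> R) :
  ex_series b -> ex_series (fun n => c * b n)%R.
Proof.
intros [l hl]; exists (l * c)%R.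
apply is_series_ext with (fun n => b n * c)%R; [intros; apply Rmult_comm | now apply is_series_scal_r].
Qed.

Lemma ex_series_pow (x : R) : (0 <= x < 1)%R -> ex_series (pow x).
Proof.
intros hx; apply ex_series_bounded with (/ (1 - x))%R.
- intros n; now apply pow_le.
- intros n; now apply rsum_geom.
Qed.

Lemma cv_inv (u : nat -> C) (l : C) :
  (forall n, u n <> 0) -> l <> 0 -> cv u l -> cv (fun n => / u n) (/ l).
Proof.
intros hu hl h.
assert (hm : Cmod l <> 0%R) by (intros e; apply hl, Cmod_eq_0, e).
apply cv_le with (fun n => Cmod (u n - l) * (/ Cmod (u n) * / Cmod l))%R.
- intros n; right; rewrite <- !Cmod_inv, <- !Cmod_mult by auto.
  rewrite <- Cmod_opp; f_equal; field; auto.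
- replace (Finite 0) with (Finite (0 * (/ Cmod l * / Cmod l))) by (f_equal; ring).
  apply is_lim_seq_mult'; [exact h|].
  apply is_lim_seq_mult'; [|apply is_lim_seq_const].
  apply (is_lim_seq_inv _ (Cmod l)); [now apply cv_Cmod | intros e; injection e; exact hm].
Qed.

Lemma cs_telescope (a Z : nat -> C) (l : C) :
  (forall k, a k = Z k - Z (S k)) -> cv Z l -> cs a (Z O - l).
Proof.
intros ha hZ; apply cv_ext with (fun n => Z O - Z n).
- intros n; induction n as [|n IH]; simpl; [ring | rewrite <- IH, ha; ring].
- apply cv_minus; [apply cv_const | exact hZ].
Qed.

(** * Absolutely convergent power series *)

(** [F] is on the disc of radius [rho] the sum of a power series whose
    coefficients have weighted l^1 norm at most [M]. *)
Definition l1_analytic (rho M : R) (F : C -> C) : Prop := exists h : nat -> C,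
  (forall J, rsum (fun j => Cmod (h j) * rho ^ j) J <= M)%R /\
  (forall u, (Cmod u <= rho)%R -> cs (fun j => h j * u ^ j) (F u)).

Lemma l1_ext (rho M : R) (F G : C -> C) :
  (forall u, (Cmod u <= rho)%R -> F u = G u) -> l1_analytic rho M F -> l1_analytic rho M G.
Proof. intros e [h [h1 h2]]; exists h; split; auto; intros u hu; rewrite <- e; auto. Qed.

Lemma l1_mono (rho M M' : R) (F : C -> C) :
  (M <= M')%R -> l1_analytic rho M F -> l1_analytic rho M' F.
Proof.
intros e [h [h1 h2]]; exists h; split; auto.
intros J; eapply Rle_trans; eauto.
Qed.

Lemma cs_single (c : C) (u : nat -> C) : u O = 1 ->
  cs (fun j => (match j with O => c | _ => 0 end) * u j) c.
Proof.
intros e.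
assert (h := cs_finite (fun j => (match j with O => c | _ => 0 end) * u j) 1).
simpl in h; rewrite e in h; replace (0 + c * 1) with c in h by ring.
apply h; intros [|k] hk; [lia | ring].
Qed.

Lemma l1_const (rho : R) (c : C) : l1_analytic rho (Cmod c) (fun _ => c).
Proof.
exists (fun j => match j with O => c | _ => 0 end); split.
- intros [|J]; simpl; [apply Cmod_ge_0|].
  induction J as [|J IH]; simpl in *; [lra | rewrite Cmod_0; lra].
- intros u _; now apply cs_single.
Qed.

Lemma l1_scal (rho M : R) (c : C) (F : C -> C) :
  l1_analytic rho M F -> l1_analytic rho (Cmod c * M) (fun u => c * F u).
Proof.
intros [h [h1 h2]]; exists (fun j => c * h j); split.
- intros J.
  replace (rsum _ J) with (rsum (fun j => Cmod c * (Cmod (h j) * rho ^ j))%R J).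
  + rewrite rsum_scal; apply Rmult_le_compat_l; auto using Cmod_ge_0.
  + induction J as [|J IH]; simpl; [reflexivity | rewrite IH, Cmod_mult; ring].
- intros u hu; apply cs_ext with (fun j => c * (h j * u ^ j)); [intros; ring|].
  apply cs_scal; auto.
Qed.

Lemma l1_plus (rho M N : R) (F G : C -> C) : (0 <= rho)%R ->
  l1_analytic rho M F -> l1_analytic rho N G -> l1_analytic rho (M + N) (fun u => F u + G u).
Proof.
intros hr [h [h1 h2]] [g [g1 g2]]; exists (fun j => h j + g j); split.
- intros J; eapply Rle_trans; [|apply Rplus_le_compat; [apply h1 | apply g1]].
  rewrite <- rsum_plus; apply rsum_le; intros k.
  rewrite <- Rmult_plus_distr_r; apply Rmult_le_compat_r; [now apply pow_le|].
  apply Cmod_triangle.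
- intros u hu; apply cs_ext with (fun j => h j * u ^ j + g j * u ^ j); [intros; ring|].
  apply cs_plus; auto.
Qed.

Lemma l1_mulX (rho M : R) (F : C -> C) : (0 <= rho)%R ->
  l1_analytic rho M F -> l1_analytic rho (rho * M) (fun u => u * F u).
Proof.
intros hr [h [h1 h2]]; exists (fun j => match j with O => 0 | S i => h i end : C); split.
- assert (e : forall J, rsum (fun j => Cmod (match j with O => 0 | S i => h i end : C) * rho ^ j)%R (S J)
    = (rho * rsum (fun j => Cmod (h j) * rho ^ j) J)%R).
  { intros J; induction J as [|J IH]; [simpl; rewrite Cmod_0; ring|].
    simpl in *; rewrite IH; ring. }
  intros [|J]; [|rewrite e; now apply Rmult_le_compat_l].
  simpl; apply Rmult_le_pos; auto; exact (h1 O).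
- intros u hu.
  replace (u * F u) with ((fun j => (match j with O => 0 | S i => h i end : C) * u ^ j) O + u * F u)
    by (simpl; ring).
  apply cs_S; apply cs_ext with (fun j => u * (h j * u ^ j)); [intros; simpl; ring|].
  apply cs_scal; auto.
Qed.

Lemma l1_lin (rho M : R) (c d : C) (F : C -> C) : (0 <= rho)%R ->
  l1_analytic rho M F ->
  l1_analytic rho (M * (Cmod c + Cmod d * rho)) (fun u => (c + d * u) * F u).
Proof.
intros hr hF; apply l1_ext with (fun u => c * F u + d * (u * F u)); [intros; ring|].
replace (M * (Cmod c + Cmod d * rho))%R with (Cmod c * M + Cmod d * (rho * M))%R by ring.
apply l1_plus; auto using l1_scal, l1_mulX.
Qed.

Lemma pseries_term_le (h : nat -> C) (rho : R) (u : C) (j : nat) : (Cmod u <= rho)%R ->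
  (Cmod (h j * u ^ j) <= Cmod (h j) * rho ^ j)%R.
Proof.
intros hu; rewrite Cmod_mult, Cmod_pow; apply Rmult_le_compat_l; [apply Cmod_ge_0|].
apply pow_incr; split; [apply Cmod_ge_0 | exact hu].
Qed.

Lemma l1_bound (rho M : R) (F : C -> C) (u : C) :
  l1_analytic rho M F -> (Cmod u <= rho)%R -> (Cmod (F u) <= M)%R.
Proof.
intros [h [h1 h2]] hu; apply (cs_bound _ _ _ (h2 u hu)); intros n.
eapply Rle_trans; [|apply (h1 n)]; apply rsum_le; intros k; now apply pseries_term_le.
Qed.

Lemma pseries_ex (h : nat -> C) (rho M : R) : (0 <= rho)%R ->
  (forall J, rsum (fun j => Cmod (h j) * rho ^ j) J <= M)%R ->
  ex_series (fun j => Cmod (h j) * rho ^ j)%R.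
Proof.
intros hr h1; apply ex_series_bounded with M; auto.
intros n; apply Rmult_le_pos; [apply Cmod_ge_0 | now apply pow_le].
Qed.

Lemma cv_pow (u : nat -> C) (l : C) (j : nat) : cv u l -> cv (fun n => u n ^ j) (l ^ j).
Proof. intros hu; induction j as [|j IH]; simpl; [apply cv_const | now apply cv_mult]. Qed.

Lemma l1_cont (rho M : R) (F : C -> C) (u : nat -> C) (l : C) :
  l1_analytic rho M F -> (forall n, Cmod (u n) <= rho)%R -> cv u l ->
  cv (fun n => F (u n)) (F l).
Proof.
intros [h [h1 h2]] hu hl.
assert (hlr : (Cmod l <= rho)%R) by (now apply cv_bound with u).
assert (hr : (0 <= rho)%R) by (eapply Rle_trans; [apply Cmod_ge_0 | exact hlr]).
destruct (tannery (fun n j => h j * u n ^ j) (fun j => h j * l ^ j)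
  (fun j => Cmod (h j) * rho ^ j)%R) as [_ H].
- intros n k; now apply pseries_term_le.
- now apply pseries_ex with M.
- intros k; now apply cv_scal, cv_pow.
- rewrite (cs_Cseries _ _ (h2 l hlr)) in H.
  apply cv_ext with (2 := H); intros n; now apply cs_Cseries, h2.
Qed.


Lemma l1_series (rho : R) (M : nat -> R) (M0 : R) (F : nat -> C -> C) : (0 < rho)%R ->
  (forall n, l1_analytic rho (M n) (F n)) -> (forall n, rsum M n <= M0)%R ->
  l1_analytic rho M0 (fun u => Cseries (fun n => F n u)).
Proof.
intros hr hF hM.
assert (hr0 := Rlt_le _ _ hr).
set (h := fun n => proj1_sig (constructive_indefinite_description _ (hF n))).
assert (hh : forall n,
  (forall J, rsum (fun j => Cmod (h n j) * rho ^ j) J <= M n)%R /\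
  (forall u, (Cmod u <= rho)%R -> cs (fun j => h n j * u ^ j) (F n u)))
  by (intros n; exact (proj2_sig (constructive_indefinite_description _ (hF n)))).
clearbody h.
assert (hM0 : forall n, (0 <= M n)%R) by (intros n; exact (proj1 (hh n) O)).
assert (hMs : ex_series M) by (now apply ex_series_bounded with M0).
assert (hjn : forall j, cs (fun n => h n j) (Cseries (fun n => h n j))).
{ intros j; apply cs_dominated with (fun n => / rho ^ j * M n)%R.
  - intros n; apply Rmult_le_reg_l with (rho ^ j)%R; [now apply pow_lt|].
    rewrite <- Rmult_assoc, Rinv_r, Rmult_1_l by (apply pow_nonzero; lra).
    eapply Rle_trans; [|apply (proj1 (hh n) (S j))]; simpl.
    assert (h0 := rsum_nonneg (fun j => Cmod (h n j) * rho ^ j)%R j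
      (fun k => Rmult_le_pos _ _ (Cmod_ge_0 _) (pow_le _ k hr0))); lra.
  - now apply ex_series_Rscal. }
exists (fun j => Cseries (fun n => h n j)); split.
- intros J.
  assert (hl : is_lim_seq (fun N => rsum (fun j => Cmod (psum (fun n => h n j) N) * rho ^ j)%R J)
    (rsum (fun j => Cmod (Cseries (fun n => h n j)) * rho ^ j)%R J)).
  { induction J as [|J IH]; simpl; [apply is_lim_seq_const|].
    apply is_lim_seq_plus'; [exact IH|].
    apply is_lim_seq_mult'; [apply cv_Cmod, hjn | apply is_lim_seq_const]. }
  refine (is_lim_seq_le _ (fun _ => M0) (Finite _) (Finite _) _ hl (is_lim_seq_const _)).
  intros N; eapply Rle_trans; [|apply (hM N)]; clear hl.
  induction N as [|N IH]; simpl.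
  + induction J as [|J IH]; simpl; [apply Rle_refl|].
    rewrite Cmod_0 in *; rewrite (Rmult_0_l (rho ^ J)), Rplus_0_r; exact IH.
  + eapply Rle_trans; [|apply Rplus_le_compat; [exact IH | apply (proj1 (hh N) J)]].
    rewrite <- rsum_plus; apply rsum_le; intros k; rewrite <- Rmult_plus_distr_r.
    apply Rmult_le_compat_r; [now apply pow_le | apply Cmod_triangle].
- intros u hu.
  destruct (fubini (fun n j => h n j * u ^ j) M) as [s [s1 s2]].
  + intros n J; eapply Rle_trans; [|apply (proj1 (hh n) J)]; apply rsum_le; intros k.
    now apply pseries_term_le.
  + exact hMs.
  + assert (e : s = Cseries (fun n => F n u)).
    { symmetry; apply cs_Cseries; apply cs_ext with (2 := s1); intros n.
      now apply cs_Cseries, (proj2 (hh n)). }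
    rewrite <- e; apply cs_ext with (2 := s2); intros j.
    apply cs_Cseries; apply cs_ext with (fun n => u ^ j * h n j); [intros; ring|].
    rewrite Cmult_comm; apply cs_scal, hjn.
Qed.

Lemma pseries_const_zero (h : nat -> C) (rho M : R) (w : nat -> C) :
  (0 < rho)%R -> cv w 0 -> (forall k, Cmod (w k) <= rho)%R ->
  (forall J, rsum (fun j => Cmod (h j) * rho ^ j) J <= M)%R ->
  (forall k, cs (fun i => h i * w k ^ i) 0) -> h O = 0.
Proof.
intros hr hw hwr h1 h2.
destruct (tannery (fun n j => h j * w n ^ j) (fun j => h j * 0 ^ j)
  (fun j => Cmod (h j) * rho ^ j)%R) as [H1 H2].
- intros n k; now apply pseries_term_le.
- apply pseries_ex with M; auto; lra.
- intros k; now apply cv_scal, cv_pow.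
- apply cv_ext with (v := fun _ => 0) in H2; [|intros n; now apply cs_Cseries].
  assert (e1 := cv_unique _ _ _ H2 (cv_const 0)).
  rewrite e1 in H1; apply cs_unique with (2 := H1).
  apply cs_ext with (fun i => match i with O => h O | _ => 0 end * 0 ^ i);
    [intros [|i]; simpl; ring | now apply cs_single].
Qed.

Lemma pseries_coef_zero (rho M : R) (w : nat -> C) (j : nat) : forall h : nat -> C,
  (0 < rho)%R -> cv w 0 -> (forall k, w k <> 0) -> (forall k, Cmod (w k) <= rho)%R ->
  (forall J, rsum (fun j => Cmod (h j) * rho ^ j) J <= M)%R ->
  (forall k, cs (fun i => h i * w k ^ i) 0) -> h j = 0.
Proof.
revert M; induction j as [|j IH]; intros M h hr hw hw0 hwr h1 h2.
{ now apply pseries_const_zero with rho M w. }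
assert (e0 : h O = 0) by (now apply pseries_const_zero with rho M w).
apply (IH (M / rho)%R (fun i => h (S i))); auto.
- intros J; apply Rmult_le_reg_l with rho; [lra|].
  replace (rho * (M / rho))%R with M by (field; lra).
  eapply Rle_trans; [|apply (h1 (S J))]; rewrite <- rsum_scal; clear - e0.
  induction J as [|J IH]; simpl in *; [rewrite e0, Cmod_0; lra | lra].
- intros k.
  assert (hk := h2 k).
  replace (RtoC 0) with (h O * w k ^ 0 + 0) in hk by (rewrite e0; ring).
  apply (cs_S (fun i => h i * w k ^ i)) in hk.
  replace (RtoC 0) with (/ w k * 0) by ring.
  apply cs_ext with (fun i => / w k * (h (S i) * w k ^ S i)); [|now apply cs_scal].
  intros i; simpl; field; auto.
Qed.

Lemma l1_identity (rho M : R) (F : C -> C) (w : nat -> C) : (0 < rho)%R ->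
  l1_analytic rho M F -> cv w 0 -> (forall k, w k <> 0) -> (forall k, Cmod (w k) <= rho)%R ->
  (forall k, F (w k) = 0) -> forall u, (Cmod u <= rho)%R -> F u = 0.
Proof.
intros hr [h [h1 h2]] hw hw0 hwr hF u hu.
assert (e : forall j, h j = 0).
{ intros j; apply (pseries_coef_zero rho M w); auto.
  intros k; rewrite <- (hF k); auto. }
apply cs_unique with (1 := h2 u hu).
apply (cs_finite _ 0); intros k _; rewrite e; ring.
Qed.

(** * q-shifted factorials *)

Section QPochhammer.

Variable q : C.
Hypothesis q_lt1 : (Cmod q < 1)%R.
Hypothesis q_neq0 : q <> 0.

Let mq := Cmod q.

Lemma mq_bounds : (0 < mq < 1)%R.
Proof. split; [now apply Cmod_gt_0 | exact q_lt1]. Qed.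

Lemma qpow_neq0 (n : nat) : q ^ n <> 0.
Proof. now apply Cpow_nz. Qed.

Lemma cv_qpow : cv (fun n => q ^ n) 0.
Proof.
apply cv_le with (pow mq).
- intros n; replace (q ^ n - 0) with (q ^ n) by ring; rewrite Cmod_pow; apply Rle_refl.
- apply is_lim_seq_geom; rewrite Rabs_pos_eq; apply mq_bounds || apply Rlt_le, mq_bounds.
Qed.

Lemma cv_scal_qpow (c : C) : cv (fun n => c * q ^ n) 0.
Proof. replace (RtoC 0) with (c * 0) by ring; apply cv_scal, cv_qpow. Qed.

Lemma qpoch_S_l (a : C) (n : nat) : qpoch a q (S n) = (1 - a) * qpoch (a * q) q n.
Proof.
induction n as [|n IH]; [simpl; ring|].
change (qpoch a q (S (S n))) with (qpoch a q (S n) * (1 - a * q ^ S n)).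
rewrite IH; simpl; ring.
Qed.

Lemma qpoch_add (a : C) (m n : nat) :
  qpoch a q (m + n) = qpoch a q m * qpoch (a * q ^ m) q n.
Proof.
induction n as [|n IH]; [rewrite Nat.add_0_r; simpl; ring|].
rewrite Nat.add_succ_r; simpl; rewrite IH, Cpow_add_r; ring.
Qed.

(** Bounds [prod_(i < n) (1 + x |q|^i)] and the corresponding infinite product. *)
Definition ebn (x : R) (n : nat) : R := exp (x * rsum (pow mq) n).
Definition eb (x : R) : R := exp (x / (1 - mq)).

Lemma ebn_S (x : R) (n : nat) : (ebn x n * (1 + x * mq ^ n) <= ebn x (S n))%R.
Proof.
unfold ebn; simpl; rewrite (Rmult_plus_distr_l x), exp_plus.
apply Rmult_le_compat_l; [apply Rlt_le, exp_pos | apply exp_ineq1_le].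
Qed.

Lemma ebn_le (x : R) (n : nat) : (0 <= x)%R -> (ebn x n <= eb x)%R.
Proof.
intros hx; unfold ebn, eb.
assert (h : (x * rsum (pow mq) n <= x / (1 - mq))%R).
{ apply Rmult_le_compat_l; auto; apply rsum_geom; assert (h := mq_bounds); lra. }
destruct h as [h | ->]; [now apply Rlt_le, exp_increasing | lra].
Qed.

Lemma eb_pos (x : R) : (0 < eb x)%R.
Proof. apply exp_pos. Qed.

Lemma eb_mono (x y : R) : (x <= y)%R -> (eb x <= eb y)%R.
Proof.
intros hx; unfold eb.
assert (h : (x / (1 - mq) <= y / (1 - mq))%R).
{ apply Rmult_le_compat_r; auto; apply Rlt_le, Rinv_0_lt_compat; assert (h := mq_bounds); lra. }
destruct h as [h | ->]; [now apply Rlt_le, exp_increasing | lra].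
Qed.

Lemma eb_ge1 (x : R) : (0 <= x)%R -> (1 <= eb x)%R.
Proof.
intros hx; replace 1%R with (eb 0); [now apply eb_mono|].
unfold eb; rewrite <- exp_0; f_equal; unfold Rdiv; ring.
Qed.

Lemma Cmod_1minus_le (x : C) : (Cmod (1 - x) <= 1 + Cmod x)%R.
Proof.
replace (1 - x) with (1 + - x) by ring.
eapply Rle_trans; [apply Cmod_triangle|]; rewrite Cmod_opp, Cmod_1; lra.
Qed.

Lemma qpoch_le_ebn (a : C) (n : nat) : (Cmod (qpoch a q n) <= ebn (Cmod a) n)%R.
Proof.
induction n as [|n IH]; simpl.
- rewrite Cmod_1; unfold ebn; simpl; rewrite Rmult_0_r, exp_0; lra.
- eapply Rle_trans; [|apply ebn_S]; rewrite Cmod_mult.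
  apply Rmult_le_compat; auto using Cmod_ge_0.
  eapply Rle_trans; [apply Cmod_1minus_le|]; rewrite Cmod_mult, Cmod_pow; apply Rle_refl.
Qed.

Lemma qpoch_le (a : C) (n : nat) : (Cmod (qpoch a q n) <= eb (Cmod a))%R.
Proof. eapply Rle_trans; [apply qpoch_le_ebn | apply ebn_le, Cmod_ge_0]. Qed.

Lemma qpoch_sub1_le (a : C) (n : nat) : (Cmod (qpoch a q n - 1) <= eb (Cmod a) - 1)%R.
Proof.
apply Rle_trans with (ebn (Cmod a) n - 1)%R;
  [|assert (h := ebn_le (Cmod a) n (Cmod_ge_0 _)); lra].
induction n as [|n IH]; simpl.
- replace (1 - 1) with (RtoC 0) by ring; rewrite Cmod_0.
  unfold ebn; simpl; rewrite Rmult_0_r, exp_0; lra.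
- assert (h := ebn_S (Cmod a) n).
  replace (qpoch a q n * (1 - a * q ^ n) - 1)
    with ((qpoch a q n - 1) * (1 - a * q ^ n) + - (a * q ^ n)) by ring.
  eapply Rle_trans; [apply Cmod_triangle|].
  rewrite Cmod_opp, Cmod_mult.
  assert (h1 := Cmod_1minus_le (a * q ^ n)).
  assert (e : Cmod (a * q ^ n) = (Cmod a * mq ^ n)%R) by (now rewrite Cmod_mult, Cmod_pow).
  rewrite e in *.
  assert (h0 : (0 <= Cmod a * mq ^ n)%R) by (rewrite <- e; apply Cmod_ge_0).
  assert (h2 : (Cmod (qpoch a q n - 1) * Cmod (1 - a * q ^ n)
    <= (ebn (Cmod a) n - 1) * (1 + Cmod a * mq ^ n))%R)
    by (apply Rmult_le_compat; auto using Cmod_ge_0).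
  lra.
Qed.

Lemma qpoch_telescope (a : C) (n : nat) :
  1 + psum (fun k => - a * q ^ k * qpoch a q k) n = qpoch a q n.
Proof. induction n as [|n IH]; simpl; [ring | rewrite <- IH; ring]. Qed.

Lemma ex_series_qpow (c : R) : ex_series (fun k => c * mq ^ k)%R.
Proof. apply ex_series_Rscal, ex_series_pow; assert (h := mq_bounds); lra. Qed.

Lemma cv_qpoch (a : C) : cv (qpoch a q) (qpoch_inf a q).
Proof.
assert (h : cs (fun k => - a * q ^ k * qpoch a q k)
  (Cseries (fun k => - a * q ^ k * qpoch a q k))).
{ apply cs_dominated with (fun k => Cmod a * eb (Cmod a) * mq ^ k)%R; [|apply ex_series_qpow].
  intros k; rewrite !Cmod_mult, Cmod_opp, Cmod_pow.
  replace (Cmod a * eb (Cmod a) * mq ^ k)%R with (Cmod a * mq ^ k * eb (Cmod a))%R by ring.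
  apply Rmult_le_compat_l; [|apply qpoch_le].
  apply Rmult_le_pos; [apply Cmod_ge_0 | apply pow_le, Cmod_ge_0]. }
assert (h1 := cv_plus _ _ _ _ (cv_const 1) h).
apply (cv_ext _ _ _ (qpoch_telescope a)) in h1.
unfold qpoch_inf; rewrite (Clim_unique _ _ (proj2 (cv_Cis_lim _ _) h1)); exact h1.
Qed.

Lemma qpoch_inf_eq (a l : C) : cv (qpoch a q) l -> qpoch_inf a q = l.
Proof. apply cv_unique, cv_qpoch. Qed.

Lemma qpoch_inf_split (a : C) (n : nat) :
  qpoch_inf a q = qpoch a q n * qpoch_inf (a * q ^ n) q.
Proof.
apply cv_unique with (fun m => qpoch a q (m + n)); [apply cv_shift, cv_qpoch|].
apply cv_ext with (fun m => qpoch a q n * qpoch (a * q ^ n) q m).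
- intros m; now rewrite Nat.add_comm, qpoch_add.
- apply cv_scal, cv_qpoch.
Qed.

Lemma qpoch_inf_S_l (a : C) : qpoch_inf a q = (1 - a) * qpoch_inf (a * q) q.
Proof. rewrite (qpoch_inf_split a 1); simpl; f_equal; [ring | f_equal; ring]. Qed.

Lemma qpoch_inf_le (a : C) : (Cmod (qpoch_inf a q) <= eb (Cmod a))%R.
Proof. apply (cv_bound _ _ _ (cv_qpoch a)), qpoch_le. Qed.

Lemma qpoch_inf_sub1_le (a : C) : (Cmod (qpoch_inf a q - 1) <= eb (Cmod a) - 1)%R.
Proof.
apply cv_bound with (fun n => qpoch a q n - 1).
- apply cv_minus; [apply cv_qpoch | apply cv_const].
- apply qpoch_sub1_le.
Qed.

Lemma lim_eb_sub1 (u : nat -> C) : cv u 0 -> is_lim_seq (fun n => eb (Cmod (u n)) - 1)%R 0.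
Proof.
intros hu; apply cv_Cmod in hu; rewrite Cmod_0 in hu.
replace 0%R with (eb 0 - 1)%R
  by (unfold eb; replace (0 / (1 - mq))%R with 0%R by (unfold Rdiv; ring); rewrite exp_0; ring).
apply is_lim_seq_minus'; [|apply is_lim_seq_const].
apply (is_lim_seq_continuous eb); [|exact hu].
unfold eb; apply (continuity_pt_comp (fun x => x / (1 - mq))%R exp);
  apply derivable_continuous_pt; reg.
Qed.

Lemma cv_qpoch_inf_1 (u : nat -> C) : cv u 0 -> cv (fun n => qpoch_inf (u n) q) 1.
Proof.
intros hu; apply cv_le with (fun n => eb (Cmod (u n)) - 1)%R;
  [intros n; apply qpoch_inf_sub1_le | now apply lim_eb_sub1].
Qed.

Lemma qpoch_inf_neq0 (a : C) : (forall n, qpoch a q n <> 0) -> qpoch_inf a q <> 0.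
Proof.
intros ha.
assert (h := lim_eb_sub1 _ (cv_scal_qpow a)).
apply is_lim_seq_spec in h; destruct (h (mkposreal _ Rlt_0_1)) as [N HN].
specialize (HN N (Nat.le_refl _)); simpl in HN; rewrite Rminus_0_r in HN.
rewrite (qpoch_inf_split a N); apply Cmult_neq_0; [apply ha|].
intros e; assert (h1 := qpoch_inf_sub1_le (a * q ^ N)); rewrite e in h1.
replace (0 - 1) with (- (1)) in h1 by ring; rewrite Cmod_m1 in h1.
apply Rabs_lt_between in HN; lra.
Qed.

Lemma qpoch_neq0 (a : C) (n : nat) : qpoch_inf a q <> 0 -> qpoch a q n <> 0.
Proof. intros h e; apply h; rewrite (qpoch_inf_split a n), e; ring. Qed.

Lemma qpoch_inf_inv_le (a : C) (n : nat) : qpoch_inf a q <> 0 ->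
  (Cmod (/ qpoch_inf (a * q ^ n) q) <= eb (Cmod a) / Cmod (qpoch_inf a q))%R.
Proof.
intros h.
assert (hn := qpoch_neq0 a n h).
assert (e := qpoch_inf_split a n).
assert (hi : qpoch_inf (a * q ^ n) q <> 0) by (intros e1; apply h; rewrite e, e1; ring).
replace (/ qpoch_inf (a * q ^ n) q) with (qpoch a q n / qpoch_inf a q)
  by (rewrite e; field; auto).
rewrite Cmod_div by exact h.
apply Rmult_le_compat_r; [|apply qpoch_le].
apply Rlt_le, Rinv_0_lt_compat; now apply Cmod_gt_0.
Qed.

Lemma qpoch_inv_le (a : C) (n : nat) : qpoch_inf a q <> 0 ->
  (Cmod (/ qpoch a q n) <= eb (Cmod a) / Cmod (qpoch_inf a q))%R.
Proof.
intros h.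
assert (hn := qpoch_neq0 a n h).
assert (e := qpoch_inf_split a n).
replace (/ qpoch a q n) with (qpoch_inf (a * q ^ n) q / qpoch_inf a q)
  by (rewrite e; field; split; auto; intros e1; apply h; rewrite e, e1; ring).
rewrite Cmod_div by exact h.
apply Rmult_le_compat_r; [apply Rlt_le, Rinv_0_lt_compat; now apply Cmod_gt_0|].
eapply Rle_trans; [apply qpoch_inf_le|]; apply eb_mono.
rewrite Cmod_mult, Cmod_pow; rewrite <- (Rmult_1_r (Cmod a)) at 2.
apply Rmult_le_compat_l; [apply Cmod_ge_0|].
fold mq; rewrite <- (pow1 n); apply pow_incr; assert (h1 := mq_bounds); lra.
Qed.

Lemma qpoch_neq0_lt1 (a : C) : (Cmod a < 1)%R -> qpoch_inf a q <> 0.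
Proof.
intros ha; apply qpoch_inf_neq0; intros n; induction n as [|n IH]; simpl.
- intros e; injection e; lra.
- apply Cmult_neq_0; [exact IH|]; intros e.
  assert (e1 : a * q ^ n = 1) by (replace (RtoC 1) with (a * q ^ n + (1 - a * q ^ n)) by ring;
    rewrite e; ring).
  assert (e2 : Cmod (a * q ^ n) = 1%R) by (rewrite e1; apply Cmod_1).
  rewrite Cmod_mult, Cmod_pow in e2; fold mq in e2.
  assert (h1 : (mq ^ n <= 1)%R)
    by (rewrite <- (pow1 n); apply pow_incr; assert (h1 := mq_bounds); lra).
  assert (h2 := Cmod_ge_0 a); assert (h3 := pow_le mq n (Rlt_le _ _ (proj1 mq_bounds))).
  nra.
Qed.

Lemma qfact_inf_neq0 : qpoch_inf q q <> 0.
Proof. apply qpoch_neq0_lt1, q_lt1. Qed.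

Lemma l1_qpoch (rho M : R) (c : C) (F : C -> C) (n : nat) : (0 <= rho)%R ->
  l1_analytic rho M F ->
  l1_analytic rho (M * ebn (Cmod c * rho) n) (fun u => qpoch (c * u) q n * F u).
Proof.
intros hr hF.
assert (hM : (0 <= M)%R) by (destruct hF as [h [h1 _]]; exact (h1 O)).
induction n as [|n IH].
- apply l1_ext with F; [intros; simpl; ring|].
  apply l1_mono with (2 := hF); unfold ebn; simpl; rewrite Rmult_0_r, exp_0; lra.
- apply (l1_lin rho _ 1 (- c * q ^ n)) in IH; auto.
  apply l1_mono with (M' := (M * ebn (Cmod c * rho) (S n))%R) in IH.
  + apply l1_ext with (2 := IH); intros u _; simpl; ring.
  + rewrite Rmult_assoc; apply Rmult_le_compat_l; auto.
    eapply Rle_trans; [|apply ebn_S]; right.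
    rewrite Cmod_1, Cmod_mult, Cmod_opp, Cmod_pow; fold mq; ring.
Qed.

Lemma l1_qpoch_eb (rho M : R) (c : C) (F : C -> C) (n : nat) : (0 <= rho)%R ->
  l1_analytic rho M F ->
  l1_analytic rho (M * eb (Cmod c * rho)) (fun u => qpoch (c * u) q n * F u).
Proof.
intros hr hF.
assert (hM : (0 <= M)%R) by (destruct hF as [h [h1 _]]; exact (h1 O)).
apply l1_mono with (2 := l1_qpoch _ _ c _ n hr hF).
apply Rmult_le_compat_l; auto; apply ebn_le, Rmult_le_pos; auto using Cmod_ge_0.
Qed.

Lemma l1_qpoch_inf (rho M : R) (c : C) (F : C -> C) : (0 < rho)%R ->
  l1_analytic rho M F ->
  l1_analytic rho (M * eb (Cmod c * rho)) (fun u => qpoch_inf (c * u) q * F u).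
Proof.
intros hr hF.
assert (hr0 := Rlt_le _ _ hr).
assert (hM : (0 <= M)%R) by (destruct hF as [h [h1 _]]; exact (h1 O)).
set (x := (Cmod c * rho)%R).
assert (hx : (0 <= x)%R) by (apply Rmult_le_pos; auto using Cmod_ge_0).
apply l1_mono with (M + M * (eb x - 1))%R; [right; ring|].
apply l1_ext with (fun u => F u +
  Cseries (fun k => - c * q ^ k * (u * (qpoch (c * u) q k * F u)))).
- intros u hu.
  assert (h1 : cv (fun n => F u * (qpoch (c * u) q n - 1)) (F u * (qpoch_inf (c * u) q - 1)))
    by (apply cv_scal, cv_minus; [apply cv_qpoch | apply cv_const]).
  rewrite (cs_Cseries _ (F u * (qpoch_inf (c * u) q - 1))); [ring|].
  apply cv_ext with (2 := h1); intros n; rewrite <- qpoch_telescope.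
  replace (F u * (1 + psum (fun k => - (c * u) * q ^ k * qpoch (c * u) q k) n - 1))
    with (F u * psum (fun k => - (c * u) * q ^ k * qpoch (c * u) q k) n) by ring.
  rewrite <- psum_scal; apply psum_ext; intros k _; ring.
- apply l1_plus; auto.
  apply l1_series with (fun k => Cmod (- c * q ^ k) * (rho * (M * ebn x k)))%R; auto.
  + intros n; apply l1_scal, l1_mulX; auto; now apply l1_qpoch.
  + intros n; apply Rle_trans with (M * (ebn x n - 1))%R.
    * induction n as [|n IH]; simpl; [unfold ebn; simpl; rewrite Rmult_0_r, exp_0; lra|].
      assert (h := ebn_S x n).
      rewrite Cmod_mult, Cmod_opp, Cmod_pow; fold mq.
      replace (Cmod c * mq ^ n * (rho * (M * ebn x n)))%R
        with (M * (ebn x n * (x * mq ^ n)))%R by (unfold x; ring).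
      nra.
    * apply Rmult_le_compat_l; auto; assert (h := ebn_le x n hx); lra.
Qed.

Fixpoint nodal (w : C) (r : nat) : C :=
  match r with O => 1 | S m => nodal w m * (w - q ^ m) end.

Lemma nodal_qpow_lt (k r : nat) : (k < r)%nat -> nodal (q ^ k) r = 0.
Proof. induction 1 as [|r _ IH]; simpl; [ring | rewrite IH; ring]. Qed.

Lemma nodal_shift (w : C) (r : nat) : nodal (q * w) (S r) = (q * w - 1) * q ^ r * nodal w r.
Proof.
induction r as [|r IH]; [simpl; ring|].
change (nodal (q * w) (S (S r))) with (nodal (q * w) (S r) * (q * w - q ^ S r)).
rewrite IH; simpl; ring.
Qed.

Lemma nodal_factors_le (w : C) (r : nat) (rho x : R) : (0 < rho)%R -> (0 <= x)%R ->
  (forall i, (i < r)%nat -> Cmod (w - q ^ i) <= rho * (1 + x * mq ^ i))%R ->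
  (Cmod (nodal w r) <= rho ^ r * eb x)%R.
Proof.
intros hr hx h.
apply Rle_trans with (rho ^ r * ebn x r)%R.
- induction r as [|r IH]; simpl.
  + rewrite Cmod_1; unfold ebn; simpl; rewrite Rmult_0_r, exp_0; lra.
  + rewrite Cmod_mult.
    apply Rle_trans with ((rho ^ r * ebn x r) * (rho * (1 + x * mq ^ r)))%R.
    * apply Rmult_le_compat; auto using Cmod_ge_0.
    * assert (h1 := ebn_S x r).
      replace (rho ^ r * ebn x r * (rho * (1 + x * mq ^ r)))%R
        with (rho * rho ^ r * (ebn x r * (1 + x * mq ^ r)))%R by ring.
      apply Rmult_le_compat_l; auto.
      apply Rmult_le_pos; [lra | apply pow_le; lra].
- apply Rmult_le_compat_l; [apply pow_le; lra | now apply ebn_le].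
Qed.

Lemma nodal_le (w : C) (r : nat) (rho : R) : (0 < rho)%R -> (Cmod w <= rho)%R ->
  (Cmod (nodal w r) <= rho ^ r * eb (/ rho))%R.
Proof.
intros hr hw; apply nodal_factors_le; auto.
- now apply Rlt_le, Rinv_0_lt_compat.
- intros i _; replace (w - q ^ i) with (w + - q ^ i) by ring.
  eapply Rle_trans; [apply Cmod_triangle|]; rewrite Cmod_opp, Cmod_pow; fold mq.
  replace (rho * (1 + / rho * mq ^ i))%R with (rho + mq ^ i)%R by (field; lra); lra.
Qed.

Lemma mqpow_le (i k : nat) : (i <= k)%nat -> (mq ^ k <= mq ^ i)%R.
Proof.
intros h; assert (h1 := mq_bounds).
replace k with (i + (k - i))%nat by lia; rewrite pow_add.
rewrite <- (Rmult_1_r (mq ^ i)) at 2; apply Rmult_le_compat_l; [apply pow_le; lra|].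
rewrite <- (pow1 (k - i)); apply pow_incr; lra.
Qed.

Lemma nodal_qpow_le (k r : nat) (rho : R) : (0 < rho)%R ->
  (Cmod (nodal (q ^ k) r) <= rho ^ r * eb (2 / rho))%R.
Proof.
intros hr.
destruct (Nat.lt_ge_cases k r) as [hk | hk].
- rewrite nodal_qpow_lt, Cmod_0 by exact hk.
  apply Rmult_le_pos; [apply pow_le; lra | apply Rlt_le, eb_pos].
- apply nodal_factors_le; auto.
  + apply Rlt_le, Rdiv_lt_0_compat; lra.
  + intros i hi; replace (q ^ k - q ^ i) with (q ^ k + - q ^ i) by ring.
    eapply Rle_trans; [apply Cmod_triangle|]; rewrite Cmod_opp, !Cmod_pow; fold mq.
    replace (rho * (1 + 2 / rho * mq ^ i))%R with (rho + 2 * mq ^ i)%R by (field; lra).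
    assert (h := mqpow_le i k ltac:(lia)); lra.
Qed.

Lemma nodal_qpoch (w : C) (r : nat) : w <> 0 -> nodal w r = w ^ r * qpoch (/ w) q r.
Proof.
intros hw; induction r as [|r IH]; simpl; [ring|].
rewrite IH; field; exact hw.
Qed.

Lemma l1_nodal (rho M : R) (F : C -> C) (r : nat) : (0 < rho)%R ->
  l1_analytic rho M F ->
  l1_analytic rho (M * (rho ^ r * eb (/ rho))) (fun u => nodal u r * F u).
Proof.
intros hr hF.
assert (hr0 := Rlt_le _ _ hr).
assert (hM : (0 <= M)%R) by (destruct hF as [h [h1 _]]; exact (h1 O)).
apply l1_mono with (M * (rho ^ r * ebn (/ rho) r))%R.
{ apply Rmult_le_compat_l; auto; apply Rmult_le_compat_l; [now apply pow_le|].
  now apply ebn_le, Rlt_le, Rinv_0_lt_compat. }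
induction r as [|r IH].
- apply l1_ext with F; [intros; simpl; ring|].
  apply l1_mono with (2 := hF); unfold ebn; simpl; rewrite Rmult_0_r, exp_0; lra.
- apply (l1_lin rho _ (- q ^ r) 1) in IH; auto.
  apply l1_mono with (M' := (M * (rho ^ S r * ebn (/ rho) (S r)))%R) in IH.
  + apply l1_ext with (2 := IH); intros u _; simpl; ring.
  + rewrite Rmult_assoc; apply Rmult_le_compat_l; auto.
    rewrite Cmod_1, Cmod_opp, Cmod_pow; fold mq.
    replace (rho ^ r * ebn (/ rho) r * (mq ^ r + 1 * rho))%R
      with (rho ^ S r * (ebn (/ rho) r * (1 + / rho * mq ^ r)))%R by (simpl; field; lra).
    apply Rmult_le_compat_l; [now apply pow_le | apply ebn_S].
Qed.

End QPochhammer.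

(** * A q-difference relation on one geometric lattice *)

Section Lattice.

Variables q t a : C.
Hypothesis q_lt1 : (Cmod q < 1)%R.
Hypothesis q_neq0 : q <> 0.
Hypothesis t_neq0 : t <> 0.

Definition kernel (r : nat) (w : C) : C :=
  nodal q w r * qpoch_inf (a * q * t * w) q * qpoch_inf (a * q ^ r * w) q
  / qpoch_inf (a * w ^ 2) q.

Variables (w0 ginf : C) (g : nat -> C) (Mg Mn : R).
Hypothesis w0_neq0 : w0 <> 0.
Hypothesis g_le : forall k, (Cmod (g k) <= Mg)%R.
Hypothesis g_cv : cv g ginf.
Hypothesis g_step : forall k,
  g (S k) * ((1 - w0 * q ^ S k) * (1 - w0 * q ^ S k / t)) = g k.
Hypothesis nodal_lattice_le : forall k r,
  (Cmod (nodal q (w0 * q ^ k) r) <= Cmod t ^ r * Mn)%R.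
Hypothesis den_neq0 : qpoch_inf (a * w0 ^ 2) q <> 0.

Lemma lattice_den_neq0 (k : nat) : qpoch_inf (a * (w0 * q ^ k) ^ 2) q <> 0.
Proof.
intros e; apply den_neq0.
rewrite (qpoch_inf_split q q_lt1 q_neq0 _ (k + k)).
replace (a * w0 ^ 2 * q ^ (k + k)) with (a * (w0 * q ^ k) ^ 2)
  by (rewrite Cpow_add_r; simpl; ring).
rewrite e; ring.
Qed.

Lemma lattice_mod_le (c : C) (k : nat) : (Cmod (c * (w0 * q ^ k)) <= Cmod (c * w0))%R.
Proof.
rewrite !Cmod_mult, Cmod_pow, <- Rmult_assoc.
rewrite <- (Rmult_1_r (Cmod c * Cmod w0)) at 2.
apply Rmult_le_compat_l; [apply Rmult_le_pos; apply Cmod_ge_0|].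
apply (mqpow_le q q_lt1 q_neq0 0 k); lia.
Qed.

Definition kernel_bound : R :=
  (Mg * (Mn * eb q (Cmod (a * q * t * w0)) * eb q (Cmod (a * w0))
   * (eb q (Cmod (a * w0 ^ 2)) / Cmod (qpoch_inf (a * w0 ^ 2) q))))%R.

Lemma kernel_term_le (r k : nat) :
  (Cmod (q ^ k * g k * kernel r (w0 * q ^ k)) <= Cmod t ^ r * (kernel_bound * Cmod q ^ k))%R.
Proof.
assert (hd := lattice_den_neq0 k).
unfold kernel, Cdiv; rewrite !Cmod_mult.
assert (h1 : (Cmod (qpoch_inf (a * q * t * (w0 * q ^ k)) q) <= eb q (Cmod (a * q * t * w0)))%R).
{ eapply Rle_trans; [apply qpoch_inf_le; auto|]; apply eb_mono; auto; apply lattice_mod_le. }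
assert (h2 : (Cmod (qpoch_inf (a * q ^ r * (w0 * q ^ k)) q) <= eb q (Cmod (a * w0)))%R).
{ eapply Rle_trans; [apply qpoch_inf_le; auto|]; apply eb_mono; auto.
  replace (a * q ^ r * (w0 * q ^ k)) with (a * (w0 * q ^ (r + k)))
    by (rewrite Cpow_add_r; ring).
  apply lattice_mod_le. }
assert (h3 : (Cmod (/ qpoch_inf (a * (w0 * q ^ k) ^ 2) q)
  <= eb q (Cmod (a * w0 ^ 2)) / Cmod (qpoch_inf (a * w0 ^ 2) q))%R).
{ replace (a * (w0 * q ^ k) ^ 2) with (a * w0 ^ 2 * q ^ (k + k))
    by (rewrite Cpow_add_r; simpl; ring).
  now apply qpoch_inf_inv_le. }
assert (h4 := nodal_lattice_le k r).
unfold kernel_bound.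
set (e3 := (eb q (Cmod (a * w0 ^ 2)) / Cmod (qpoch_inf (a * w0 ^ 2) q))%R) in *.
rewrite Cmod_pow.
replace (Cmod t ^ r * (Mg * (Mn * eb q (Cmod (a * q * t * w0)) * eb q (Cmod (a * w0)) * e3)
  * Cmod q ^ k))%R with (Cmod q ^ k * Mg * (Cmod t ^ r * Mn * eb q (Cmod (a * q * t * w0))
    * eb q (Cmod (a * w0)) * e3))%R by ring.
repeat apply Rmult_le_compat; auto using Cmod_ge_0, Rle_refl;
  repeat (apply Rmult_le_pos || apply Cmod_ge_0 || apply pow_le).
Qed.

Lemma kernel_series (r : nat) :
  cs (fun k => q ^ k * g k * kernel r (w0 * q ^ k))
     (Cseries (fun k => q ^ k * g k * kernel r (w0 * q ^ k))).
Proof.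
apply cs_dominated with (fun k => Cmod t ^ r * (kernel_bound * Cmod q ^ k))%R.
- apply kernel_term_le.
- apply ex_series_Rscal; now apply ex_series_qpow.
Qed.

(** Found by q-Gosper summation. Its value at infinity does not vanish, only
    the sum of those for the lattices [q^k] and [t q^k] does, see
    [weights_balance]. *)
Definition certificate (r k : nat) : C :=
  let w := w0 * q ^ k in
  t ^ 2 * g k * nodal q w (S r) * (1 - w / t) * qpoch_inf (a * t * w) q
  * qpoch_inf (a * q ^ S r * w) q / qpoch_inf (a * w ^ 2) q / w0.

Lemma certificate_eq (r k : nat) :
  t ^ 2 * (q ^ k * g k * kernel r (w0 * q ^ k))
  - (t + a * t ^ 3) * (q ^ k * g k * kernel (S r) (w0 * q ^ k))
  + a * t ^ 2 * (q ^ k * g k * kernel (S (S r)) (w0 * q ^ k))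
  = certificate r k - certificate r (S k).
Proof.
unfold certificate, kernel.
rewrite <- (g_step k).
assert (hd := lattice_den_neq0 k).
assert (hd' := lattice_den_neq0 (S k)).
assert (hk := qpow_neq0 q q_neq0 k).
replace (w0 * q ^ S k) with (q * (w0 * q ^ k)) in * by (simpl; ring).
rewrite nodal_shift.
assert (ew : q ^ k = w0 * q ^ k / w0) by (field; auto).
assert (hw : w0 * q ^ k <> 0) by (now apply Cmult_neq_0).
set (w := w0 * q ^ k) in *; clearbody w; rewrite ew; clear ew hk.
assert (eD : qpoch_inf (a * w ^ 2) q
  = (1 - a * w ^ 2) * (1 - a * q * w ^ 2) * qpoch_inf (a * (q * w) ^ 2) q).
{ rewrite (qpoch_inf_S_l q q_lt1 q_neq0 (a * w ^ 2)), (qpoch_inf_S_l q q_lt1 q_neq0 (a * w ^ 2 * q)).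
  replace (a * w ^ 2 * q * q) with (a * (q * w) ^ 2) by ring; ring. }
assert (eX : qpoch_inf (a * t * w) q = (1 - a * t * w) * qpoch_inf (a * q * t * w) q).
{ rewrite qpoch_inf_S_l by auto.
  now replace (a * t * w * q) with (a * q * t * w) by ring. }
assert (eY1 : qpoch_inf (a * q ^ S r * w) q
  = (1 - a * q ^ S r * w) * qpoch_inf (a * q ^ S (S r) * w) q).
{ rewrite qpoch_inf_S_l by auto.
  now replace (a * q ^ S r * w * q) with (a * q ^ S (S r) * w) by (simpl; ring). }
assert (eY0 : qpoch_inf (a * q ^ r * w) q
  = (1 - a * q ^ r * w) * qpoch_inf (a * q ^ S r * w) q).
{ rewrite qpoch_inf_S_l by auto.
  now replace (a * q ^ r * w * q) with (a * q ^ S r * w) by (simpl; ring). }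
rewrite eY0, eY1, eX.
replace (a * t * (q * w)) with (a * q * t * w) by ring.
replace (a * q ^ S r * (q * w)) with (a * q ^ S (S r) * w) by (simpl; ring).
rewrite eD in hd |- *.
revert hd hd'; generalize (qpoch_inf (a * (q * w) ^ 2) q) (qpoch_inf (a * q * t * w) q)
  (qpoch_inf (a * q ^ S (S r) * w) q); intros D X Y hd hd'.
assert (hd1 : 1 - a * (w * w) <> 0)
  by (intros e; apply hd; replace (a * w ^ 2) with (a * (w * w)) by ring; rewrite e; ring).
assert (hd2 : 1 - a * q * (w * w) <> 0)
  by (intros e; apply hd; replace (a * q * w ^ 2) with (a * q * (w * w)) by ring; rewrite e; ring).
simpl nodal; simpl Cpow.
generalize (g (S k)) (nodal q w r) (q ^ r); intros G P R.
field; repeat split; auto.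
Qed.

Lemma cv_nodal (u : nat -> C) (l : C) (r : nat) :
  cv u l -> cv (fun k => nodal q (u k) r) (nodal q l r).
Proof.
intros hu; induction r as [|r IH]; simpl; [apply cv_const|].
apply cv_mult; [exact IH | apply cv_minus; [exact hu | apply cv_const]].
Qed.

Lemma cv_certificate (r : nat) :
  cv (certificate r) (t ^ 2 * ginf * nodal q 0 (S r) / w0).
Proof.
assert (hw : cv (fun k => w0 * q ^ k) 0) by (now apply cv_scal_qpow).
assert (hc : forall c, cv (fun k => c * (w0 * q ^ k)) 0).
{ intros c; replace (RtoC 0) with (c * 0) by ring; now apply cv_scal. }
replace (t ^ 2 * ginf * nodal q 0 (S r) / w0)
  with (t ^ 2 * ginf * nodal q 0 (S r) * (1 - / t * 0) * 1 * 1 * / 1 * / w0)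
  by (field; repeat split; auto; intros e; injection e; lra).
unfold certificate, Cdiv; apply cv_mult; [|apply cv_const].
apply cv_mult; [apply cv_mult; [apply cv_mult; [apply cv_mult; [apply cv_mult|]|]|]|].
- apply cv_scal; exact g_cv.
- now apply cv_nodal.
- apply cv_minus; [apply cv_const|].
  apply cv_ext with (fun k => / t * (w0 * q ^ k)); [intros; ring | now apply cv_scal].
- apply cv_qpoch_inf_1; auto.
- apply cv_qpoch_inf_1; auto.
- apply cv_inv.
  + apply lattice_den_neq0.
  + intros e; injection e; lra.
  + apply cv_qpoch_inf_1; auto.
    apply cv_ext with (fun k => a * (w0 * q ^ k) * (w0 * q ^ k)); [intros; ring|].
    replace (RtoC 0) with (0 * 0) by ring; now apply cv_mult.
Qed.

Lemma kernel_recurrence (r : nat) :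
  t ^ 2 * Cseries (fun k => q ^ k * g k * kernel r (w0 * q ^ k))
  - (t + a * t ^ 3) * Cseries (fun k => q ^ k * g k * kernel (S r) (w0 * q ^ k))
  + a * t ^ 2 * Cseries (fun k => q ^ k * g k * kernel (S (S r)) (w0 * q ^ k))
  = certificate r 0 - t ^ 2 * ginf * nodal q 0 (S r) / w0.
Proof.
apply cs_unique with (2 := cs_telescope _ _ _ (certificate_eq r) (cv_certificate r)).
apply cs_plus; [|now apply cs_scal, kernel_series].
apply cs_ext with (fun k => t ^ 2 * (q ^ k * g k * kernel r (w0 * q ^ k))
  + - (t + a * t ^ 3) * (q ^ k * g k * kernel (S r) (w0 * q ^ k))); [intros; ring|].
replace (t ^ 2 * _ - _) with
  (t ^ 2 * Cseries (fun k => q ^ k * g k * kernel r (w0 * q ^ k))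
   + - (t + a * t ^ 3) * Cseries (fun k => q ^ k * g k * kernel (S r) (w0 * q ^ k))) by ring.
apply cs_plus; apply cs_scal, kernel_series.
Qed.

Lemma kernel_limit (nu : nat -> C) :
  (forall k, cv (fun r => nodal q (w0 * q ^ k) r / t ^ r) (nu k)) ->
  cv (fun r => Cseries (fun k => q ^ k * g k * kernel r (w0 * q ^ k)) / t ^ r)
     (Cseries (fun k => q ^ k * g k * (nu k * qpoch_inf (a * q * t * (w0 * q ^ k)) q
        / qpoch_inf (a * (w0 * q ^ k) ^ 2) q))).
Proof.
intros hnu.
apply cv_ext with (fun r => Cseries (fun k => / t ^ r * (q ^ k * g k * kernel r (w0 * q ^ k)))).
{ intros r; apply cs_Cseries; unfold Cdiv; rewrite Cmult_comm; apply cs_scal, kernel_series. }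
apply tannery with (fun k => kernel_bound * Cmod q ^ k)%R.
- intros r k; rewrite Cmod_mult, Cmod_inv, Cmod_pow by (now apply Cpow_nz).
  assert (h := kernel_term_le r k).
  assert (h0 : (0 < Cmod t ^ r)%R) by (now apply pow_lt, Cmod_gt_0).
  apply Rmult_le_reg_l with (Cmod t ^ r)%R; [exact h0|].
  rewrite <- Rmult_assoc, Rinv_r, Rmult_1_l by lra; exact h.
- now apply ex_series_qpow.
- intros k.
  replace (q ^ k * g k * (nu k * qpoch_inf (a * q * t * (w0 * q ^ k)) q
        / qpoch_inf (a * (w0 * q ^ k) ^ 2) q))
    with (nu k * (1 * (q ^ k * g k * (qpoch_inf (a * q * t * (w0 * q ^ k)) q
        / qpoch_inf (a * (w0 * q ^ k) ^ 2) q))))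
    by (unfold Cdiv; ring).
  apply cv_ext with (fun r => nodal q (w0 * q ^ k) r / t ^ r
    * (qpoch_inf (a * w0 * q ^ k * q ^ r) q * (q ^ k * g k *
      (qpoch_inf (a * q * t * (w0 * q ^ k)) q / qpoch_inf (a * (w0 * q ^ k) ^ 2) q)))).
  + intros r; unfold kernel, Cdiv.
    replace (a * q ^ r * (w0 * q ^ k)) with (a * w0 * q ^ k * q ^ r) by ring; ring.
  + apply cv_mult; [apply hnu|]; apply cv_mult; [|apply cv_const].
    apply cv_qpoch_inf_1; auto; now apply cv_scal_qpow.
Qed.

End Lattice.

(** * The generating functional on two lattices *)

Lemma C1_neq_0 : RtoC 1 <> 0.
Proof. intros e; injection e; lra. Qed.

Section TwoLattices.

Variables q t : C.
Hypothesis q_lt1 : (Cmod q < 1)%R.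
Hypothesis q_neq0 : q <> 0.
Hypothesis t_neq0 : t <> 0.
Hypothesis t_inf : qpoch_inf t q <> 0.
Hypothesis tinv_inf : qpoch_inf (/ t) q <> 0.

Definition weight1 (k : nat) : C := / (qpoch_inf t q * qpoch q q k * qpoch (q / t) q k).
Definition weight2 (k : nat) : C := / (qpoch_inf (/ t) q * qpoch q q k * qpoch (q * t) q k).

Lemma qt_inf : qpoch_inf (q * t) q <> 0.
Proof.
intros e; apply t_inf; rewrite qpoch_inf_S_l by auto.
rewrite Cmult_comm in e; rewrite e; ring.
Qed.

Lemma qtinv_inf : qpoch_inf (q / t) q <> 0.
Proof.
intros e; apply tinv_inf; rewrite qpoch_inf_S_l by auto.
replace (/ t * q) with (q / t) by (field; auto); rewrite e; ring.
Qed.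

Lemma weight_le (x y : C) : x <> 0 -> qpoch_inf y q <> 0 -> exists M : R,
  forall k, (Cmod (/ (x * qpoch q q k * qpoch y q k)) <= M)%R.
Proof.
intros hx hy; exists (Cmod (/ x) * (eb q (Cmod q) / Cmod (qpoch_inf q q))
  * (eb q (Cmod y) / Cmod (qpoch_inf y q)))%R; intros k.
assert (hq := qfact_inf_neq0 q q_lt1 q_neq0).
assert (h1 := qpoch_neq0 q q_lt1 q_neq0 _ k hq).
assert (h2 := qpoch_neq0 q q_lt1 q_neq0 _ k hy).
replace (/ (x * qpoch q q k * qpoch y q k)) with (/ x * / qpoch q q k * / qpoch y q k)
  by (field; auto).
rewrite !Cmod_mult.
apply Rmult_le_compat; auto using Cmod_ge_0, qpoch_inv_le.
- apply Rmult_le_pos; apply Cmod_ge_0.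
- apply Rmult_le_compat; auto using Cmod_ge_0, qpoch_inv_le, Rle_refl.
Qed.

Lemma weight_cv (x y : C) : x <> 0 -> qpoch_inf y q <> 0 ->
  cv (fun k => / (x * qpoch q q k * qpoch y q k)) (/ (x * qpoch_inf q q * qpoch_inf y q)).
Proof.
intros hx hy.
assert (hq := qfact_inf_neq0 q q_lt1 q_neq0).
apply cv_inv.
- intros n; repeat apply Cmult_neq_0; auto; now apply qpoch_neq0.
- repeat apply Cmult_neq_0; auto.
- apply cv_mult; [apply cv_scal|]; now apply cv_qpoch.
Qed.

Lemma weight1_le : exists M : R, forall k, (Cmod (weight1 k) <= M)%R.
Proof. apply weight_le; [exact t_inf | apply qtinv_inf]. Qed.

Lemma weight2_le : exists M : R, forall k, (Cmod (weight2 k) <= M)%R.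
Proof. apply weight_le; [exact tinv_inf | apply qt_inf]. Qed.

Lemma weight1_step (k : nat) :
  weight1 (S k) * ((1 - 1 * q ^ S k) * (1 - 1 * q ^ S k / t)) = weight1 k.
Proof.
assert (h1 := qpoch_neq0 q q_lt1 q_neq0 _ (S k) (qfact_inf_neq0 q q_lt1 q_neq0)).
assert (h2 := qpoch_neq0 q q_lt1 q_neq0 _ (S k) qtinv_inf).
unfold weight1; simpl in *.
assert (h3 : qpoch q q k <> 0) by (intros e; apply h1; rewrite e; ring).
assert (h4 : 1 - q * q ^ k <> 0) by (intros e; apply h1; rewrite e; ring).
assert (h5 : qpoch (q / t) q k <> 0) by (intros e; apply h2; rewrite e; ring).
assert (h6 : t - q * q ^ k <> 0).
{ intros e; apply h2; replace (1 - q / t * q ^ k) with ((t - q * q ^ k) / t) by (field; auto).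
  rewrite e; field; auto. }
field; repeat split; auto.
Qed.

Lemma weight2_step (k : nat) :
  weight2 (S k) * ((1 - t * q ^ S k) * (1 - t * q ^ S k / t)) = weight2 k.
Proof.
assert (h1 := qpoch_neq0 q q_lt1 q_neq0 _ (S k) (qfact_inf_neq0 q q_lt1 q_neq0)).
assert (h2 := qpoch_neq0 q q_lt1 q_neq0 _ (S k) qt_inf).
unfold weight2; simpl in *.
assert (h3 : qpoch q q k <> 0) by (intros e; apply h1; rewrite e; ring).
assert (h4 : 1 - q * q ^ k <> 0) by (intros e; apply h1; rewrite e; ring).
assert (h5 : qpoch (q * t) q k <> 0) by (intros e; apply h2; rewrite e; ring).
assert (h6 : 1 - q * t * q ^ k <> 0) by (intros e; apply h2; rewrite e; ring).
field; repeat split; auto.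
Qed.

Lemma nodal1_le (k r : nat) :
  (Cmod (nodal q (1 * q ^ k) r) <= Cmod t ^ r * eb q (2 / Cmod t))%R.
Proof.
rewrite Cmult_1_l; apply nodal_qpow_le; auto; now apply Cmod_gt_0.
Qed.

Lemma Cmod_mul_qpow_le (k : nat) : (Cmod (t * q ^ k) <= Cmod t)%R.
Proof.
rewrite Cmod_mult, Cmod_pow, <- (Rmult_1_r (Cmod t)).
rewrite Rmult_assoc, Rmult_1_l.
apply Rmult_le_compat_l; [apply Cmod_ge_0|].
apply (mqpow_le q q_lt1 q_neq0 0 k); lia.
Qed.

Lemma nodal2_le (k r : nat) :
  (Cmod (nodal q (t * q ^ k) r) <= Cmod t ^ r * eb q (/ Cmod t))%R.
Proof.
apply nodal_le; auto; [now apply Cmod_gt_0 | apply Cmod_mul_qpow_le].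
Qed.

Lemma weights_balance :
  / (qpoch_inf t q * qpoch_inf q q * qpoch_inf (q / t) q) / 1
  + / (qpoch_inf (/ t) q * qpoch_inf q q * qpoch_inf (q * t) q) / t = 0.
Proof.
assert (h0 := qfact_inf_neq0 q q_lt1 q_neq0).
assert (h1 := qt_inf); assert (h2 := qtinv_inf).
assert (e1 : qpoch_inf t q = (1 - t) * qpoch_inf (q * t) q)
  by (rewrite qpoch_inf_S_l by auto; f_equal; f_equal; ring).
assert (e2 : qpoch_inf (/ t) q = (1 - / t) * qpoch_inf (q / t) q)
  by (rewrite qpoch_inf_S_l by auto; f_equal; f_equal; field; auto).
assert (h3 : 1 - t <> 0) by (intros e; apply t_inf; rewrite e1, e; ring).
rewrite e1, e2; field; repeat split; auto using C1_neq_0.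
intros e; apply h3; replace (1 - t) with (- (t - 1)) by ring; rewrite e; ring.
Qed.

Section SmallA.

Variable a : C.
Hypothesis a_inf : qpoch_inf a q <> 0.
Hypothesis at2_inf : qpoch_inf (a * t ^ 2) q <> 0.
Hypothesis at2_lt1 : (Cmod (a * t ^ 2) < 1)%R.

Definition kernel_sum (r : nat) : C :=
  Cseries (fun k => q ^ k * weight1 k * kernel q t a r (1 * q ^ k))
  + Cseries (fun k => q ^ k * weight2 k * kernel q t a r (t * q ^ k)).

Lemma a_inf1 : qpoch_inf (a * 1 ^ 2) q <> 0.
Proof. now replace (a * 1 ^ 2) with a by ring. Qed.

Lemma kernel_sum_recurrence (r : nat) :
  t ^ 2 * kernel_sum r - (t + a * t ^ 3) * kernel_sum (S r)
  + a * t ^ 2 * kernel_sum (S (S r)) = 0.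
Proof.
destruct weight1_le as [M1 hM1], weight2_le as [M2 hM2].
assert (H1 := kernel_recurrence q t a q_lt1 q_neq0 t_neq0 1 _ weight1 _ _
  C1_neq_0 hM1 (weight_cv _ _ t_inf qtinv_inf) weight1_step nodal1_le a_inf1 r).
assert (H2 := kernel_recurrence q t a q_lt1 q_neq0 t_neq0 t _ weight2 _ _
  t_neq0 hM2 (weight_cv _ _ tinv_inf qt_inf) weight2_step nodal2_le at2_inf r).
unfold kernel_sum.
assert (Hb := weights_balance).
assert (z1 : certificate q t a 1 weight1 r 0 = 0).
{ unfold certificate; simpl (q ^ 0).
  replace (nodal q (1 * 1) (S r)) with (RtoC 0); [unfold Cdiv; ring|].
  replace (1 * 1) with (q ^ 0) by (simpl; ring); symmetry; apply nodal_qpow_lt; lia. }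
assert (z2 : certificate q t a t weight2 r 0 = 0).
{ unfold certificate; simpl (q ^ 0).
  replace (1 - t * 1 / t) with (RtoC 0) by (field; auto); unfold Cdiv; ring. }
rewrite z1 in H1; rewrite z2 in H2.
set (N0 := nodal q 0 (S r)) in *; clearbody N0.
set (b1 := / (qpoch_inf t q * qpoch_inf q q * qpoch_inf (q / t) q)) in *.
set (b2 := / (qpoch_inf (/ t) q * qpoch_inf q q * qpoch_inf (q * t) q)) in *.
replace (0 - t ^ 2 * b1 * N0 / 1) with (- t ^ 2 * N0 * (b1 / 1)) in H1 by (unfold Cdiv; ring).
replace (0 - t ^ 2 * b2 * N0 / t) with (- t ^ 2 * N0 * (b2 / t)) in H2 by (unfold Cdiv; ring).
match type of H1 with ?x1 = _ => match type of H2 with ?x2 = _ =>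
  transitivity (x1 + x2); [ring|] end end.
rewrite H1, H2; transitivity (- t ^ 2 * N0 * (b1 / 1 + b2 / t)); [ring|].
rewrite Hb; ring.
Qed.

Lemma one_minus_at2 : 1 - a * t ^ 2 <> 0.
Proof.
intros e; assert (e1 : a * t ^ 2 = 1)
  by (replace (a * t ^ 2) with (1 - (1 - a * t ^ 2)) by ring; rewrite e; ring).
rewrite e1, Cmod_1 in at2_lt1; lra.
Qed.

Lemma kernel_sum_limit : cv (fun r => kernel_sum r / t ^ r) (/ (1 - a * t ^ 2)).
Proof.
destruct weight1_le as [M1 hM1], weight2_le as [M2 hM2].
assert (hmt : (0 < Cmod t)%R) by (now apply Cmod_gt_0).
assert (hmq : (0 < Cmod q)%R) by (now apply Cmod_gt_0).
assert (H1 := kernel_limit q t a q_lt1 q_neq0 t_neq0 1 weight1 _ _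
  hM1 nodal1_le a_inf1 (fun _ => 0)).
assert (H2 := kernel_limit q t a q_lt1 q_neq0 t_neq0 t weight2 _ _
  hM2 nodal2_le at2_inf (fun k => match k with O => qpoch_inf (/ t) q | _ => 0 end)).
cbv beta in H1, H2.
assert (e1 : Cseries (fun k => q ^ k * weight1 k * (0 * qpoch_inf (a * q * t * (1 * q ^ k)) q
        / qpoch_inf (a * (1 * q ^ k) ^ 2) q)) = 0).
{ apply cs_Cseries, (cs_finite _ 0); intros k _; unfold Cdiv; ring. }
rewrite e1 in H1; clear e1.
assert (e2 : Cseries (fun k => q ^ k * weight2 k *
   (match k with O => qpoch_inf (/ t) q | _ => 0 end * qpoch_inf (a * q * t * (t * q ^ k)) q
        / qpoch_inf (a * (t * q ^ k) ^ 2) q)) = / (1 - a * t ^ 2)).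
{ apply cs_Cseries.
  replace (/ (1 - a * t ^ 2)) with (psum (fun k => q ^ k * weight2 k *
   (match k with O => qpoch_inf (/ t) q | _ => 0 end * qpoch_inf (a * q * t * (t * q ^ k)) q
        / qpoch_inf (a * (t * q ^ k) ^ 2) q)) 1).
  - apply cs_finite; intros [|k] hk; [lia | unfold Cdiv; ring].
  - simpl psum; unfold weight2; simpl.
    replace (a * (t * 1 * (t * 1 * 1))) with (a * t ^ 2) by ring.
    assert (h := qpoch_inf_S_l q q_lt1 q_neq0 (a * t ^ 2)).
    replace (a * t ^ 2 * q) with (a * q * t * (t * 1)) in h by ring.
    assert (h1 := one_minus_at2).
    assert (h2 : qpoch_inf (a * q * t * (t * 1)) q <> 0)
      by (intros e; apply at2_inf; rewrite h, e; ring).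
    rewrite h.
    replace (a * t ^ 2) with (a * (t * t)) in * by ring.
    field; repeat split; auto. }
rewrite e2 in H2; clear e2.
replace (/ (1 - a * t ^ 2)) with (0 + / (1 - a * t ^ 2)) by ring.
apply cv_ext with (fun r =>
  Cseries (fun k => q ^ k * weight1 k * kernel q t a r (1 * q ^ k)) / t ^ r
  + Cseries (fun k => q ^ k * weight2 k * kernel q t a r (t * q ^ k)) / t ^ r);
  [intros r; unfold kernel_sum, Cdiv; ring|].
apply cv_plus; [apply H1 | apply H2].
- intros k; apply (is_lim_seq_incr_n _ (S k)).
  apply is_lim_seq_ext with (fun _ => 0%R); [|apply is_lim_seq_const].
  intros r; rewrite Cmult_1_l, nodal_qpow_lt by lia.
  unfold Cdiv; replace (0 * / t ^ (r + S k) - 0) with (RtoC 0) by ring; now rewrite Cmod_0.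
- intros [|k].
  + apply cv_ext with (qpoch (/ t) q); [|now apply cv_qpoch].
    intros r; replace (t * q ^ 0) with t by (simpl; ring).
    rewrite nodal_qpoch by auto; field; now apply Cpow_nz.
  + apply cv_le with (fun r => Cmod q ^ r * eb q (/ (Cmod t * Cmod q)))%R.
    * intros r.
      replace (nodal q (t * q ^ S k) r / t ^ r - 0) with (nodal q (t * q ^ S k) r / t ^ r)
        by ring.
      rewrite Cmod_div, Cmod_pow by (now apply Cpow_nz).
      assert (h : (Cmod (nodal q (t * q ^ S k) r)
        <= (Cmod t * Cmod q) ^ r * eb q (/ (Cmod t * Cmod q)))%R).
      { apply nodal_le; auto; [now apply Rmult_lt_0_compat|].
        rewrite Cmod_mult, Cmod_pow; apply Rmult_le_compat_l; [apply Cmod_ge_0|].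
        rewrite <- (pow_1 (Cmod q)) at 2; apply mqpow_le; auto; lia. }
      rewrite Rpow_mult_distr in h.
      assert (h0 : (0 < Cmod t ^ r)%R) by (now apply pow_lt).
      apply Rmult_le_reg_l with (Cmod t ^ r)%R; auto.
      replace (Cmod t ^ r * (Cmod (nodal q (t * q ^ S k) r) / Cmod t ^ r))%R
        with (Cmod (nodal q (t * q ^ S k) r)) by (field; lra).
      lra.
    * replace (Finite 0) with (Finite (0 * eb q (/ (Cmod t * Cmod q)))) by (f_equal; ring).
      apply is_lim_seq_mult'; [|apply is_lim_seq_const].
      apply is_lim_seq_geom; rewrite Rabs_pos_eq; lra.
Qed.

Lemma kernel_sum_value (r : nat) : (1 - a * t ^ 2) * kernel_sum r = t ^ r.
Proof.
set (v := fun r => kernel_sum r / t ^ r).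
assert (hv : forall r, v r - v (S r) = a * t ^ 2 * (v (S r) - v (S (S r)))).
{ intros s; assert (h := kernel_sum_recurrence s).
  assert (ht := Cpow_nz t s t_neq0).
  unfold v; simpl Cpow.
  transitivity (a * t ^ 2 * (kernel_sum (S s) / (t * t ^ s) - kernel_sum (S (S s)) / (t * (t * t ^ s)))
    + (t ^ 2 * kernel_sum s - (t + a * t ^ 3) * kernel_sum (S s) + a * t ^ 2 * kernel_sum (S (S s)))
      / (t ^ 2 * t ^ s)); [field; auto|].
  rewrite h; field; auto. }
assert (hl : cv v (/ (1 - a * t ^ 2))) by apply kernel_sum_limit.
assert (hc : forall s, v s = v (S s)).
{ intros s.
  assert (e : forall n, v s - v (S s) = (a * t ^ 2) ^ n * (v (n + s)%nat - v (n + S s)%nat)).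
  { induction n as [|n IH]; [simpl; ring|].
    rewrite IH, Nat.add_succ_r, hv; simpl; rewrite Nat.add_succ_r; ring. }
  assert (h0 : v s - v (S s) = 0).
  { apply cv_unique with (fun _ : nat => v s - v (S s)); [apply cv_const|].
    apply cv_ext with (1 := fun n => eq_sym (e n)).
    replace (RtoC 0) with (0 * (/ (1 - a * t ^ 2) - / (1 - a * t ^ 2))) by ring.
    apply cv_mult.
    - apply cv_le with (pow (Cmod (a * t ^ 2))).
      + intros n; replace ((a * t ^ 2) ^ n - 0) with ((a * t ^ 2) ^ n) by ring.
        rewrite Cmod_pow; lra.
      + apply is_lim_seq_geom; rewrite Rabs_pos_eq; auto using Cmod_ge_0.
    - apply cv_minus.
      + now apply (cv_shift v).
      + now apply (cv_shift v). }
  replace (v s) with (v s - v (S s) + v (S s)) by ring; rewrite h0; ring. }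
assert (hc0 : forall s, v s = v O).
{ induction s as [|s IH]; [reflexivity | now rewrite <- hc]. }
assert (e : v r = / (1 - a * t ^ 2)).
{ apply cv_unique with (2 := hl).
  apply cv_ext with (fun _ => v r); [intros n; now rewrite !hc0 | apply cv_const]. }
assert (h1 := one_minus_at2).
replace (kernel_sum r) with (v r * t ^ r) by (unfold v; field; now apply Cpow_nz).
rewrite e; field; exact h1.
Qed.

End SmallA.
End TwoLattices.

(** * Continuation in the parameter *)

Section Continuation.

Variables q t : C.
Hypothesis q_lt1 : (Cmod q < 1)%R.
Hypothesis q_neq0 : q <> 0.
Hypothesis t_neq0 : t <> 0.
Hypothesis t_inf : qpoch_inf t q <> 0.
Hypothesis tinv_inf : qpoch_inf (/ t) q <> 0.

(** [(1 - a t^2) * kernel] at [w = q^k] and at [w = t q^k], with the quotients of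
    infinite products cancelled: this is entire in [a]. For [k < r], where the
    exponent [k - r] is truncated, [nodal q (q ^ k) r] is [0]. *)
Definition poly_kernel1 (a : C) (r k : nat) : C :=
  (1 - a * t ^ 2) * qpoch_inf (a * q * t * q ^ k) q
  * (nodal q (q ^ k) r * qpoch (a * q ^ (r + k)) q (k - r)).

Definition poly_ratio (a : C) (k : nat) : C :=
  match k with
  | O => 1
  | S j => (1 - a * t ^ 2) * qpoch (a * q * t ^ 2 * q ^ k) q j
  end.

Definition poly_kernel2 (a : C) (r k : nat) : C :=
  nodal q (t * q ^ k) r * qpoch_inf (a * q ^ r * (t * q ^ k)) q * poly_ratio a k.

Lemma poly_kernel1_eq (a : C) (r k : nat) : qpoch_inf a q <> 0 ->
  poly_kernel1 a r k = (1 - a * t ^ 2) * kernel q t a r (1 * q ^ k).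
Proof.
intros ha; unfold poly_kernel1, kernel; rewrite Cmult_1_l.
destruct (Nat.lt_ge_cases k r) as [hk | hk].
- rewrite nodal_qpow_lt by exact hk; unfold Cdiv; ring.
- assert (h : qpoch_inf (a * (q ^ k) ^ 2) q <> 0).
  { intros e; apply ha; rewrite (qpoch_inf_split q q_lt1 q_neq0 a (k + k)).
    replace (a * q ^ (k + k)) with (a * (q ^ k) ^ 2) by (rewrite Cpow_add_r; ring).
    rewrite e; ring. }
  rewrite (qpoch_inf_split q q_lt1 q_neq0 (a * q ^ r * q ^ k) (k - r)).
  replace (a * q ^ r * q ^ k * q ^ (k - r)) with (a * (q ^ k) ^ 2).
  + replace (a * q ^ r * q ^ k) with (a * q ^ (r + k)) by (rewrite Cpow_add_r; ring).
    field; exact h.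
  + replace (a * q ^ r * q ^ k * q ^ (k - r)) with (a * q ^ k * (q ^ r * q ^ (k - r))) by ring.
    rewrite <- Cpow_add_r; replace (r + (k - r))%nat with k by lia; ring.
Qed.

Lemma poly_kernel2_eq (a : C) (r k : nat) : qpoch_inf (a * t ^ 2) q <> 0 ->
  poly_kernel2 a r k = (1 - a * t ^ 2) * kernel q t a r (t * q ^ k).
Proof.
intros ha; unfold poly_kernel2, kernel.
assert (h : qpoch_inf (a * (t * q ^ k) ^ 2) q <> 0).
{ intros e; apply ha; rewrite (qpoch_inf_split q q_lt1 q_neq0 (a * t ^ 2) (k + k)).
  replace (a * t ^ 2 * q ^ (k + k)) with (a * (t * q ^ k) ^ 2) by (rewrite Cpow_add_r; ring).
  rewrite e; ring. }
assert (e : (1 - a * t ^ 2) * qpoch_inf (a * q * t * (t * q ^ k)) q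
  = poly_ratio a k * qpoch_inf (a * (t * q ^ k) ^ 2) q).
{ destruct k as [|k].
  - simpl poly_ratio; replace (t * q ^ 0) with t by (simpl; ring).
    rewrite (qpoch_inf_S_l q q_lt1 q_neq0 (a * t ^ 2)).
    replace (a * t ^ 2 * q) with (a * q * t * t) by ring; ring.
  - unfold poly_ratio.
    replace (a * q * t * (t * q ^ S k)) with (a * q * t ^ 2 * q ^ S k) by ring.
    rewrite (qpoch_inf_split q q_lt1 q_neq0 (a * q * t ^ 2 * q ^ S k) k).
    replace (a * q * t ^ 2 * q ^ S k * q ^ k) with (a * (t * q ^ S k) ^ 2); [ring|].
    simpl; ring. }
transitivity (nodal q (t * q ^ k) r * qpoch_inf (a * q ^ r * (t * q ^ k)) q
  * (poly_ratio a k * qpoch_inf (a * (t * q ^ k) ^ 2) q) / qpoch_inf (a * (t * q ^ k) ^ 2) q);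
  [field; exact h|].
rewrite <- e; field; exact h.
Qed.

Definition poly_kernel_sum (a : C) (r : nat) : C :=
  Cseries (fun k => q ^ k * weight1 q t k * poly_kernel1 a r k)
  + Cseries (fun k => q ^ k * weight2 q t k * poly_kernel2 a r k).

Lemma poly_kernel_sum_small (a : C) (r : nat) :
  (Cmod a < 1)%R -> (Cmod (a * t ^ 2) < 1)%R -> poly_kernel_sum a r = t ^ r.
Proof.
intros h1 h2.
assert (h1' := qpoch_neq0_lt1 q q_lt1 q_neq0 _ h1).
assert (h2' := qpoch_neq0_lt1 q q_lt1 q_neq0 _ h2).
destruct (weight1_le q t q_lt1 q_neq0 t_neq0 t_inf tinv_inf) as [M1 hM1].
destruct (weight2_le q t q_lt1 q_neq0 t_inf tinv_inf) as [M2 hM2].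
rewrite <- (kernel_sum_value q t q_lt1 q_neq0 t_neq0 t_inf tinv_inf a h1' h2' h2 r).
unfold kernel_sum, poly_kernel_sum; rewrite Cmult_plus_distr_l; f_equal; apply cs_Cseries.
- apply cs_ext with (fun k => (1 - a * t ^ 2) *
    (q ^ k * weight1 q t k * kernel q t a r (1 * q ^ k))).
  + intros k; rewrite poly_kernel1_eq by exact h1'; ring.
  + apply cs_scal.
    apply (kernel_series q t a q_lt1 q_neq0 1 _ M1 _ hM1
      (nodal1_le q t q_lt1 q_neq0 t_neq0)).
    now replace (a * 1 ^ 2) with a by ring.
- apply cs_ext with (fun k => (1 - a * t ^ 2) *
    (q ^ k * weight2 q t k * kernel q t a r (t * q ^ k))).
  + intros k; rewrite poly_kernel2_eq by exact h2'; ring.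
  + apply cs_scal.
    now apply (kernel_series q t a q_lt1 q_neq0 t _ M2 _ hM2
      (nodal2_le q t q_lt1 q_neq0 t_neq0)).
Qed.

Lemma l1_series_qpow (rho K : R) (F : nat -> C -> C) : (0 < rho)%R -> (0 <= K)%R ->
  (forall k, l1_analytic rho (K * Cmod q ^ k) (F k)) ->
  l1_analytic rho (K * / (1 - Cmod q)) (fun u => Cseries (fun k => F k u)).
Proof.
intros hr hK hF.
apply l1_series with (fun k => K * Cmod q ^ k)%R; auto.
intros n; rewrite rsum_scal; apply Rmult_le_compat_l; auto.
apply rsum_geom; split; [apply Cmod_ge_0 | exact q_lt1].
Qed.

Lemma Cmod_qpow_le1 (k : nat) : (Cmod (q ^ k) <= 1)%R.
Proof. rewrite Cmod_pow; apply (mqpow_le q q_lt1 q_neq0 0 k); lia. Qed.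

Lemma l1_poly_kernel1 (rho : R) (r : nat) : (0 < rho)%R -> exists K : R, (0 <= K)%R /\
  forall k, l1_analytic rho (K * Cmod q ^ k)
    (fun a => q ^ k * weight1 q t k * poly_kernel1 a r k).
Proof.
intros hr.
assert (hr0 := Rlt_le _ _ hr).
destruct (weight1_le q t q_lt1 q_neq0 t_neq0 t_inf tinv_inf) as [M hM].
assert (hM0 : (0 <= M)%R) by (eapply Rle_trans; [apply Cmod_ge_0 | apply (hM O)]).
exists (M * (Cmod t ^ r * eb q (2 / Cmod t)) * eb q (1 * rho) * eb q (Cmod (q * t) * rho)
  * (1 + Cmod (t ^ 2) * rho))%R.
assert (hp : forall x, (0 <= eb q x)%R) by (intros x; apply Rlt_le, eb_pos).
split.
{ repeat apply Rmult_le_pos; auto; [apply pow_le, Cmod_ge_0|].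
  assert (h := Rmult_le_pos _ _ (Cmod_ge_0 (t ^ 2)) hr0); lra. }
intros k.
assert (H := l1_const rho (q ^ k * weight1 q t k * nodal q (q ^ k) r)).
apply (l1_qpoch_eb q q_lt1 q_neq0 _ _ (q ^ (r + k)) _ (k - r) hr0) in H.
apply (l1_qpoch_inf q q_lt1 q_neq0 _ _ (q * t * q ^ k) _ hr) in H.
apply (l1_lin _ _ 1 (- t ^ 2) _ hr0) in H.
eapply l1_ext in H; [eapply l1_mono; [|exact H]|].
- rewrite !Cmod_mult, Cmod_opp, Cmod_1.
  assert (hn := nodal1_le q t q_lt1 q_neq0 t_neq0 k r); rewrite Cmult_1_l in hn.
  assert (hqk := Cmod_qpow_le1 k).
  assert (e1 : (eb q (Cmod (q ^ (r + k)) * rho) <= eb q (1 * rho))%R).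
  { apply eb_mono; auto; apply Rmult_le_compat_r; auto; apply Cmod_qpow_le1. }
  assert (e2 : (eb q (Cmod q * Cmod t * Cmod (q ^ k) * rho) <= eb q (Cmod q * Cmod t * rho))%R).
  { apply eb_mono; auto; apply Rmult_le_compat_r; auto.
    rewrite <- (Rmult_1_r (Cmod q * Cmod t)) at 2; apply Rmult_le_compat_l; auto.
    apply Rmult_le_pos; apply Cmod_ge_0. }
  rewrite Cmod_pow at 1.
  match goal with |- (_ <= ?x)%R => replace x with
    (Cmod q ^ k * M * (Cmod t ^ r * eb q (2 / Cmod t)) * eb q (1 * rho)
     * eb q (Cmod q * Cmod t * rho) * (1 + Cmod (t ^ 2) * rho))%R by ring end.
  repeat apply Rmult_le_compat; auto using Cmod_ge_0, Rle_refl;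
    repeat (apply Rmult_le_pos || apply Cmod_ge_0 || apply pow_le || apply hp).
  assert (h := Rmult_le_pos _ _ (Cmod_ge_0 (t ^ 2)) hr0); lra.
- intros a _; unfold poly_kernel1; cbv beta.
  replace (q ^ (r + k) * a) with (a * q ^ (r + k)) by ring.
  replace (q * t * q ^ k * a) with (a * q * t * q ^ k) by ring; ring.
Qed.

Lemma l1_poly_ratio (rho M : R) (F : C -> C) (k : nat) : (0 < rho)%R ->
  l1_analytic rho M F ->
  l1_analytic rho (M * eb q (Cmod (q * t ^ 2) * rho) * (1 + Cmod (t ^ 2) * rho))
    (fun a => poly_ratio a k * F a).
Proof.
intros hr hF; assert (hr0 := Rlt_le _ _ hr).
assert (hM : (0 <= M)%R) by (destruct hF as [h [h1 _]]; exact (h1 O)).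
assert (h0 := Rmult_le_pos _ _ (Cmod_ge_0 (t ^ 2)) hr0).
assert (h1 := Rmult_le_pos _ _ (Cmod_ge_0 (q * t ^ 2)) hr0).
assert (h2 := eb_ge1 q q_lt1 q_neq0 _ h1).
destruct k as [|k].
- apply l1_ext with F; [intros; simpl; ring|]; apply l1_mono with (2 := hF).
  rewrite <- (Rmult_1_r M) at 1; rewrite Rmult_assoc; apply Rmult_le_compat_l; auto.
  replace 1%R with (1 * 1)%R at 1 by ring; apply Rmult_le_compat; lra.
- apply (l1_qpoch_eb q q_lt1 q_neq0 _ _ (q * t ^ 2 * q ^ S k) _ k hr0) in hF.
  apply (l1_lin _ _ 1 (- t ^ 2) _ hr0) in hF.
  eapply l1_ext in hF; [eapply l1_mono; [|exact hF]|].
  + rewrite Cmod_opp, Cmod_1; apply Rmult_le_compat_r; [lra|].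
    apply Rmult_le_compat_l; auto; apply eb_mono; auto; apply Rmult_le_compat_r; auto.
    rewrite (Cmod_mult (q * t ^ 2)); rewrite <- (Rmult_1_r (Cmod (q * t ^ 2))) at 2.
    apply Rmult_le_compat_l; [apply Cmod_ge_0 | apply Cmod_qpow_le1].
  + intros a _; unfold poly_ratio; cbv beta.
    replace (q * t ^ 2 * q ^ S k * a) with (a * q * t ^ 2 * q ^ S k) by ring; ring.
Qed.

Lemma l1_poly_kernel2 (rho : R) (r : nat) : (0 < rho)%R -> exists K : R, (0 <= K)%R /\
  forall k, l1_analytic rho (K * Cmod q ^ k)
    (fun a => q ^ k * weight2 q t k * poly_kernel2 a r k).
Proof.
intros hr.
assert (hr0 := Rlt_le _ _ hr).
destruct (weight2_le q t q_lt1 q_neq0 t_inf tinv_inf) as [M hM].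
assert (hM0 : (0 <= M)%R) by (eapply Rle_trans; [apply Cmod_ge_0 | apply (hM O)]).
exists (M * (Cmod t ^ r * eb q (/ Cmod t)) * eb q (Cmod t * rho)
  * eb q (Cmod (q * t ^ 2) * rho) * (1 + Cmod (t ^ 2) * rho))%R.
assert (hp : forall x, (0 <= eb q x)%R) by (intros x; apply Rlt_le, eb_pos).
assert (h0 := Rmult_le_pos _ _ (Cmod_ge_0 (t ^ 2)) hr0).
split.
{ repeat apply Rmult_le_pos; auto; [apply pow_le, Cmod_ge_0 | lra]. }
intros k.
assert (H := l1_const rho (q ^ k * weight2 q t k * nodal q (t * q ^ k) r)).
apply (l1_qpoch_inf q q_lt1 q_neq0 _ _ (q ^ r * (t * q ^ k)) _ hr) in H.
apply (l1_poly_ratio _ _ _ k hr) in H.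
eapply l1_ext in H; [eapply l1_mono; [|exact H]|].
- assert (hn := nodal2_le q t q_lt1 q_neq0 t_neq0 k r).
  assert (e1 : (eb q (Cmod (q ^ r * (t * q ^ k)) * rho) <= eb q (Cmod t * rho))%R).
  { apply eb_mono; auto; apply Rmult_le_compat_r; auto.
    replace (q ^ r * (t * q ^ k)) with (t * q ^ (r + k)) by (rewrite Cpow_add_r; ring).
    now apply Cmod_mul_qpow_le. }
  rewrite !(Cmod_mult _ (nodal q (t * q ^ k) r)), (Cmod_mult (q ^ k)), Cmod_pow.
  match goal with |- (_ <= ?x)%R => replace x with
    (Cmod q ^ k * M * (Cmod t ^ r * eb q (/ Cmod t)) * eb q (Cmod t * rho)
     * eb q (Cmod (q * t ^ 2) * rho) * (1 + Cmod (t ^ 2) * rho))%R by ring end.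
  repeat apply Rmult_le_compat; auto using Cmod_ge_0, Rle_refl;
    repeat (apply Rmult_le_pos || apply Cmod_ge_0 || apply pow_le || apply hp); lra.
- intros a _; unfold poly_kernel2; cbv beta.
  replace (q ^ r * (t * q ^ k) * a) with (a * q ^ r * (t * q ^ k)) by ring; ring.
Qed.

Lemma poly_kernel_sum_value (a : C) (r : nat) : poly_kernel_sum a r = t ^ r.
Proof.
set (rho := (1 + Cmod a)%R).
assert (ha := Cmod_ge_0 a).
assert (hr : (0 < rho)%R) by (unfold rho; lra).
destruct (l1_poly_kernel1 rho r hr) as [K1 [hK1 H1]].
destruct (l1_poly_kernel2 rho r hr) as [K2 [hK2 H2]].
apply (l1_series_qpow _ _ _ hr hK1) in H1.
apply (l1_series_qpow _ _ _ hr hK2) in H2.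
assert (H := l1_plus _ _ _ _ _ (Rlt_le _ _ hr)
  (l1_plus _ _ _ _ _ (Rlt_le _ _ hr) H1 H2) (l1_const rho (- t ^ r))).
cbv beta in H.
assert (hs : is_lim_seq (fun n => Cmod (t ^ 2 * q ^ n - 0)) 0) by (now apply cv_scal_qpow).
apply is_lim_seq_spec in hs; destruct (hs (mkposreal _ Rlt_0_1)) as [N HN]; simpl in HN.
assert (h := l1_identity _ _ _ (fun k => q ^ (k + S N)) hr H).
cbv beta in h.
assert (e : poly_kernel_sum a r + - t ^ r = 0).
{ apply h.
  - apply (cv_shift (fun n => q ^ n)); now apply cv_qpow.
  - intros k; now apply Cpow_nz.
  - intros k; eapply Rle_trans; [apply Cmod_qpow_le1 | unfold rho; lra].
  - intros k.
    assert (e := poly_kernel_sum_small (q ^ (k + S N)) r).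
    unfold poly_kernel_sum in e; rewrite e; [ring| |].
    + eapply Rle_lt_trans; [|exact q_lt1].
      rewrite Cmod_pow; rewrite <- (pow_1 (Cmod q)) at 2; apply mqpow_le; auto; lia.
    + assert (e1 := HN (k + S N)%nat ltac:(lia)).
      rewrite Rminus_0_r, Rabs_pos_eq in e1 by apply Cmod_ge_0.
      replace (q ^ (k + S N) * t ^ 2) with (t * (t * 1) * q ^ (k + S N) - 0) by ring; exact e1.
  - unfold rho; lra. }
replace (poly_kernel_sum a r) with (poly_kernel_sum a r + - t ^ r + t ^ r) by ring.
rewrite e; ring.
Qed.

End Continuation.

(** * Bailey inversion *)

Section Inversion.

Variables q A : C.
Hypothesis q_lt1 : (Cmod q < 1)%R.
Hypothesis q_neq0 : q <> 0.
Hypothesis A_neq1 : 1 - A <> 0.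

Lemma qpow_sub_neq0 (j k : nat) : j <> k -> q ^ k - q ^ j <> 0.
Proof.
assert (H : forall i n, (i < n)%nat -> q ^ n <> q ^ i).
{ intros i n h e; apply (f_equal Cmod) in e; rewrite !Cmod_pow in e.
  assert (hq := mq_bounds q q_lt1 q_neq0).
  assert (h1 := mqpow_le q q_lt1 q_neq0 (S i) n h); simpl in h1.
  assert (h2 := pow_lt (Cmod q) i (proj1 hq)); nra. }
intros hjk e.
assert (e1 : q ^ k = q ^ j) by (replace (q ^ k) with (q ^ k - q ^ j + q ^ j) by ring;
  rewrite e; ring).
destruct (Nat.lt_gt_cases j k) as [h _]; destruct (h hjk) as [h1 | h1].
- exact (H j k h1 e1).
- exact (H k j h1 (eq_sym e1)).
Qed.

Lemma one_sub_qpow_neq0 (n : nat) : 1 - q ^ S n <> 0.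
Proof. apply (qpow_sub_neq0 (S n) 0); lia. Qed.

Lemma qfact_neq0 (n : nat) : qpoch q q n <> 0.
Proof. apply qpoch_neq0; auto; now apply qfact_inf_neq0. Qed.

Lemma qpoch_inv_qpow_lt (r j : nat) : (r < j)%nat -> qpoch (/ q ^ r) q j = 0.
Proof.
induction 1 as [|j _ IH]; simpl; [|rewrite IH; ring].
replace (1 - / q ^ r * q ^ r) with (RtoC 0) by (field; now apply Cpow_nz); ring.
Qed.

Definition inv_term (j k r : nat) : C :=
  qpoch A q (r + j) * (1 - A * q ^ (2 * r)) * qpoch (/ q ^ r) q j / qpoch q q r
  * (nodal q (q ^ k) r * qpoch (A * q * q ^ (r + k)) q (k - r)).

Lemma inv_term_sum (j k m : nat) : (m <= k)%nat ->
  (q ^ k - q ^ j) * psum (inv_term j k) (S m)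
  = qpoch A q (S (m + j)) * qpoch (/ q ^ m) q j / qpoch q q m
    * (nodal q (q ^ k) (S m) * qpoch (A * q * q ^ (m + k)) q (k - m)).
Proof.
induction m as [|m IH]; intros hm.
- simpl psum; unfold inv_term; rewrite !Nat.add_0_l, Nat.sub_0_r, Nat.mul_0_r.
  destruct j as [|j].
  + simpl; field; split; apply C1_neq_0.
  + rewrite (qpoch_inv_qpow_lt 0 (S j)) by lia; unfold Cdiv; ring.
- change (psum (inv_term j k) (S (S m)))
    with (psum (inv_term j k) (S m) + inv_term j k (S m)).
  rewrite Cmult_plus_distr_l, IH by lia; unfold inv_term.
  assert (hp := one_sub_qpow_neq0 m).
  assert (hqm := Cpow_nz q m q_neq0).
  assert (hf := qfact_neq0 m).
  assert (e1 : qpoch (/ q ^ m) q j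
    = qpoch (/ q ^ S m) q j * (1 - / q ^ S m * q ^ j) / (1 - / q ^ S m)).
  { change (qpoch (/ q ^ S m) q j * (1 - / q ^ S m * q ^ j)) with (qpoch (/ q ^ S m) q (S j)).
    rewrite qpoch_S_l.
    replace (/ q ^ S m * q) with (/ q ^ m) by (simpl; field; auto).
    simpl; field; repeat split; auto.
    intros e; apply hp; simpl; replace (1 - q * q ^ m) with (- (q * q ^ m - 1)) by ring.
    rewrite e; ring. }
  replace (k - m)%nat with (S (k - S m)) by lia.
  rewrite (qpoch_S_l q (A * q * q ^ (m + k))), e1.
  replace (A * q * q ^ (m + k) * q) with (A * q * q ^ (S m + k)) by (simpl; ring).
  replace (S m + j)%nat with (S (m + j)) by lia.
  change (qpoch A q (S (S (m + j)))) with (qpoch A q (S (m + j)) * (1 - A * q ^ S (m + j))).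
  simpl nodal; simpl (qpoch q q (S m)).
  replace (q ^ (2 * S m)) with (q * q ^ m * (q * q ^ m))
    by (replace (2 * S m)%nat with (S m + S m)%nat by lia; rewrite Cpow_add_r; reflexivity).
  rewrite !(Cpow_add_r q m k), !Cpow_S, (Cpow_add_r q m j).
  revert hp; simpl (q ^ S m); intros hp.
  generalize (qpoch A q (S (m + j))) (qpoch (/ (q * q ^ m)) q j) (nodal q (q ^ k) m)
    (qpoch (A * q * q ^ (S m + k)) q (k - S m)) (q ^ k) (q ^ j); intros X Y N Z K J.
  revert hp hqm hf; generalize (qpoch q q m) (q ^ m); intros Fm M hf hp hqm.
  field; repeat split; auto.
  intros e; apply hf; replace (1 - q * M) with (- (q * M - 1)) by ring; rewrite e; ring.
Qed.

Lemma inv_term_diag (k : nat) :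
  qpoch (/ q ^ k) q k * nodal q (q ^ k) k * q ^ k = qpoch q q k * qpoch q q k.
Proof.
induction k as [|k IH]; [simpl; ring|].
assert (hqm := Cpow_nz q k q_neq0).
rewrite qpoch_S_l; simpl (q ^ S k); rewrite nodal_shift.
replace (/ (q * q ^ k) * q) with (/ q ^ k) by (field; auto).
simpl qpoch.
transitivity ((1 - q * q ^ k) * (1 - q * q ^ k)
  * (qpoch (/ q ^ k) q k * nodal q (q ^ k) k * q ^ k)); [field; auto|].
rewrite IH; ring.
Qed.

Variable f : nat -> C.

(** The coefficient of [t^r] in the generating function; [f] plays the role of
    [f_k = (q;q)_k beta_k] for a Bailey pair relative to [A]. *)
Definition bailey_coef (r : nat) : C :=
  qpoch A q r * (1 - A * q ^ (2 * r)) / (qpoch q q r * (1 - A))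
  * psum (fun j => qpoch (/ q ^ r) q j * qpoch (A * q ^ r) q j / qpoch q q j * q ^ j * f j) (S r).

Lemma psum_single (a : nat -> C) (n k : nat) : (k < n)%nat ->
  (forall j, (j < n)%nat -> j <> k -> a j = 0) -> psum a n = a k.
Proof.
intros hk h; induction n as [|n IH]; [lia|]; simpl.
destruct (Nat.eq_dec k n) as [-> | hn].
- rewrite psum_zero; [ring|].
  intros j hj; apply h; lia.
- rewrite IH, (h n) by (lia || intros; apply h; lia); ring.
Qed.

Lemma bailey_inversion (k : nat) :
  psum (fun r => bailey_coef r * (nodal q (q ^ k) r * qpoch (A * q * q ^ (r + k)) q (k - r))) (S k)
  = qpoch (A * q) q (k + k) * f k.
Proof.
transitivity (psum (fun r => psum (fun j =>
  q ^ j * f j / (qpoch q q j * (1 - A)) * inv_term j k r) (S k)) (S k)).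
- apply psum_ext; intros r hr; unfold bailey_coef.
  replace (psum (fun j => qpoch (/ q ^ r) q j * qpoch (A * q ^ r) q j / qpoch q q j * q ^ j * f j) (S r))
    with (psum (fun j => qpoch (/ q ^ r) q j * qpoch (A * q ^ r) q j / qpoch q q j * q ^ j * f j) (S k)).
  + match goal with |- ?c * psum ?g ?n * ?d = _ => transitivity (c * d * psum g n); [ring|] end.
    rewrite <- psum_scal; apply psum_ext; intros j _.
    unfold inv_term; rewrite qpoch_add.
    field; repeat split; auto using qfact_neq0.
  + replace (S k) with (S r + (k - r))%nat by lia; rewrite psum_split.
    match goal with |- ?x + ?y = _ => replace y with (RtoC 0); [ring|] end.
    symmetry; apply psum_zero; intros i _; rewrite qpoch_inv_qpow_lt by lia; unfold Cdiv; ring.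
- rewrite psum_exchange.
  transitivity (psum (fun j => q ^ j * f j / (qpoch q q j * (1 - A))
    * psum (inv_term j k) (S k)) (S k)); [apply psum_ext; intros j _; apply psum_scal|].
  rewrite (psum_single _ _ k).
  + rewrite (psum_single (inv_term k k) _ k).
    * unfold inv_term; rewrite Nat.sub_diag; simpl (qpoch _ _ 0).
      assert (e : qpoch A q (k + k) * (1 - A * q ^ (2 * k)) = (1 - A) * qpoch (A * q) q (k + k)).
      { rewrite <- qpoch_S_l; simpl; rewrite Nat.add_0_r; reflexivity. }
      assert (e1 := inv_term_diag k).
      assert (hf := qfact_neq0 k).
      transitivity (f k * (qpoch A q (k + k) * (1 - A * q ^ (2 * k)))
        * (qpoch (/ q ^ k) q k * nodal q (q ^ k) k * q ^ k)
        / (qpoch q q k * qpoch q q k * (1 - A))); [field; auto|].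
      rewrite e, e1; field; auto.
    * lia.
    * intros r hr hrk; unfold inv_term; rewrite qpoch_inv_qpow_lt by lia; unfold Cdiv; ring.
  + lia.
  + intros j hj hjk.
    assert (h := inv_term_sum j k k (Nat.le_refl _)).
    rewrite nodal_qpow_lt in h by lia.
    assert (h1 := qpow_sub_neq0 j k hjk).
    replace (psum (inv_term j k) (S k))
      with ((q ^ k - q ^ j) * psum (inv_term j k) (S k) / (q ^ k - q ^ j)) by (field; auto).
    rewrite h; unfold Cdiv; ring.
Qed.

End Inversion.

(** * Abel's limit theorem and expansion in the dual basis *)

Lemma summation_by_parts (s x : nat -> C) (K n : nat) :
  psum (fun k => s (K + k)%nat * x (K + k)%nat) n
  = (psum s (K + n) - psum s K) * x (K + n)%nat
    - psum (fun k => (psum s (K + S k) - psum s K) * (x (S (K + k)) - x (K + k)%nat)) n.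
Proof.
induction n as [|n IH]; [rewrite Nat.add_0_r; simpl; ring|].
simpl psum at 1 4; rewrite IH, Nat.add_succ_r; simpl psum; ring.
Qed.

Lemma abel_tail (s x : nat -> C) (l : C) (e B V : R) (K n : nat) :
  (forall m, (K <= m)%nat -> Cmod (psum s m - l) <= e)%R ->
  (forall r, Cmod (x r) <= B)%R ->
  (forall N, rsum (fun r => Cmod (x (S r) - x r)) N <= V)%R ->
  (Cmod (psum (fun r => s r * x r)%C (K + n) - psum (fun r => s r * x r)%C K)
    <= 2 * e * (B + V))%R.
Proof.
intros hs hB hV.
assert (hsig : forall k, (Cmod (psum s (K + k) - psum s K) <= 2 * e)%R).
{ intros k; assert (h1 := hs (K + k)%nat ltac:(lia)); assert (h2 := hs K (Nat.le_refl _)).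
  replace (psum s (K + k) - psum s K) with ((psum s (K + k) - l) + - (psum s K - l)) by ring.
  eapply Rle_trans; [apply Cmod_triangle|]; rewrite Cmod_opp; lra. }
assert (he : (0 <= 2 * e)%R) by (eapply Rle_trans; [apply Cmod_ge_0 | apply (hsig O)]).
rewrite psum_split.
replace (psum (fun r => s r * x r)%C K + psum (fun k => s (K + k)%nat * x (K + k)%nat) n
  - psum (fun r => s r * x r)%C K) with (psum (fun k => s (K + k)%nat * x (K + k)%nat) n) by ring.
rewrite summation_by_parts.
match goal with |- (Cmod (?y - ?z) <= _)%R => replace (y - z) with (y + - z) by ring end.
eapply Rle_trans; [apply Cmod_triangle|]; rewrite Cmod_opp, Cmod_mult, Rmult_plus_distr_l.
apply Rplus_le_compat.
- apply Rmult_le_compat; auto using Cmod_ge_0.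
- eapply Rle_trans; [apply psum_le_rsum with
    (b := fun k => (2 * e * Cmod (x (S (K + k)) - x (K + k)%nat))%R)|].
  + intros k; rewrite Cmod_mult; apply Rmult_le_compat_r; auto using Cmod_ge_0.
  + rewrite rsum_scal; apply Rmult_le_compat_l; auto.
    eapply Rle_trans; [|apply (hV (K + n)%nat)].
    assert (h : forall m, (rsum (fun k => Cmod (x (S (K + k)) - x (K + k)%nat)) m
      + rsum (fun r => Cmod (x (S r) - x r)) K = rsum (fun r => Cmod (x (S r) - x r)) (K + m))%R).
    { induction m as [|m IH]; [rewrite Nat.add_0_r; simpl; ring|].
      rewrite Nat.add_succ_r; simpl; rewrite <- IH; ring. }
    assert (h1 := rsum_nonneg (fun r => Cmod (x (S r) - x r)) K (fun r => Cmod_ge_0 _)).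
    specialize (h n); lra.
Qed.

(** Abel's limit theorem with the weights [x^r] replaced by any family of
    uniformly bounded variation. *)
Lemma abel_limit (s c N : nat -> C) (b : nat -> nat -> C) (l L : C) (B V : R) :
  cs s l -> (forall n r, Cmod (b n r) <= B)%R ->
  (forall n K, rsum (fun r => Cmod (b n (S r) - b n r)) K <= V)%R ->
  (forall r, cv (fun n => b n r) (c r)) ->
  (forall n, cs (fun r => s r * b n r) (N n)) -> cv N L ->
  cs (fun r => s r * c r) L.
Proof.
intros hs hB hV hc hN hL.
assert (hB0 : (0 <= B)%R) by (eapply Rle_trans; [apply Cmod_ge_0 | apply (hB O O)]).
assert (hV0 : (0 <= V)%R) by exact (hV O O).
apply is_lim_seq_spec; intros eps; assert (heps := cond_pos eps).
set (e := (eps / (8 * (B + V + 1)))%R).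
assert (he : (0 < e)%R) by (apply Rdiv_lt_0_compat; lra).
assert (hs' := hs); apply is_lim_seq_spec in hs'.
destruct (hs' (mkposreal _ he)) as [K HK]; simpl in HK.
assert (HK' : forall m, (K <= m)%nat -> (Cmod (psum s m - l) <= e)%R).
{ intros m hm; specialize (HK m hm); rewrite Rminus_0_r, Rabs_pos_eq in HK by apply Cmod_ge_0.
  lra. }
exists K; intros m hm; rewrite Rminus_0_r, Rabs_pos_eq by apply Cmod_ge_0.
assert (hu : forall n, (Cmod (N n - psum (fun r => s r * b n r)%C m) <= 2 * e * (B + V))%R).
{ intros n; apply cv_bound with
    (fun j => psum (fun r => s r * b n r)%C (j + m) - psum (fun r => s r * b n r)%C m).
  - apply cv_minus; [|apply cv_const]; apply (cv_shift (psum (fun r => s r * b n r)%C)), hN.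
  - intros j; rewrite Nat.add_comm; apply abel_tail with l; auto.
    intros i hi; apply HK'; lia. }
assert (hps : cv (fun n => psum (fun r => s r * b n r)%C m) (psum (fun r => s r * c r)%C m)).
{ clear - hc; induction m as [|m IH]; simpl; [apply cv_const|].
  apply cv_plus; [exact IH | now apply cv_scal]. }
assert (h8 : (2 * e * (B + V) <= eps / 4)%R).
{ unfold e; apply Rmult_le_reg_r with (8 * (B + V + 1))%R; [lra|].
  replace (2 * (eps / (8 * (B + V + 1))) * (B + V) * (8 * (B + V + 1)))%R
    with (2 * eps * (B + V))%R by (field; lra).
  nra. }
assert (hfin : (Cmod (L - psum (fun r => s r * c r)%C m) <= eps / 4)%R).
{ apply cv_bound with (fun n => N n - psum (fun r => s r * b n r)%C m).
  - now apply cv_minus.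
  - intros n; eapply Rle_trans; [apply hu | exact h8]. }
replace (psum (fun r => s r * c r)%C m - L) with (- (L - psum (fun r => s r * c r)%C m)) by ring.
rewrite Cmod_opp; lra.
Qed.

Lemma cs_terms_bounded (s : nat -> C) (l : C) : cs s l -> exists M : R, forall r, (Cmod (s r) <= M)%R.
Proof.
intros hs.
assert (h : cv s 0).
{ replace (RtoC 0) with (l - l) by ring.
  apply cv_ext with (fun n => psum s (S n) - psum s n); [intros n; simpl; ring|].
  apply cv_minus; [now apply (cv_S (psum s)) | exact hs]. }
apply cv_Cmod in h.
destruct (filterlim_bounded (fun n => Cmod (s n))) as [M hM].
- exists (Cmod 0); exact h.
- exists M; intros r; eapply Rle_trans; [|apply (hM r)].
  change (Cmod (s r) <= Rabs (Cmod (s r)))%R; apply Rle_abs.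
Qed.

Section Expansion.

Variables q A t : C.
Hypothesis q_lt1 : (Cmod q < 1)%R.
Hypothesis q_neq0 : q <> 0.
Hypothesis t_neq0 : t <> 0.
Hypothesis A_neq1 : 1 - A <> 0.

Variables (x1 x2 b1 b2 b3 c : C) (f : nat -> C).

Definition den_fun (u : C) : C := qpoch_inf (x1 * u) q * qpoch_inf (x2 * u) q.
Definition num_fun (u : C) : C :=
  c * (qpoch_inf (b1 * u) q * qpoch_inf (b2 * u) q * qpoch_inf (b3 * u) q).

Hypothesis f_eq : forall k, den_fun (q ^ k) * f k = num_fun (q ^ k).

Definition basis_fun (r : nat) (u : C) : C :=
  nodal q u r * qpoch_inf (A * q * q ^ r * u) q.

Variable l : C.
Hypothesis sum_l : cs (fun r => bailey_coef q A f r * t ^ r) l.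

Lemma l1_den_mul (rho M : R) (F : C -> C) : (0 < rho)%R -> l1_analytic rho M F ->
  exists M' : R, l1_analytic rho M' (fun u => den_fun u * F u).
Proof.
intros hr hF.
apply (l1_qpoch_inf q q_lt1 q_neq0 _ _ x2 _ hr) in hF.
apply (l1_qpoch_inf q q_lt1 q_neq0 _ _ x1 _ hr) in hF.
eexists; eapply l1_ext; [|exact hF]; intros u _; unfold den_fun; ring.
Qed.

Lemma l1_num (rho : R) : (0 < rho)%R -> exists M : R, l1_analytic rho M num_fun.
Proof.
intros hr.
assert (H := l1_const rho c).
apply (l1_qpoch_inf q q_lt1 q_neq0 _ _ b1 _ hr) in H.
apply (l1_qpoch_inf q q_lt1 q_neq0 _ _ b2 _ hr) in H.
apply (l1_qpoch_inf q q_lt1 q_neq0 _ _ b3 _ hr) in H.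
eexists; eapply l1_ext; [|exact H]; intros u _; unfold num_fun; ring.
Qed.

Lemma l1_basis (rho : R) (r : nat) : (0 < rho)%R ->
  l1_analytic rho (rho ^ r * (eb q (Cmod (A * q) * rho) * eb q (/ rho))) (basis_fun r).
Proof.
intros hr; assert (hr0 := Rlt_le _ _ hr).
assert (H := l1_const rho 1).
apply (l1_qpoch_inf q q_lt1 q_neq0 _ _ (A * q * q ^ r) _ hr) in H.
apply (l1_nodal q q_lt1 q_neq0 _ _ _ r hr) in H.
eapply l1_ext in H; [eapply l1_mono; [|exact H]|].
- rewrite Cmod_1, Rmult_1_l.
  replace (rho ^ r * (eb q (Cmod (A * q) * rho) * eb q (/ rho)))%R
    with (eb q (Cmod (A * q) * rho) * (rho ^ r * eb q (/ rho)))%R by ring.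
  apply Rmult_le_compat_r.
  + apply Rmult_le_pos; [now apply pow_le | apply Rlt_le, eb_pos].
  + apply eb_mono; auto; apply Rmult_le_compat_r; auto.
    rewrite (Cmod_mult (A * q)); rewrite <- (Rmult_1_r (Cmod (A * q))) at 2.
    apply Rmult_le_compat_l; [apply Cmod_ge_0 | now apply Cmod_qpow_le1].
- intros u _; unfold basis_fun; ring.
Qed.

Lemma coef_le : exists M : R, (0 <= M)%R /\
  forall r, (Cmod (bailey_coef q A f r) * Cmod t ^ r <= M)%R.
Proof.
destruct (cs_terms_bounded _ _ sum_l) as [M hM]; exists M; split.
- eapply Rle_trans; [apply Cmod_ge_0 | apply (hM O)].
- intros r; rewrite <- Cmod_pow, <- Cmod_mult; apply hM.
Qed.

Lemma basis_qpow_sum (k : nat) :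
  cs (fun r => bailey_coef q A f r * basis_fun r (q ^ k)) (qpoch_inf (A * q) q * f k).
Proof.
rewrite (qpoch_inf_split q q_lt1 q_neq0 (A * q) (k + k)).
replace (qpoch (A * q) q (k + k) * qpoch_inf (A * q * q ^ (k + k)) q * f k)
  with (qpoch_inf (A * q * q ^ (k + k)) q * (qpoch (A * q) q (k + k) * f k)) by ring.
rewrite <- (bailey_inversion q A q_lt1 q_neq0 A_neq1 f k), <- psum_scal.
rewrite (psum_ext _ (fun r => bailey_coef q A f r * basis_fun r (q ^ k))).
- apply cs_finite; intros r hr; unfold basis_fun.
  rewrite nodal_qpow_lt by lia; ring.
- intros r hr; unfold basis_fun.
  replace (A * q * q ^ r * q ^ k) with (A * q * q ^ (r + k)) by (rewrite Cpow_add_r; ring).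
  rewrite (qpoch_inf_split q q_lt1 q_neq0 (A * q * q ^ (r + k)) (k - r)).
  replace (A * q * q ^ (r + k) * q ^ (k - r)) with (A * q * q ^ (k + k)); [ring|].
  replace (k + k)%nat with ((r + k) + (k - r))%nat by lia; rewrite !Cpow_add_r; ring.
Qed.

Lemma basis_term_le (r : nat) (u : C) (rho : R) : (0 < rho)%R -> (Cmod u <= rho)%R ->
  (Cmod (basis_fun r u) <= rho ^ r * (eb q (Cmod (A * q) * rho) * eb q (/ rho)))%R.
Proof. intros hr; apply l1_bound; now apply l1_basis. Qed.

Lemma expansion_inside (u : C) : (Cmod u < Cmod t)%R ->
  exists N, cs (fun r => bailey_coef q A f r * basis_fun r u) N
    /\ den_fun u * N = qpoch_inf (A * q) q * num_fun u.
Proof.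
intros hu.
set (rho := ((Cmod u + Cmod t) / 2)%R).
assert (hu0 := Cmod_ge_0 u).
assert (hr : (0 < rho)%R) by (unfold rho; lra).
assert (hru : (Cmod u <= rho)%R) by (unfold rho; lra).
assert (hrt : (0 <= rho / Cmod t < 1)%R).
{ split; [apply Rlt_le, Rdiv_lt_0_compat; lra|].
  apply Rmult_lt_reg_r with (Cmod t); [lra|].
  replace (rho / Cmod t * Cmod t)%R with rho by (field; lra); unfold rho; lra. }
destruct coef_le as [Ma [hMa0 hMa]].
set (E := (eb q (Cmod (A * q) * rho) * eb q (/ rho))%R).
assert (hE : (0 <= E)%R) by (apply Rmult_le_pos; apply Rlt_le, eb_pos).
assert (hterm : forall r, l1_analytic rho (Ma * E * (rho / Cmod t) ^ r)
  (fun v => bailey_coef q A f r * basis_fun r v)).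
{ intros r; eapply l1_mono; [|apply l1_scal, (l1_basis rho r hr)]; fold E.
  assert (h0 : (0 < Cmod t ^ r)%R) by (apply pow_lt; lra).
  apply Rmult_le_reg_r with (Cmod t ^ r)%R; auto.
  replace ((rho / Cmod t) ^ r)%R with (rho ^ r / Cmod t ^ r)%R
    by (unfold Rdiv; rewrite Rpow_mult_distr, pow_inv; ring).
  replace (Ma * E * (rho ^ r / Cmod t ^ r) * Cmod t ^ r)%R with (Ma * (rho ^ r * E))%R
    by (field; lra).
  replace (Cmod (bailey_coef q A f r) * (rho ^ r * E) * Cmod t ^ r)%R
    with (Cmod (bailey_coef q A f r) * Cmod t ^ r * (rho ^ r * E))%R by ring.
  apply Rmult_le_compat_r; auto.
  apply Rmult_le_pos; auto; apply pow_le; lra. }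
assert (hMs : forall n, (rsum (fun r => Ma * E * (rho / Cmod t) ^ r) n
  <= Ma * E * / (1 - rho / Cmod t))%R).
{ intros n; rewrite rsum_scal; apply Rmult_le_compat_l; [now apply Rmult_le_pos|].
  now apply rsum_geom. }
assert (H := l1_series _ _ _ _ hr hterm hMs).
assert (hcs : cs (fun r => bailey_coef q A f r * basis_fun r u)
  (Cseries (fun r => bailey_coef q A f r * basis_fun r u))).
{ apply cs_dominated with (fun r => Ma * E * (rho / Cmod t) ^ r)%R.
  - intros r; exact (l1_bound _ _ _ u (hterm r) hru).
  - apply ex_series_Rscal; now apply ex_series_pow. }
exists (Cseries (fun r => bailey_coef q A f r * basis_fun r u)); split; [exact hcs|].
destruct (l1_den_mul _ _ _ hr H) as [M1 H1].
destruct (l1_num rho hr) as [M2 H2].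
assert (H3 := l1_plus _ _ _ _ _ (Rlt_le _ _ hr) H1
  (l1_scal _ _ (- qpoch_inf (A * q) q) _ H2)); cbv beta in H3.
assert (hq0 := cv_qpow q q_lt1 q_neq0).
assert (hq0' := hq0); apply is_lim_seq_spec in hq0'.
destruct (hq0' (mkposreal _ hr)) as [N HN]; simpl in HN.
assert (e := l1_identity _ _ _ (fun k => q ^ (k + N)) hr H3); cbv beta in e.
assert (e0 : forall v, (Cmod v <= rho)%R ->
  den_fun v * Cseries (fun r => bailey_coef q A f r * basis_fun r v)
  + - qpoch_inf (A * q) q * num_fun v = 0).
{ apply e.
  - now apply (cv_shift (fun n => q ^ n)).
  - intros k; now apply Cpow_nz.
  - intros k; assert (h := HN (k + N)%nat ltac:(lia)).
    rewrite Rminus_0_r, Rabs_pos_eq in h by apply Cmod_ge_0.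
    replace (q ^ (k + N) - 0) with (q ^ (k + N)) in h by ring; lra.
  - intros k; rewrite (cs_Cseries _ _ (basis_qpow_sum (k + N))), <- f_eq; ring. }
specialize (e0 u hru).
match type of e0 with ?y + _ = _ => transitivity (y + - qpoch_inf (A * q) q * num_fun u
  + qpoch_inf (A * q) q * num_fun u); [ring|] end.
rewrite e0; ring.
Qed.

Definition approach (n : nat) : C := RtoC (1 - / (INR n + 2)) * t.

Lemma approach_ratio (n : nat) : (/ 2 <= 1 - / (INR n + 2) < 1)%R.
Proof.
assert (h := pos_INR n).
assert (h1 : (0 < / (INR n + 2))%R) by (apply Rinv_0_lt_compat; lra).
assert (h2 : (/ (INR n + 2) <= / 2)%R) by (apply Rinv_le_contravar; lra).
lra.
Qed.

Lemma Cmod_approach (n : nat) : Cmod (approach n) = ((1 - / (INR n + 2)) * Cmod t)%R.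
Proof.
unfold approach; rewrite Cmod_mult, Cmod_R, Rabs_pos_eq; [reflexivity|].
assert (h := approach_ratio n); lra.
Qed.

Lemma cv_approach : cv approach t.
Proof.
apply cv_le with (fun n => / (INR n + 2) * Cmod t)%R.
- intros n; unfold approach.
  replace (RtoC (1 - / (INR n + 2)) * t - t) with (RtoC (- / (INR n + 2)) * t)
    by (rewrite RtoC_minus, RtoC_opp; ring).
  rewrite Cmod_mult, Cmod_R, Rabs_Ropp, Rabs_pos_eq; [lra|].
  apply Rlt_le, Rinv_0_lt_compat; assert (h := pos_INR n); lra.
- replace (Finite 0) with (Finite (0 * Cmod t)) by (f_equal; ring).
  apply is_lim_seq_mult'; [|apply is_lim_seq_const].
  apply (is_lim_seq_inv _ p_infty); [|discriminate].
  apply (is_lim_seq_plus _ _ p_infty 2); [apply is_lim_seq_INR | apply is_lim_seq_const | reflexivity].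
Qed.

Lemma basis_variation (rho : R) (u : C) (r : nat) :
  (/ 2 <= rho < 1)%R -> u = RtoC rho * t ->
  (Cmod (basis_fun (S r) u / t ^ S r - basis_fun r u / t ^ r)
    <= eb q (2 / Cmod t) * eb q (Cmod (A * q) * Cmod t) / Cmod t
       * (Cmod t * ((1 - rho) * rho ^ r) + (1 + Cmod t * (Cmod (A * q) * Cmod t)) * Cmod q ^ r))%R.
Proof.
intros hrho hu.
assert (ht : (0 < Cmod t)%R) by (now apply Cmod_gt_0).
assert (hmu : Cmod u = (rho * Cmod t)%R)
  by (rewrite hu, Cmod_mult, Cmod_R, Rabs_pos_eq; lra).
assert (hut : (Cmod u <= Cmod t)%R) by (rewrite hmu; nra).
set (X := qpoch_inf (A * q * q ^ S r * u) q).
assert (e : basis_fun (S r) u / t ^ S r - basis_fun r u / t ^ r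
  = / t ^ S r * nodal q u r * X * ((u - t) + q ^ r * (t * (A * q * u) - 1))).
{ unfold basis_fun.
  replace (qpoch_inf (A * q * q ^ r * u) q) with ((1 - A * q * q ^ r * u) * X).
  - fold X; simpl; field; split; auto; now apply Cpow_nz.
  - rewrite (qpoch_inf_S_l q q_lt1 q_neq0 (A * q * q ^ r * u)); unfold X; simpl.
    now replace (A * q * q ^ r * u * q) with (A * q * (q * q ^ r) * u) by ring. }
rewrite e, (Cmod_mult (/ t ^ S r * nodal q u r * X)), (Cmod_mult (/ t ^ S r * nodal q u r)),
  (Cmod_mult (/ t ^ S r)), Cmod_inv, Cmod_pow by (now apply Cpow_nz).
assert (hX : (Cmod X <= eb q (Cmod (A * q) * Cmod t))%R).
{ eapply Rle_trans; [now apply qpoch_inf_le|]; apply eb_mono; auto.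
  rewrite Cmod_mult, (Cmod_mult (A * q)).
  apply Rmult_le_compat; auto using Cmod_ge_0.
  - apply Rmult_le_pos; apply Cmod_ge_0.
  - rewrite <- (Rmult_1_r (Cmod (A * q))) at 2.
    apply Rmult_le_compat_l; [apply Cmod_ge_0 | now apply Cmod_qpow_le1]. }
assert (hn : (Cmod (nodal q u r) <= (rho ^ r * Cmod t ^ r) * eb q (2 / Cmod t))%R).
{ rewrite <- Rpow_mult_distr, <- hmu.
  eapply Rle_trans; [apply nodal_le with (rho := Cmod u); auto; [nra | lra]|].
  apply Rmult_le_compat_l; [apply pow_le, Cmod_ge_0|].
  apply eb_mono; auto; rewrite hmu.
  replace (2 / Cmod t)%R with (/ (/ 2 * Cmod t))%R by (field; lra).
  apply Rinv_le_contravar; nra. }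
assert (hb : (Cmod ((u - t) + q ^ r * (t * (A * q * u) - 1))
  <= (1 - rho) * Cmod t + Cmod q ^ r * (1 + Cmod t * (Cmod (A * q) * Cmod t)))%R).
{ eapply Rle_trans; [apply Cmod_triangle|]; apply Rplus_le_compat.
  - right; rewrite hu; replace (RtoC rho * t - t) with (RtoC (- (1 - rho)) * t)
      by (rewrite RtoC_opp, RtoC_minus; ring).
    rewrite Cmod_mult, Cmod_R, Rabs_Ropp, Rabs_pos_eq; lra.
  - rewrite Cmod_mult, Cmod_pow; apply Rmult_le_compat_l; [apply pow_le, Cmod_ge_0|].
    replace (t * (A * q * u) - 1) with (- (1 - t * (A * q * u))) by ring.
    rewrite Cmod_opp; eapply Rle_trans; [apply Cmod_1minus_le|].
    apply Rplus_le_compat_l; rewrite Cmod_mult; apply Rmult_le_compat_l; [lra|].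
    rewrite (Cmod_mult (A * q)); apply Rmult_le_compat_l; auto using Cmod_ge_0. }
assert (hr0 : (0 <= rho ^ r <= 1)%R).
{ split; [apply pow_le; lra|]; rewrite <- (pow1 r); apply pow_incr; lra. }
set (E1 := eb q (2 / Cmod t)) in *; set (E2 := eb q (Cmod (A * q) * Cmod t)) in *.
assert (hE1 : (0 <= E1)%R) by apply Rlt_le, eb_pos.
assert (hE2 : (0 <= E2)%R) by apply Rlt_le, eb_pos.
set (Q := (Cmod q ^ r)%R) in *.
assert (hQ : (0 <= Q)%R) by (apply pow_le, Cmod_ge_0).
set (Z := (1 + Cmod t * (Cmod (A * q) * Cmod t))%R) in *.
assert (hZ : (0 <= Z)%R).
{ unfold Z; assert (h := Rmult_le_pos _ _ (Rlt_le _ _ ht)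
    (Rmult_le_pos _ _ (Cmod_ge_0 (A * q)) (Rlt_le _ _ ht))); lra. }
assert (htr : (0 < Cmod t ^ S r)%R) by (now apply pow_lt).
apply Rle_trans with (/ Cmod t ^ S r * (rho ^ r * Cmod t ^ r * E1) * E2
  * ((1 - rho) * Cmod t + Q * Z))%R.
{ apply Rmult_le_compat; auto using Cmod_ge_0.
  - repeat apply Rmult_le_pos; auto using Cmod_ge_0; now apply Rlt_le, Rinv_0_lt_compat.
  - apply Rmult_le_compat; auto using Cmod_ge_0.
    + apply Rmult_le_pos; auto using Cmod_ge_0; now apply Rlt_le, Rinv_0_lt_compat.
    + apply Rmult_le_compat_l; auto; now apply Rlt_le, Rinv_0_lt_compat. }
replace (/ Cmod t ^ S r * (rho ^ r * Cmod t ^ r * E1) * E2 * ((1 - rho) * Cmod t + Q * Z))%R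
  with (E1 * E2 / Cmod t * (Cmod t * ((1 - rho) * rho ^ r) + rho ^ r * (Z * Q)))%R
  by (simpl; field; split; [apply pow_nonzero; lra | lra]).
apply Rmult_le_compat_l.
- apply Rmult_le_pos; [now apply Rmult_le_pos | now apply Rlt_le, Rinv_0_lt_compat].
- apply Rplus_le_compat_l.
  rewrite <- (Rmult_1_l (Z * Q)) at 2; apply Rmult_le_compat_r; [now apply Rmult_le_pos | lra].
Qed.

Lemma expansion_boundary :
  cs (fun r => den_fun t * (bailey_coef q A f r * basis_fun r t))
     (qpoch_inf (A * q) q * num_fun t).
Proof.
assert (ht : (0 < Cmod t)%R) by (now apply Cmod_gt_0).
assert (hua : forall n, (Cmod (approach n) <= Cmod t)%R).
{ intros n; rewrite Cmod_approach; assert (h := approach_ratio n); nra. }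
destruct (l1_den_mul (Cmod t) _ _ ht (l1_const _ 1)) as [MD HD].
destruct (l1_num (Cmod t) ht) as [MG HG].
set (B0 := (eb q (Cmod (A * q) * Cmod t) * eb q (/ Cmod t))%R).
set (E := (eb q (2 / Cmod t) * eb q (Cmod (A * q) * Cmod t) / Cmod t)%R).
set (Z := (1 + Cmod t * (Cmod (A * q) * Cmod t))%R).
assert (hE : (0 <= E)%R).
{ apply Rmult_le_pos; [|now apply Rlt_le, Rinv_0_lt_compat].
  apply Rmult_le_pos; apply Rlt_le, eb_pos. }
assert (hZ : (0 <= Z)%R).
{ unfold Z; assert (h := Rmult_le_pos _ _ (Rlt_le _ _ ht)
    (Rmult_le_pos _ _ (Cmod_ge_0 (A * q)) (Rlt_le _ _ ht))); lra. }
assert (hMD : forall n, (Cmod (den_fun (approach n)) <= MD)%R).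
{ intros n; assert (h := l1_bound _ _ _ _ HD (hua n)); cbv beta in h.
  now rewrite Cmult_1_r in h. }
assert (hMD0 : (0 <= MD)%R) by (eapply Rle_trans; [apply Cmod_ge_0 | apply (hMD O)]).
apply cs_ext with (fun r => bailey_coef q A f r * t ^ r
  * (den_fun t * (basis_fun r t / t ^ r)));
  [intros r; field; now apply Cpow_nz|].
apply abel_limit with (l := l)
  (N := fun n => qpoch_inf (A * q) q * num_fun (approach n))
  (b := fun n r => den_fun (approach n) * (basis_fun r (approach n) / t ^ r))
  (B := (MD * B0)%R) (V := (MD * (E * (Cmod t + Z * / (1 - Cmod q))))%R).
- exact sum_l.
- intros n r; rewrite Cmod_mult; apply Rmult_le_compat; auto using Cmod_ge_0.
  rewrite Cmod_div, Cmod_pow by (now apply Cpow_nz).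
  assert (h := basis_term_le r _ _ ht (hua n)); fold B0 in h.
  assert (h0 : (0 < Cmod t ^ r)%R) by (now apply pow_lt).
  apply Rmult_le_reg_l with (Cmod t ^ r)%R; auto.
  replace (Cmod t ^ r * (Cmod (basis_fun r (approach n)) / Cmod t ^ r))%R
    with (Cmod (basis_fun r (approach n))) by (field; lra); exact h.
- intros n K; assert (hrho := approach_ratio n).
  set (rho := (1 - / (INR n + 2))%R) in *.
  eapply Rle_trans.
  + apply rsum_le with (b := fun r =>
      (MD * (E * (Cmod t * ((1 - rho) * rho ^ r) + Z * Cmod q ^ r)))%R).
    intros r.
    replace (den_fun (approach n) * (basis_fun (S r) (approach n) / t ^ S r)
      - den_fun (approach n) * (basis_fun r (approach n) / t ^ r))
      with (den_fun (approach n) * (basis_fun (S r) (approach n) / t ^ S r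
        - basis_fun r (approach n) / t ^ r)) by ring.
    rewrite Cmod_mult; apply Rmult_le_compat; auto using Cmod_ge_0.
    apply basis_variation; [exact hrho | reflexivity].
  + rewrite rsum_scal; apply Rmult_le_compat_l; auto.
    rewrite rsum_scal; apply Rmult_le_compat_l; auto.
    rewrite rsum_plus, !rsum_scal; apply Rplus_le_compat.
    * rewrite <- (Rmult_1_r (Cmod t)) at 2; apply Rmult_le_compat_l; [lra|].
      apply Rle_trans with ((1 - rho) * / (1 - rho))%R; [|right; field; lra].
      apply Rmult_le_compat_l; [lra | apply rsum_geom; lra].
    * apply Rmult_le_compat_l; auto; apply rsum_geom.
      assert (h := mq_bounds q q_lt1 q_neq0); lra.
- intros r; apply cv_mult.
  + assert (h := l1_cont _ _ _ _ _ HD hua cv_approach); cbv beta in h.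
    rewrite Cmult_1_r in h; apply cv_ext with (2 := h); intros n; ring.
  + unfold Cdiv; apply cv_mult; [|apply cv_const].
    exact (l1_cont _ _ _ _ _ (l1_basis _ r ht) hua cv_approach).
- intros n; destruct (expansion_inside (approach n)) as [N [h1 h2]].
  + rewrite Cmod_approach; assert (h := approach_ratio n); nra.
  + rewrite <- h2; apply cs_ext with (fun r => den_fun (approach n)
      * (bailey_coef q A f r * basis_fun r (approach n)));
      [intros r; field; now apply Cpow_nz | now apply cs_scal].
- apply cv_scal, (l1_cont _ _ _ _ _ HG hua cv_approach).
Qed.

Lemma expansion (k : nat) : den_fun (t * q ^ k) <> 0 ->
  cs (fun r => bailey_coef q A f r * basis_fun r (t * q ^ k))
     (qpoch_inf (A * q) q * num_fun (t * q ^ k) / den_fun (t * q ^ k)).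
Proof.
intros hd; destruct k as [|k].
- replace (t * q ^ 0) with t in * by (simpl; ring).
  apply cs_ext with (fun r => / den_fun t * (den_fun t * (bailey_coef q A f r * basis_fun r t)));
    [intros r; field; auto|].
  unfold Cdiv; rewrite Cmult_comm; apply cs_scal, expansion_boundary.
- destruct (expansion_inside (t * q ^ S k)) as [N [h1 h2]].
  + rewrite Cmod_mult, Cmod_pow.
    assert (ht : (0 < Cmod t)%R) by (now apply Cmod_gt_0).
    assert (hq := mq_bounds q q_lt1 q_neq0).
    assert (h := mqpow_le q q_lt1 q_neq0 1 (S k) ltac:(lia)); rewrite pow_1 in h.
    rewrite <- (Rmult_1_r (Cmod t)) at 2; apply Rmult_lt_compat_l; lra.
  + rewrite <- h2; replace (den_fun (t * q ^ S k) * N / den_fun (t * q ^ S k)) with N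
      by (field; auto); exact h1.
Qed.

End Expansion.

(** * Interchange of summations *)

Section Core.

Variables q A t : C.
Hypothesis q_lt1 : (Cmod q < 1)%R.
Hypothesis q_neq0 : q <> 0.
Hypothesis t_neq0 : t <> 0.
Hypothesis t_inf : qpoch_inf t q <> 0.
Hypothesis tinv_inf : qpoch_inf (/ t) q <> 0.
Hypothesis A_neq1 : 1 - A <> 0.

Let a := A * q.
Let tau := (Cmod t * Cmod q)%R.

Lemma tau_pos : (0 < tau)%R.
Proof. apply Rmult_lt_0_compat; now apply Cmod_gt_0. Qed.

Lemma poly_kernel1_le : exists K : R, (0 <= K)%R /\ forall r k,
  (Cmod (q ^ k * weight1 q t k * poly_kernel1 q t a r k) <= tau ^ r * (K * Cmod q ^ k))%R.
Proof.
destruct (weight1_le q t q_lt1 q_neq0 t_neq0 t_inf tinv_inf) as [M hM].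
assert (hM0 : (0 <= M)%R) by (eapply Rle_trans; [apply Cmod_ge_0 | apply (hM O)]).
assert (hp : forall x, (0 <= eb q x)%R) by (intros x; apply Rlt_le, eb_pos).
assert (ha := Cmod_ge_0 (a * t ^ 2)).
exists (M * ((1 + Cmod (a * t ^ 2)) * eb q (Cmod (a * q * t)) * (eb q (2 / tau) * eb q (Cmod a))))%R.
split; [repeat apply Rmult_le_pos; auto; lra|].
intros r k; unfold poly_kernel1.
rewrite (Cmod_mult (q ^ k * weight1 q t k)), (Cmod_mult (q ^ k)), Cmod_pow.
rewrite (Cmod_mult ((1 - a * t ^ 2) * _)), (Cmod_mult (1 - a * t ^ 2)), (Cmod_mult (nodal _ _ _)).
match goal with |- (_ <= ?x)%R => replace x with
  (Cmod q ^ k * M * ((1 + Cmod (a * t ^ 2)) * eb q (Cmod (a * q * t))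
    * ((tau ^ r * eb q (2 / tau)) * eb q (Cmod a))))%R by ring end.
assert (h1 : (Cmod (qpoch_inf (a * q * t * q ^ k) q) <= eb q (Cmod (a * q * t)))%R).
{ eapply Rle_trans; [now apply qpoch_inf_le|]; apply eb_mono; auto.
  rewrite (Cmod_mult (a * q * t)); rewrite <- (Rmult_1_r (Cmod (a * q * t))) at 2.
  apply Rmult_le_compat_l; [apply Cmod_ge_0 | now apply Cmod_qpow_le1]. }
assert (h2 : (Cmod (qpoch (a * q ^ (r + k)) q (k - r)) <= eb q (Cmod a))%R).
{ eapply Rle_trans; [now apply qpoch_le|]; apply eb_mono; auto.
  rewrite Cmod_mult; rewrite <- (Rmult_1_r (Cmod a)) at 2.
  apply Rmult_le_compat_l; [apply Cmod_ge_0 | now apply Cmod_qpow_le1]. }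
assert (h3 := nodal_qpow_le q q_lt1 q_neq0 k r tau tau_pos).
repeat apply Rmult_le_compat; auto using Cmod_ge_0, Rle_refl, Cmod_1minus_le;
  repeat (apply Rmult_le_pos || apply Cmod_ge_0 || apply pow_le).
Qed.

Lemma poly_ratio_le (k : nat) :
  (Cmod (poly_ratio q t a k) <= (1 + Cmod (a * t ^ 2)) * eb q (Cmod (a * q * t ^ 2)))%R.
Proof.
assert (ha := Cmod_ge_0 (a * t ^ 2)).
assert (hb := eb_ge1 q q_lt1 q_neq0 _ (Cmod_ge_0 (a * q * t ^ 2))).
destruct k as [|k]; unfold poly_ratio.
- rewrite Cmod_1; rewrite <- (Rmult_1_r 1) at 1; apply Rmult_le_compat; lra.
- rewrite (Cmod_mult (1 - a * t ^ 2)).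
  apply Rmult_le_compat; auto using Cmod_ge_0, Cmod_1minus_le.
  eapply Rle_trans; [now apply qpoch_le|]; apply eb_mono; auto.
  rewrite (Cmod_mult (a * q * t ^ 2)); rewrite <- (Rmult_1_r (Cmod (a * q * t ^ 2))) at 2.
  apply Rmult_le_compat_l; [apply Cmod_ge_0 | now apply Cmod_qpow_le1].
Qed.

Lemma poly_kernel2_le : exists K : R, (0 <= K)%R /\ forall r k,
  (Cmod (q ^ S k * weight2 q t (S k) * poly_kernel2 q t a r (S k))
   <= tau ^ r * (K * Cmod q ^ k))%R.
Proof.
destruct (weight2_le q t q_lt1 q_neq0 t_inf tinv_inf) as [M hM].
assert (hM0 : (0 <= M)%R) by (eapply Rle_trans; [apply Cmod_ge_0 | apply (hM O)]).
assert (hp : forall x, (0 <= eb q x)%R) by (intros x; apply Rlt_le, eb_pos).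
assert (ha := Cmod_ge_0 (a * t ^ 2)).
exists (M * ((eb q (Cmod (A * q) * tau) * eb q (/ tau))
  * ((1 + Cmod (a * t ^ 2)) * eb q (Cmod (a * q * t ^ 2)))))%R.
split; [repeat apply Rmult_le_pos; auto; lra|].
intros r k; unfold poly_kernel2; fold (basis_fun q A r (t * q ^ S k)).
rewrite (Cmod_mult (q ^ S k * weight2 q t (S k))), (Cmod_mult (q ^ S k)), Cmod_pow.
rewrite Cmod_mult.
match goal with |- (_ <= ?x)%R => replace x with
  (Cmod q ^ k * M * ((tau ^ r * (eb q (Cmod (A * q) * tau) * eb q (/ tau)))
    * ((1 + Cmod (a * t ^ 2)) * eb q (Cmod (a * q * t ^ 2)))))%R by ring end.
assert (h1 : (Cmod (basis_fun q A r (t * q ^ S k))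
  <= tau ^ r * (eb q (Cmod (A * q) * tau) * eb q (/ tau)))%R).
{ apply basis_term_le; auto using tau_pos.
  rewrite Cmod_mult, Cmod_pow; apply Rmult_le_compat_l; [apply Cmod_ge_0|].
  rewrite <- (pow_1 (Cmod q)) at 2; apply mqpow_le; auto; lia. }
assert (h2 := poly_ratio_le (S k)).
assert (h3 := mqpow_le q q_lt1 q_neq0 k (S k) ltac:(lia)).
repeat apply Rmult_le_compat; auto using Cmod_ge_0, Rle_refl;
  repeat (apply Rmult_le_pos || apply Cmod_ge_0 || apply pow_le).
Qed.

Lemma interchange (al : nat -> C) (Ma K : R) (u : nat -> nat -> C) :
  (0 <= Ma)%R -> (0 <= K)%R ->
  (forall r, Cmod (al r) * Cmod t ^ r <= Ma)%R ->
  (forall r k, Cmod (u r k) <= tau ^ r * (K * Cmod q ^ k))%R ->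
  exists s, cs (fun k => Cseries (fun r => al r * u r k)) s
    /\ cs (fun r => al r * Cseries (u r)) s.
Proof.
intros hMa hK hal hu.
assert (hq := mq_bounds q q_lt1 q_neq0).
destruct (fubini (fun k r => al r * u r k)
  (fun k => Ma * K * / (1 - Cmod q) * Cmod q ^ k)%R) as [s [s1 s2]].
- intros k J.
  apply Rle_trans with (rsum (fun r => Ma * K * Cmod q ^ k * Cmod q ^ r)%R J).
  + apply rsum_le; intros r; rewrite Cmod_mult.
    eapply Rle_trans; [apply Rmult_le_compat_l; [apply Cmod_ge_0 | apply hu]|].
    unfold tau; rewrite Rpow_mult_distr.
    replace (Cmod (al r) * (Cmod t ^ r * Cmod q ^ r * (K * Cmod q ^ k)))%R
      with (Cmod (al r) * Cmod t ^ r * (K * Cmod q ^ k * Cmod q ^ r))%R by ring.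
    replace (Ma * K * Cmod q ^ k * Cmod q ^ r)%R with (Ma * (K * Cmod q ^ k * Cmod q ^ r))%R by ring.
    apply Rmult_le_compat_r; [|apply hal].
    repeat apply Rmult_le_pos; auto; apply pow_le; lra.
  + rewrite rsum_scal.
    replace (Ma * K * / (1 - Cmod q) * Cmod q ^ k)%R
      with (Ma * K * Cmod q ^ k * / (1 - Cmod q))%R by ring.
    apply Rmult_le_compat_l; [|apply rsum_geom; lra].
    repeat apply Rmult_le_pos; auto; apply pow_le; lra.
- now apply ex_series_qpow.
- exists s; split; [exact s1|].
  apply cs_ext with (2 := s2); intros r; apply cs_Cseries, cs_scal.
  apply cs_dominated with (1 := hu r).
  apply ex_series_Rscal; now apply ex_series_qpow.
Qed.

Variables (x1 x2 b1 b2 b3 c : C) (f : nat -> C) (l : C).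
Hypothesis f_eq : forall k, den_fun q x1 x2 (q ^ k) * f k = num_fun q b1 b2 b3 c (q ^ k).
Hypothesis sum_l : cs (fun r => bailey_coef q A f r * t ^ r) l.
Hypothesis den_neq0 : forall k, den_fun q x1 x2 (t * q ^ k) <> 0.

Theorem bailey_coef_generating_function : exists s1 s2 : C,
  cs (fun k => q ^ k * weight1 q t k
        * ((1 - a * t ^ 2) * qpoch_inf (a * q * t * q ^ k) q)
        * (qpoch a q (k + k) * f k)) s1 /\
  cs (fun k => q ^ k * weight2 q t k * poly_ratio q t a k
        * (qpoch_inf a q * num_fun q b1 b2 b3 c (t * q ^ k) / den_fun q x1 x2 (t * q ^ k))) s2 /\
  l = s1 + s2.
Proof.
destruct (coef_le q A t f l sum_l) as [Ma [hMa hal]].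
destruct poly_kernel1_le as [K1 [hK1 hu1]], poly_kernel2_le as [K2 [hK2 hu2]].
set (al := bailey_coef q A f) in *.
destruct (interchange al Ma K1 _ hMa hK1 hal hu1) as [s1 [p1 r1]].
destruct (interchange al Ma K2 (fun r k =>
  q ^ S k * weight2 q t (S k) * poly_kernel2 q t a r (S k)) hMa hK2 hal hu2) as [s2 [p2 r2]].
cbv beta in p1, p2, r1, r2.
assert (hexp := fun k => expansion q A t q_lt1 q_neq0 t_neq0 A_neq1 x1 x2 b1 b2 b3 c f f_eq l
  sum_l k (den_neq0 k)).
fold al in hexp.
assert (hexp' : forall k, cs (fun r => al r * (q ^ k * weight2 q t k * poly_kernel2 q t a r k))
  (q ^ k * weight2 q t k * poly_ratio q t a k
   * (qpoch_inf a q * num_fun q b1 b2 b3 c (t * q ^ k) / den_fun q x1 x2 (t * q ^ k)))).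
{ intros k; apply cs_ext with (fun r => q ^ k * weight2 q t k * poly_ratio q t a k
    * (al r * basis_fun q A r (t * q ^ k))).
  - intros r; unfold poly_kernel2, basis_fun; fold a; ring.
  - apply cs_scal, hexp. }
assert (hdom : forall r, cs (fun k => q ^ S k * weight2 q t (S k) * poly_kernel2 q t a r (S k))
  (Cseries (fun k => q ^ S k * weight2 q t (S k) * poly_kernel2 q t a r (S k)))).
{ intros r; apply cs_dominated with (1 := hu2 r).
  apply ex_series_Rscal; now apply ex_series_qpow. }
assert (hval : forall r, t ^ r =
  Cseries (fun k => q ^ k * weight1 q t k * poly_kernel1 q t a r k)
  + (q ^ 0 * weight2 q t 0 * poly_kernel2 q t a r 0
     + Cseries (fun k => q ^ S k * weight2 q t (S k) * poly_kernel2 q t a r (S k)))).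
{ intros r.
  rewrite <- (poly_kernel_sum_value q t q_lt1 q_neq0 t_neq0 t_inf tinv_inf a r).
  unfold poly_kernel_sum; f_equal; apply cs_Cseries.
  apply (cs_S (fun k => q ^ k * weight2 q t k * poly_kernel2 q t a r k)); apply hdom. }
set (y0 := q ^ 0 * weight2 q t 0 * poly_ratio q t a 0
   * (qpoch_inf a q * num_fun q b1 b2 b3 c (t * q ^ 0) / den_fun q x1 x2 (t * q ^ 0))).
exists s1, (y0 + s2); split; [|split].
- apply cs_ext with (2 := p1); intros k; apply cs_Cseries.
  apply cs_ext with (fun r => q ^ k * weight1 q t k
      * ((1 - a * t ^ 2) * qpoch_inf (a * q * t * q ^ k) q)
    * (al r * (nodal q (q ^ k) r * qpoch (A * q * q ^ (r + k)) q (k - r)))).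
  + intros r; unfold poly_kernel1; fold a; ring.
  + apply cs_scal; unfold a at 1.
    rewrite <- (bailey_inversion q A q_lt1 q_neq0 A_neq1 f k); fold al.
    apply cs_finite; intros r hr; rewrite nodal_qpow_lt by lia; ring.
- apply (cs_S (fun k => q ^ k * weight2 q t k * poly_ratio q t a k
   * (qpoch_inf a q * num_fun q b1 b2 b3 c (t * q ^ k) / den_fun q x1 x2 (t * q ^ k)))).
  apply cs_ext with (2 := p2); intros k; apply cs_Cseries, (hexp' (S k)).
- apply cs_unique with (1 := sum_l); fold al.
  apply cs_ext with (fun r =>
    al r * Cseries (fun k => q ^ k * weight1 q t k * poly_kernel1 q t a r k)
    + (al r * (q ^ 0 * weight2 q t 0 * poly_kernel2 q t a r 0)
       + al r * Cseries (fun k => q ^ S k * weight2 q t (S k) * poly_kernel2 q t a r (S k)))).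
  + intros r; rewrite (hval r); ring.
  + apply cs_plus; [exact r1|]; apply cs_plus; [apply (hexp' 0%nat) | exact r2].
Qed.

End Core.

(** * Specialization to continuous q-Jacobi polynomials *)

Lemma Cexp_plus (x y : C) : Cexp (x + y) = Cexp x * Cexp y.
Proof.
unfold Cexp; destruct x as [x1 x2], y as [y1 y2]; simpl.
rewrite exp_plus, cos_plus, sin_plus; unfold Cmult; simpl; f_equal; ring.
Qed.

Lemma cpower_plus (logq x y : C) : cpower logq (x + y) = cpower logq x * cpower logq y.
Proof. unfold cpower; rewrite <- Cexp_plus; f_equal; ring. Qed.

Lemma cpower_mult_INR (logq x : C) (n : nat) : cpower logq (x * INR n) = cpower logq x ^ n.
Proof.
induction n as [|n IH].
- simpl; unfold cpower; replace (x * 0 * logq) with (RtoC 0) by ring.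
  unfold Cexp; simpl; rewrite exp_0, cos_0, sin_0.
  unfold RtoC; f_equal; ring.
- rewrite S_INR, RtoC_plus.
  replace (x * (INR n + 1)) with (x + x * INR n) by ring.
  rewrite cpower_plus, IH; reflexivity.
Qed.

Lemma cpower_neq0 (logq x : C) : cpower logq x <> 0.
Proof.
assert (h : cpower logq 0 = 1).
{ replace (RtoC 0) with (0 * INR 0) by ring; apply (cpower_mult_INR logq 0 0). }
intros e; apply C1_neq_0; rewrite <- h.
replace (RtoC 0) with (x + - x) at 1 by ring; rewrite cpower_plus, e; ring.
Qed.

Lemma qpoch_double (q a x y : C) (k : nat) : x * x = a -> y * y = a * q ->
  qpoch a q (k + k) = qpoch x q k * qpoch (- x) q k * (qpoch y q k * qpoch (- y) q k).
Proof.
intros hx hy; induction k as [|k IH]; [simpl; ring|].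
replace (S k + S k)%nat with (S (S (k + k))) by lia.
simpl; rewrite IH, Cpow_add_r.
replace (a * (q * (q ^ k * q ^ k))) with (a * q * (q ^ k * q ^ k)) by ring.
rewrite <- hy, <- hx; ring.
Qed.

Lemma qpoch_ratio (q x : C) (n : nat) : (1 - x) * qpoch (x * q) q n = qpoch x q n * (1 - x * q ^ n).
Proof. rewrite <- qpoch_S_l; reflexivity. Qed.

Lemma cs_scal_Cseries (c : C) (u : nat -> C) (s : C) :
  cs (fun k => c * u k) s -> c * Cseries u = s.
Proof.
intros h; destruct (Ceq_dec c 0) as [-> | hc].
- rewrite Cmult_0_l; apply cs_unique with (2 := h).
  apply cs_ext with (fun _ => 0); [intros; ring|].
  exact (cs_finite (fun _ => 0) 0 (fun _ _ => eq_refl)).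
- apply (cs_scal (/ c)) in h.
  rewrite (cs_Cseries u (/ c * s)); [field; auto|].
  apply cs_ext with (2 := h); intros k; field; auto.
Qed.

Lemma qpoch_diverges (a q : C) : (1 < Cmod q)%R -> a <> 0 -> ~ qpochs_inf_admissible [a] q.
Proof.
intros hq ha h.
destruct (h a (or_introl eq_refl)) as [p [hp hp0]].
apply cv_Cis_lim in hp.
assert (h1 : cv (fun n => qpoch a q (S n) - qpoch a q n) (p - p))
  by (apply cv_minus; [now apply cv_S | exact hp]).
assert (h2 := cv_Cmod _ _ h1); assert (h3 := cv_Cmod _ _ hp).
replace (p - p) with (RtoC 0) in h2 by ring; rewrite Cmod_0 in h2.
assert (h4 : is_lim_seq (fun n => Cmod a * Cmod (qpoch a q n))%R (Cmod a * Cmod p)%R)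
  by (apply is_lim_seq_mult'; [apply is_lim_seq_const | exact h3]).
assert (h5 : (Cmod a * Cmod p <= 0)%R).
{ refine (is_lim_seq_le _ _ (Finite _) (Finite _) _ h4 h2); intros n; simpl qpoch.
  replace (qpoch a q n * (1 - a * q ^ n) - qpoch a q n)
    with (- (a * q ^ n * qpoch a q n)) by ring.
  rewrite Cmod_opp, !Cmod_mult, Cmod_pow; apply Rmult_le_compat_r; [apply Cmod_ge_0|].
  rewrite <- (Rmult_1_r (Cmod a)) at 1; apply Rmult_le_compat_l; [apply Cmod_ge_0|].
  apply pow_R1_Rle; lra. }
apply Cmod_gt_0 in ha; apply Cmod_gt_0 in hp0; nra.
Qed.

Section Specialization.

Variables q A t s B b x1 x2 : C.
Hypothesis q_lt1 : (Cmod q < 1)%R.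
Hypothesis q_neq0 : q <> 0.
Hypothesis t_neq0 : t <> 0.
Hypothesis t_inf : qpoch_inf t q <> 0.
Hypothesis tinv_inf : qpoch_inf (/ t) q <> 0.
Hypothesis s_sqr : s * s = A.
Hypothesis B_sqr : B * B = A * q.
Hypothesis s_adm : forall n, qpoch s q n <> 0.
Hypothesis b_inf : qpoch_inf b q <> 0.
Hypothesis ms_inf : qpoch_inf (- s) q <> 0.
Hypothesis mB_inf : qpoch_inf (- B) q <> 0.
Hypothesis A1_adm : forall n, qpoch (A * q * q * t) q n <> 0.
Hypothesis A2_inf : qpoch_inf (A * q * q * t ^ 2) q <> 0.
Hypothesis mst_adm : forall n, qpoch (- s * t) q n <> 0.
Hypothesis bt_adm : forall n, qpoch (b * t) q n <> 0.
Hypothesis x1t_inf : qpoch_inf (x1 * t) q <> 0.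
Hypothesis x2t_inf : qpoch_inf (x2 * t) q <> 0.

Definition ratio (k : nat) : C :=
  qpoch x1 q k * qpoch x2 q k / (qpoch b q k * qpoch (- s) q k * qpoch (- B) q k).

Definition ratio_const : C :=
  qpoch_inf x1 q * qpoch_inf x2 q / (qpoch_inf b q * qpoch_inf (- s) q * qpoch_inf (- B) q).

Lemma one_sub_A_neq0 : 1 - A <> 0.
Proof.
intros e; assert (h1 := s_adm 1); assert (h2 := qpoch_neq0 q q_lt1 q_neq0 _ 1 ms_inf).
simpl in h1, h2; apply (Cmult_neq_0 _ _ h1 h2); rewrite <- s_sqr in e.
replace (1 * (1 - s * 1) * (1 * (1 - - s * 1))) with (1 - s * s) by ring; exact e.
Qed.

Lemma ratio_eq (k : nat) :
  den_fun q x1 x2 (q ^ k) * ratio k = num_fun q b (- s) (- B) ratio_const (q ^ k).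
Proof.
assert (h1 := qpoch_neq0 q q_lt1 q_neq0 _ k b_inf).
assert (h2 := qpoch_neq0 q q_lt1 q_neq0 _ k ms_inf).
assert (h3 := qpoch_neq0 q q_lt1 q_neq0 _ k mB_inf).
assert (e1 := qpoch_inf_split q q_lt1 q_neq0 b k).
assert (e2 := qpoch_inf_split q q_lt1 q_neq0 (- s) k).
assert (e3 := qpoch_inf_split q q_lt1 q_neq0 (- B) k).
assert (g1 : qpoch_inf (b * q ^ k) q <> 0) by (intros e; apply b_inf; rewrite e1, e; ring).
assert (g2 : qpoch_inf (- s * q ^ k) q <> 0) by (intros e; apply ms_inf; rewrite e2, e; ring).
assert (g3 : qpoch_inf (- B * q ^ k) q <> 0) by (intros e; apply mB_inf; rewrite e3, e; ring).
unfold den_fun, num_fun, ratio, ratio_const.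
rewrite (qpoch_inf_split q q_lt1 q_neq0 x1 k), (qpoch_inf_split q q_lt1 q_neq0 x2 k), e1, e2, e3.
field; repeat split; auto.
Qed.

Lemma den_split (k : nat) :
  qpoch_inf (x1 * t) q * qpoch_inf (x2 * t) q
  = qpoch (x1 * t) q k * qpoch (x2 * t) q k * den_fun q x1 x2 (t * q ^ k).
Proof.
rewrite (qpoch_inf_split q q_lt1 q_neq0 (x1 * t) k), (qpoch_inf_split q q_lt1 q_neq0 (x2 * t) k).
unfold den_fun; replace (x1 * (t * q ^ k)) with (x1 * t * q ^ k) by ring.
replace (x2 * (t * q ^ k)) with (x2 * t * q ^ k) by ring; ring.
Qed.

Lemma den_lattice_neq0 (k : nat) : den_fun q x1 x2 (t * q ^ k) <> 0.
Proof.
intros e; apply (Cmult_neq_0 _ _ x1t_inf x2t_inf).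
rewrite (den_split k), e; ring.
Qed.

Lemma poly_ratio_mul (k : nat) :
  poly_ratio q t (A * q) k * qpoch (A * q * q * t ^ 2) q k = qpoch (A * q * t ^ 2) q (k + k).
Proof.
destruct k as [|k]; [simpl; ring|].
change (S k + S k)%nat with (S (k + S k)); rewrite (qpoch_S_l q (A * q * t ^ 2)), (Nat.add_comm k (S k)), qpoch_add.
unfold poly_ratio.
replace (A * q * q * t ^ 2 * q ^ S k) with (A * q * t ^ 2 * q * q ^ S k) by ring.
replace (A * q * q * t ^ 2) with (A * q * t ^ 2 * q) by ring; ring.
Qed.

Lemma first_term_eq (k : nat) :
  q ^ k * weight1 q t k * ((1 - A * q * t ^ 2) * qpoch_inf (A * q * q * t * q ^ k) q)
    * (qpoch (A * q) q (k + k) * ratio k)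
  = qpoch_inf (A * q * q * t) q * qpoch_inf (A * q * t ^ 2) q
    / (qpoch_inf t q * qpoch_inf (A * q * q * t ^ 2) q)
    * (qpoch B q k * qpoch (s * q) q k * qpoch (- (s * q)) q k * qpoch x1 q k * qpoch x2 q k
       / (qpoch q q k * qpoch b q k * qpoch (- s) q k * qpoch (A * q * q * t) q k
          * qpoch (q / t) q k) * q ^ k).
Proof.
assert (hq := qfact_neq0 q q_lt1 q_neq0 k).
assert (h1 := qpoch_neq0 q q_lt1 q_neq0 _ k b_inf).
assert (h2 := qpoch_neq0 q q_lt1 q_neq0 _ k ms_inf).
assert (h3 := qpoch_neq0 q q_lt1 q_neq0 _ k mB_inf).
assert (h4 := A1_adm k).
assert (h5 := qpoch_neq0 q q_lt1 q_neq0 _ k (qtinv_inf q t q_lt1 q_neq0 t_neq0 tinv_inf)).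
rewrite (qpoch_inf_split q q_lt1 q_neq0 (A * q * q * t) k).
rewrite (qpoch_inf_S_l q q_lt1 q_neq0 (A * q * t ^ 2)).
replace (A * q * t ^ 2 * q) with (A * q * q * t ^ 2) by ring.
rewrite (qpoch_double q (A * q) B (s * q) k B_sqr) by (rewrite <- s_sqr; ring).
unfold weight1, ratio.
revert A2_inf; generalize (qpoch_inf (A * q * q * t ^ 2) q); intros Z hZ.
replace (t ^ 2) with (t * t) by ring.
field; repeat split; auto.
Qed.

Lemma second_term_eq (k : nat) :
  q ^ k * weight2 q t k * poly_ratio q t (A * q) k
    * (qpoch_inf (A * q) q * num_fun q b (- s) (- B) ratio_const (t * q ^ k)
       / den_fun q x1 x2 (t * q ^ k))
  = qpoch_inf (A * q) q * qpoch_inf (- s * t) q * qpoch_inf (- B * t) q * qpoch_inf (b * t) q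
      * qpoch_inf x1 q * qpoch_inf x2 q
    / (qpoch_inf b q * qpoch_inf (- s) q * qpoch_inf (- B) q * qpoch_inf (/ t) q
       * qpoch_inf (x1 * t) q * qpoch_inf (x2 * t) q)
    * (qpoch (B * t) q k * qpoch (s * q * t) q k * qpoch (- (s * q) * t) q k
       * qpoch (x1 * t) q k * qpoch (x2 * t) q k
       / (qpoch q q k * qpoch (- s * t) q k * qpoch (q * t) q k * qpoch (b * t) q k
          * qpoch (A * q * q * t ^ 2) q k) * q ^ k).
Proof.
assert (hq := qfact_neq0 q q_lt1 q_neq0 k).
assert (h1 := mst_adm k); assert (h2 := bt_adm k).
assert (h3 := qpoch_neq0 q q_lt1 q_neq0 _ k (qt_inf q t q_lt1 q_neq0 t_inf)).
assert (h4 := qpoch_neq0 q q_lt1 q_neq0 _ k A2_inf).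
assert (hd := den_lattice_neq0 k).
assert (ed := den_split k).
assert (h5 := qpoch_neq0 q q_lt1 q_neq0 _ k x1t_inf).
assert (h6 := qpoch_neq0 q q_lt1 q_neq0 _ k x2t_inf).
assert (er : poly_ratio q t (A * q) k = qpoch (B * t) q k * qpoch (- (B * t)) q k
  * (qpoch (s * q * t) q k * qpoch (- (s * q * t)) q k) / qpoch (A * q * q * t ^ 2) q k).
{ rewrite <- (qpoch_double q (A * q * t ^ 2)).
  - rewrite <- poly_ratio_mul; field; exact h4.
  - rewrite <- B_sqr; ring.
  - rewrite <- s_sqr; ring. }
rewrite er.
replace (- (B * t)) with (- B * t) by ring.
replace (- (s * q * t)) with (- (s * q) * t) by ring.
rewrite (qpoch_inf_split q q_lt1 q_neq0 (- s * t) k), (qpoch_inf_split q q_lt1 q_neq0 (- B * t) k),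
  (qpoch_inf_split q q_lt1 q_neq0 (b * t) k).
unfold num_fun, ratio_const, weight2.
replace (b * (t * q ^ k)) with (b * t * q ^ k) by ring.
replace (- s * (t * q ^ k)) with (- s * t * q ^ k) by ring.
replace (- B * (t * q ^ k)) with (- B * t * q ^ k) by ring.
match goal with |- _ = ?n / ?d * ?r =>
  replace d with (qpoch_inf b q * qpoch_inf (- s) q * qpoch_inf (- B) q * qpoch_inf (/ t) q
    * (qpoch_inf (x1 * t) q * qpoch_inf (x2 * t) q)) by ring end.
rewrite ed.
revert hd h4; generalize (den_fun q x1 x2 (t * q ^ k)) (qpoch (A * q * q * t ^ 2) q k); intros D Z hd h4.
field; repeat split; auto.
Qed.

Theorem generating_function (l : C) :
  cs (fun r => bailey_coef q A ratio r * t ^ r) l ->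
  l = qpoch_inf (A * q * q * t) q * qpoch_inf (A * q * t ^ 2) q
      / (qpoch_inf t q * qpoch_inf (A * q * q * t ^ 2) q)
      * Cseries (fun k =>
         qpoch B q k * qpoch (s * q) q k * qpoch (- (s * q)) q k * qpoch x1 q k * qpoch x2 q k
         / (qpoch q q k * qpoch b q k * qpoch (- s) q k * qpoch (A * q * q * t) q k
            * qpoch (q / t) q k) * q ^ k)
    + qpoch_inf (A * q) q * qpoch_inf (- s * t) q * qpoch_inf (- B * t) q * qpoch_inf (b * t) q
        * qpoch_inf x1 q * qpoch_inf x2 q
      / (qpoch_inf b q * qpoch_inf (- s) q * qpoch_inf (- B) q * qpoch_inf (/ t) q
         * qpoch_inf (x1 * t) q * qpoch_inf (x2 * t) q)
      * Cseries (fun k => qpoch (B * t) q k * qpoch (s * q * t) q k * qpoch (- (s * q) * t) q k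
         * qpoch (x1 * t) q k * qpoch (x2 * t) q k
         / (qpoch q q k * qpoch (- s * t) q k * qpoch (q * t) q k * qpoch (b * t) q k
            * qpoch (A * q * q * t ^ 2) q k) * q ^ k).
Proof.
intros hl.
destruct (bailey_coef_generating_function q A t q_lt1 q_neq0 t_neq0 t_inf tinv_inf
  one_sub_A_neq0 x1 x2 b (- s) (- B) ratio_const ratio l ratio_eq hl den_lattice_neq0)
  as [s1 [s2 [h1 [h2 ->]]]].
f_equal; symmetry; apply cs_scal_Cseries.
- apply cs_ext with (2 := h1); exact first_term_eq.
- apply cs_ext with (2 := h2); exact second_term_eq.
Qed.

Lemma askey_wilson_coef (n : nat) :
  qpoch A q n * qpoch (s * q) q n * qpoch (- (s * q)) q n
    / (qpoch s q n * qpoch (- s) q n * qpoch q q n)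
  * psum (fun k => qpoch (/ q ^ n) q k * qpoch (A * q ^ n) q k * qpoch x1 q k * qpoch x2 q k
      / (qpoch q q k * qpoch b q k * qpoch (- s) q k * qpoch (- B) q k) * q ^ k) (S n)
  = bailey_coef q A ratio n.
Proof.
unfold bailey_coef; f_equal.
- assert (h1 := s_adm n); assert (h2 := qpoch_neq0 q q_lt1 q_neq0 _ n ms_inf).
  assert (hq := qfact_neq0 q q_lt1 q_neq0 n).
  assert (hA := one_sub_A_neq0).
  assert (e1 := qpoch_ratio q s n); assert (e2 := qpoch_ratio q (- s) n).
  replace (- s * q) with (- (s * q)) in e2 by ring.
  replace (q ^ (2 * n)) with (q ^ n * q ^ n) by (rewrite <- Cpow_add_r; f_equal; lia).
  transitivity (qpoch A q n * ((1 - s) * qpoch (s * q) q n) * ((1 - - s) * qpoch (- (s * q)) q n)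
    / (qpoch s q n * qpoch (- s) q n * qpoch q q n * (1 - A))).
  + rewrite <- s_sqr in hA |- *; field; repeat split; auto.
  + rewrite e1, e2; rewrite <- s_sqr in hA |- *; field; repeat split; auto.
- apply psum_ext; intros k _; unfold ratio.
  assert (hq := qfact_neq0 q q_lt1 q_neq0 k).
  assert (h1 := qpoch_neq0 q q_lt1 q_neq0 _ k b_inf).
  assert (h2 := qpoch_neq0 q q_lt1 q_neq0 _ k ms_inf).
  assert (h3 := qpoch_neq0 q q_lt1 q_neq0 _ k mB_inf).
  field; repeat split; auto.
Qed.

End Specialization.

Theorem theorem3p6 (q logq x z alpha beta t : C) :
  let Q := cpower logq in
  let summand := fun n : nat =>
    qpochs [Q (alpha + beta + 1); Q ((alpha + beta + 3) / 2);
            - Q ((alpha + beta + 3) / 2)] q n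
    / qpochs [Q (alpha + 1); Q ((alpha + beta + 1) / 2);
              - Q ((alpha + beta + 1) / 2)] q n
    * t ^ n * q_jacobi n alpha beta x q logq in
  q <> 0 -> Cmod q <> 1%R -> Cexp logq = q ->
  z <> 0 -> x = (z + / z) / 2 ->
  alpha <> 0 -> beta <> 0 -> t <> 0 ->
  (Cmod (Q (alpha + 1 / 2) * t)%C < 1)%R ->
  (* both sides are meaningful: no vanishing denominators, convergence *)
  qpochs_admissible
    [Q (alpha + 1); Q ((alpha + beta + 1) / 2); - Q ((alpha + beta + 1) / 2);
     - Q ((alpha + beta + 2) / 2);
     Q (alpha + beta + 3) * t; q / t;
     - Q ((alpha + beta + 1) / 2) * t; q * t; Q (alpha + 1) * t;
     Q (alpha + beta + 3) * t ^ 2] q ->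
  qpochs_inf_admissible
    [t; Q (alpha + beta + 3) * t ^ 2;
     Q (alpha + 1); - Q ((alpha + beta + 1) / 2); - Q ((alpha + beta + 2) / 2);
     1 / t; Q (alpha / 2 + 1 / 4) * t * z; Q (alpha / 2 + 1 / 4) * t * / z] q ->
  Cex_series summand ->
  Cseries summand =
    qpochs_inf [Q (alpha + beta + 3) * t; Q (alpha + beta + 2) * t ^ 2] q
    / qpochs_inf [t; Q (alpha + beta + 3) * t ^ 2] q
    * phi [Q ((alpha + beta + 2) / 2); Q ((alpha + beta + 3) / 2);
           - Q ((alpha + beta + 3) / 2);
           Q (alpha / 2 + 1 / 4) * z; Q (alpha / 2 + 1 / 4) * / z]
          [Q (alpha + 1); - Q ((alpha + beta + 1) / 2);
           Q (alpha + beta + 3) * t; q / t] q q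
    + qpochs_inf
        [Q (alpha + beta + 2); - Q ((alpha + beta + 1) / 2) * t;
         - Q ((alpha + beta + 2) / 2) * t; Q (alpha + 1) * t;
         Q (alpha / 2 + 1 / 4) * z; Q (alpha / 2 + 1 / 4) * / z] q
      / qpochs_inf
        [Q (alpha + 1); - Q ((alpha + beta + 1) / 2);
         - Q ((alpha + beta + 2) / 2); 1 / t;
         Q (alpha / 2 + 1 / 4) * t * z; Q (alpha / 2 + 1 / 4) * t * / z] q
      * phi [Q ((alpha + beta + 2) / 2) * t; Q ((alpha + beta + 3) / 2) * t;
             - Q ((alpha + beta + 3) / 2) * t;
             Q (alpha / 2 + 1 / 4) * t * z; Q (alpha / 2 + 1 / 4) * t * / z]
            [- Q ((alpha + beta + 1) / 2) * t; q * t; Q (alpha + 1) * t;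
             Q (alpha + beta + 3) * t ^ 2] q q.
Proof.
intros Q summand q_neq0 q_mod1 hlog z_neq0 hx _ _ t_neq0 _ hadm hinf hex.
assert (Qplus : forall u v, Q (u + v) = Q u * Q v) by apply cpower_plus.
assert (Q1 : Q 1 = q) by (unfold Q, cpower; rewrite Cmult_1_l; exact hlog).
destruct (Rlt_or_le (Cmod q) 1) as [q_lt1 | q_ge1].
2: { exfalso; apply (qpoch_diverges t q); [lra | exact t_neq0|].
  intros u [<- | []]; apply hinf; simpl; auto. }
assert (hinf' : forall u, In u
  [t; Q (alpha + beta + 3) * t ^ 2;
     Q (alpha + 1); - Q ((alpha + beta + 1) / 2); - Q ((alpha + beta + 2) / 2);
     1 / t; Q (alpha / 2 + 1 / 4) * t * z; Q (alpha / 2 + 1 / 4) * t * / z] ->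
  qpoch_inf u q <> 0).
{ intros u hu; destruct (hinf u hu) as [p [hp hp0]].
  apply cv_Cis_lim in hp; now rewrite (qpoch_inf_eq q q_lt1 q_neq0 _ _ hp). }
clear hinf.
set (A := Q (alpha + beta + 1)) in *.
set (s := Q ((alpha + beta + 1) / 2)) in *.
set (B := Q ((alpha + beta + 2) / 2)) in *.
set (e := Q (alpha / 2 + 1 / 4)) in *.
set (b := Q (alpha + 1)) in *.
assert (two_neq0 : RtoC 2 <> 0) by (intros h; injection h; lra).
assert (four_neq0 : RtoC 4 <> 0) by (intros h; injection h; lra).
assert (eA3 : Q (alpha + beta + 3) = A * q * q).
{ unfold A; rewrite <- Q1, <- !Qplus; f_equal; ring. }
assert (eA2 : Q (alpha + beta + 2) = A * q).
{ unfold A; rewrite <- Q1, <- !Qplus; f_equal; ring. }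
assert (es3 : Q ((alpha + beta + 3) / 2) = s * q).
{ unfold s; rewrite <- Q1, <- !Qplus; f_equal; field; auto. }
assert (es : s * s = A).
{ unfold s, A; rewrite <- !Qplus; f_equal; field; auto. }
assert (eB : B * B = A * q).
{ rewrite <- eA2; unfold B; rewrite <- !Qplus; f_equal; field; auto. }
rewrite ?eA3, ?eA2, ?es3 in *.
assert (t_inf : qpoch_inf t q <> 0) by (apply hinf'; simpl; tauto).
assert (tinv_inf : qpoch_inf (/ t) q <> 0).
{ replace (/ t) with (1 / t) by (field; auto); apply hinf'; simpl; tauto. }
assert (b_inf : qpoch_inf b q <> 0) by (apply hinf'; simpl; tauto).
assert (ms_inf : qpoch_inf (- s) q <> 0) by (apply hinf'; simpl; tauto).
assert (mB_inf : qpoch_inf (- B) q <> 0) by (apply hinf'; simpl; tauto).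
assert (A2_inf : qpoch_inf (A * q * q * t ^ 2) q <> 0) by (apply hinf'; simpl; tauto).
assert (x1t_inf : qpoch_inf (e * z * t) q <> 0).
{ replace (e * z * t) with (e * t * z) by ring; apply hinf'; simpl; tauto. }
assert (x2t_inf : qpoch_inf (e * / z * t) q <> 0).
{ replace (e * / z * t) with (e * t * / z) by ring; apply hinf'; simpl; tauto. }
assert (s_adm : forall n, qpoch s q n <> 0) by (apply hadm; simpl; tauto).
assert (A1_adm : forall n, qpoch (A * q * q * t) q n <> 0) by (apply hadm; simpl; tauto).
assert (mst_adm : forall n, qpoch (- s * t) q n <> 0) by (apply hadm; simpl; tauto).
assert (bt_adm : forall n, qpoch (b * t) q n <> 0) by (apply hadm; simpl; tauto).
assert (hsum : forall n, summand n
  = bailey_coef q A (ratio q s B b (e * z) (e * / z)) n * t ^ n).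
{ intros n.
  rewrite <- (askey_wilson_coef q A s B b (e * z) (e * / z) q_lt1 q_neq0 es s_adm
    b_inf ms_inf mB_inf n).
  unfold summand, q_jacobi; rewrite hx, askey_wilsonE by exact z_neq0.
  fold Q; fold s; fold B; fold e; unfold askey_wilson_z.
  rewrite psum_sum_n.
  set (e' := Q (alpha / 2 + 3 / 4)); set (f := Q (beta / 2 + 1 / 4));
    set (f' := Q (beta / 2 + 3 / 4)).
  assert (h1 : e * e' = b).
  { unfold e, e', b; rewrite <- Qplus; f_equal; field; auto. }
  assert (h2 : e * - f = - s).
  { transitivity (- (e * f)); [ring|].
    unfold e, f, s; rewrite <- Qplus; f_equal; f_equal; field; auto. }
  assert (h3 : e * - f' = - B).
  { transitivity (- (e * f')); [ring|].
    unfold e, f', B; rewrite <- Qplus; f_equal; f_equal; field; auto. }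
  assert (h4 : q ^ n / q * (e * e' * - f * - f') = A * q ^ n).
  { assert (h : e * e' * - f * - f' = A * q).
    { rewrite <- eA2; transitivity (e * e' * f * f'); [ring|].
      unfold e, e', f, f'; rewrite <- !Qplus; f_equal; field; auto. }
    rewrite h; field; auto. }
  rewrite h4, h1, h2, h3.
  rewrite (cpower_mult_INR logq (alpha / 2 + 1 / 4) n : Q _ = e ^ n).
  unfold qpochs; simpl map; simpl fold_right.
  assert (hb := qpoch_neq0 q q_lt1 q_neq0 _ n b_inf).
  assert (hs := qpoch_neq0 q q_lt1 q_neq0 _ n ms_inf).
  assert (hB := qpoch_neq0 q q_lt1 q_neq0 _ n mB_inf).
  assert (hq := qfact_neq0 q q_lt1 q_neq0 n).
  assert (hsn := s_adm n).
  assert (hen : e ^ n <> 0) by (apply Cpow_nz; apply cpower_neq0).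
  match goal with |- ?L = ?R =>
    match L with context [psum ?g (S n)] => match R with context [psum ?g' (S n)] =>
      rewrite (psum_ext g g') end end end.
  - rewrite es3; field; repeat split; auto.
  - intros k _.
    assert (hb' := qpoch_neq0 q q_lt1 q_neq0 _ k b_inf).
    assert (hs' := qpoch_neq0 q q_lt1 q_neq0 _ k ms_inf).
    assert (hB' := qpoch_neq0 q q_lt1 q_neq0 _ k mB_inf).
    assert (hq' := qfact_neq0 q q_lt1 q_neq0 k).
    field; repeat split; auto. }
destruct hex as [l hl]; apply cs_is_series in hl.
rewrite (cs_Cseries _ _ hl).
apply (cs_ext _ _ _ hsum) in hl.
rewrite (generating_function q A t s B b (e * z) (e * / z) q_lt1 q_neq0 t_neq0 t_inf tinv_inf
  es eB s_adm b_inf ms_inf mB_inf A1_adm A2_inf mst_adm bt_adm x1t_inf x2t_inf l hl).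
replace (e * t * z) with (e * z * t) by ring.
replace (e * t * / z) with (e * / z * t) by ring.
replace (1 / t) with (/ t) by (field; auto).
unfold phi, qpochs, qpochs_inf; cbn [map fold_right].
apply (f_equal2 Cplus); apply (f_equal2 Cmult).
1, 3: apply (f_equal2 Cdiv); ring.
all: apply f_equal, functional_extensionality; intros k.
all: apply (f_equal2 Cmult); [apply (f_equal2 Cdiv); ring | reflexivity].
Qed.
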